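(* Consider the two-player nested system $x(t+1)=Ax(t)+Bu(t)+v(t)$, $t=0,\dots,N-1$, with $A,B$ lower block triangular, where at each time $u_1(t)$ must be a function of $\mathcal F_1(t)=\{x_1(0:t),u_1(0:t-1)\}$ and $u_2(t)$ a function of $\mathcal F_2(t)=\{x_1(0:t-1),u_1(0:t-1),x_2(0:t),u_2(0:t-1)\}$, and the common objective is to minimize $$\mathbb E\Big[\sum_{t=0}^{N-1}\big(x(t)'Qx(t)+u(t)'Ru(t)\big)+x(N)'Sx(N)\Big].$$ Then the optimal control law is given by $$u(t)=F^*(t)\begin{bmatrix} x_1(t)-\hat x_1(t) \\ x_2(t)-\hat{\hat x}_2(t)\end{bmatrix}+\tilde K(t),\qquad F^*(t)=\begin{bmatrix} F^*_{11}(t)&0 \\ 0&F^*_{22}(t)\end{bmatrix},$$ where $$\tilde K(t)=\begin{bmatrix} K_{11}(t)&K_{12}(t)&\mathbf 0 \\ K_{21}(t)&K_{22}(t)&J(t)\end{bmatrix}\begin{bmatrix}\hat x_1(t) \\ \hat x_2(t) \\ \hat{\hat x}_2(t)-\hat x_2(t)\end{bmatrix}.$$ Here $F^*_{11}(t),F^*_{22}(t)$ are the gains on the current observations $x_1(t),x_2(t)$ in the linear optimal law, $K(t)=(K_{ij}(t))$ is given by the backward recursion $$P(N)=S,\quad P(t)=A'P(t+1)A+A'P(t+1)BK(t)+Q,\quad K(t)=-(B'P(t+1)B+R)^{-1}B'P(t+1)A,$$ and $J(t)$ is given by the backward recursion $$\tilde P(N)=S_{22},\quad \tilde P(t)=A_{22}'\tilde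 P(t+1)A_{22}+A_{22}'\tilde P(t+1)B_{22}J(t)+Q_{22},$$ $$J(t)=-(B_{22}'\tilde P(t+1)B_{22}+R_{22})^{-1}B_{22}'\tilde P(t+1)A_{22}.$$
   Context: Prime denotes transpose; $z(0:t)$ denotes $(z(0),\dots,z(t))$. The state, input and noise are partitioned as $x=(x_1,x_2)$, $u=(u_1,u_2)$, $v=(v_1,v_2)$ and $A=\begin{bmatrix} A_{11}&0 \\ A_{21}&A_{22}\end{bmatrix}$, $B=\begin{bmatrix} B_{11}&0 \\ B_{21}&B_{22}\end{bmatrix}$; $Q_{22},R_{22},S_{22}$ are the lower-right blocks of $Q,R,S$ in the corresponding partitions. $Q,R,S$ are positive definite. The initial state $x(0)$ is zero-mean Gaussian, independent of the noise; $v(t)$ is zero-mean Gaussian with covariance $V$, independent across time. Admissible laws are $u_i(t)=f_i(\mathcal F_i(t),t)$. Set $\mathcal H_i(t)=\{x_i(0:t-1),u_i(0:t-1)\}$, so $\mathcal F_1(t)=\{x_1(t),\mathcal H_1(t)\}$ and $\mathcal F_2(t)=\{x_2(t),\mathcal H_1(t),\mathcal H_2(t)\}$. The problem has a linear optimal law, which can be written $u_1(t)=F^*_{11}(t)x_1(t)+L_1(\mathcal H_1(t))$, $u_2(t)=F^*_{22}(t)x_2(t)+L_2(\mathcal H_1(t),\mathcal H_2(t))$ with $L_1,L_2$ linear (possibly time-varying); this defines $F^*_{11}(t),F^*_{22}(t)$. The estimators are $\hat x(t)=\mathbb E[x(t)\mid\mathcal H_1(t)]$ and $\hat{\hat x}(t)=\mathbb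 E[x(t)\mid\mathcal H_1(t),\mathcal H_2(t)]$, with blocks $\hat x=(\hat x_1,\hat x_2)$, $\hat{\hat x}=(\hat{\hat x}_1,\hat{\hat x}_2)$. *)

(* Defs.v *)
From HB Require Import structures.
From mathcomp Require Import all_boot all_order all_algebra.
From mathcomp Require Import all_classical all_reals all_analysis.

Set Implicit Arguments.
Unset Strict Implicit.
Unset Printing Implicit Defensive.

Import Order.TTheory GRing.Theory Num.Theory.
Import numFieldNormedType.Exports.

Local Open Scope classical_set_scope.
Local Open Scope ring_scope.

(* The sigma-algebra on matrices is generated by the entries, exactly as the
   library does for tuples; over a realType it is the Borel sigma-algebra. *)
Definition mx_display : measure_display -> measure_display.
Proof. exact. Qed.

Section measurable_matrix.
Context {d : measure_display} {T : measurableType d} (m n : nat).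

Definition mx_measurable : set (set 'M[T]_(m, n)) :=
  <<s \bigcup_(ij : 'I_m * 'I_n)
        preimage_set_system setT (fun M : 'M[T]_(m, n) => M ij.1 ij.2)
          measurable >>.

Lemma mx_measurable0 : mx_measurable set0.
Proof. exact: sigma_algebra0. Qed.

Lemma mx_measurableC A : mx_measurable A -> mx_measurable (~` A).
Proof. exact: sigma_algebraC. Qed.

Lemma mx_measurable_bigcup (F : (set 'M[T]_(m, n))^nat) :
  (forall i, mx_measurable (F i)) -> mx_measurable (\bigcup_i F i).
Proof. exact: sigma_algebra_bigcup. Qed.

HB.instance Definition _ := @isMeasurable.Build (mx_display d) 'M[T]_(m, n)
  mx_measurable mx_measurable0 mx_measurableC mx_measurable_bigcup.

End measurable_matrix.

Section linear_algebra.
Context {R : realType}.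

Definition quad n (M : 'M[R]_n) (z : 'cV[R]_n) : R := (z^T *m M *m z) 0 0.

Definition posdefmx n (M : 'M[R]_n) : Prop :=
  M^T = M /\ forall z : 'cV[R]_n, z != 0 -> 0 < quad M z.

(* The backward recursion of the finite-horizon linear-quadratic regulator
   with dynamics (A, B), stage weights (Q, W) and terminal weight S. *)
Definition riccati n m (N : nat) (A : 'M[R]_n) (B : 'M[R]_(n, m))
    (Q : 'M[R]_n) (W : 'M[R]_m) (S : 'M[R]_n)
    (P : nat -> 'M[R]_n) (K : nat -> 'M[R]_(m, n)) : Prop :=
  P N = S /\
  forall t, (t < N)%N ->
    P t = A^T *m P t.+1 *m A + A^T *m P t.+1 *m B *m K t + Q /\
    K t = - (invmx (B^T *m P t.+1 *m B + W) *m (B^T *m P t.+1 *m A)).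

End linear_algebra.

Section probability.
Context {d : measure_display} {Omega : measurableType d} {R : realType}.
Variable P : probability Omega R.

(* The law N(0, s^2); [normal_prob] is not the Dirac mass when s = 0. *)
Definition centered_normal (s : R) (U : set R) : \bar R :=
  if s == 0 then \d_(0 : R) U else normal_prob 0 s U.

(* Zero-mean Gaussian vector, possibly degenerate: every linear functional
   of it is a centered normal variable. *)
Definition gaussian_vector n (X : Omega -> 'cV[R]_n) : Prop :=
  measurable_fun [set: Omega] X /\
  forall a : 'cV[R]_n, exists s : R,
    forall U : set R, measurable U ->
      P ((fun w => (a^T *m X w) 0 0) @^-1` U) = centered_normal s U.

Definition covariance_matrix n (X : Omega -> 'cV[R]_n) (V : 'M[R]_n) : Prop :=
  forall i j, covariance P (fun w => X w i 0) (fun w => X w j 0) = (V i j)%:E.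

Definition mutually_independent (I : finType) d' (T : measurableType d')
    (X : I -> Omega -> T) : Prop :=
  forall (E : {set I}) (G : I -> set Omega),
    (forall i, i \in E -> g_sigma_algebra_preimage (X i) (G i)) ->
    P (\bigcap_(i in [set` E]) G i) = (\prod_(i in E) P (G i))%E.

(* Z is a version of E[X | Y]. *)
Definition cond_expectation d' (T : measurableType d') (Y : Omega -> T)
    (X Z : Omega -> R) : Prop :=
  [/\ P.-integrable [set: Omega] (EFin \o X),
      P.-integrable [set: Omega] (EFin \o Z),
      forall U : set R, measurable U -> g_sigma_algebra_preimage Y (Z @^-1` U)
    & forall G, g_sigma_algebra_preimage Y G ->
        (\int[P]_(w in G) (Z w)%:E = \int[P]_(w in G) (X w)%:E)%E].

Definition cond_expectation_vec d' (T : measurableType d') (Y : Omega -> T)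
    n (X Z : Omega -> 'cV[R]_n) : Prop :=
  forall i, cond_expectation Y (fun w => X w i 0) (fun w => Z w i 0).

End probability.

(* The type of H_i(t) = (x_i(0:t-1), u_i(0:t-1)), each z(0:t-1) being stored as
   the matrix with columns z(0), ..., z(t-1). It is a notation so that the
   product carries its library module and measurable structures. *)
Notation local_hist R n m t := ('M[R]_(n, t) * 'M[R]_(m, t))%type.

Section two_players.
Context {R : realType} {n1 n2 m1 m2 : nat}.

Definition hist n (z : nat -> 'cV[R]_n) (t : nat) : 'M[R]_(n, t) :=
  \matrix_(i, s) z s i 0.

Local Notation hist1 t := (local_hist R n1 m1 t).
Local Notation hist2 t := (local_hist R n2 m2 t).

(* Player 1 acts on F_1(t) = (x_1(t), H_1(t)) and player 2 on
   F_2(t) = (x_2(t), (H_1(t), H_2(t))). *)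
Record law := Law {
  law1 : forall t, 'cV[R]_n1 * hist1 t -> 'cV[R]_m1;
  law2 : forall t, 'cV[R]_n2 * (hist1 t * hist2 t) -> 'cV[R]_m2 }.

Definition admissible (N : nat) (f : law) : Prop :=
  forall t, (t < N)%N ->
    measurable_fun [set: 'cV[R]_n1 * hist1 t] (@law1 f t) /\
    measurable_fun [set: 'cV[R]_n2 * (hist1 t * hist2 t)] (@law2 f t).

Definition linear_law
    (F11 : nat -> 'M[R]_(m1, n1)) (F22 : nat -> 'M[R]_(m2, n2))
    (L1 : forall t, {linear hist1 t -> 'cV[R]_m1})
    (L2 : forall t, {linear (hist1 t * hist2 t)%type -> 'cV[R]_m2}) : law :=
  Law (fun t y => F11 t *m y.1 + L1 t y.2)
      (fun t y => F22 t *m y.1 + L2 t y.2).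

Implicit Types (x : nat -> 'cV[R]_(n1 + n2)) (u : nat -> 'cV[R]_(m1 + m2)).

Definition H1 x u (t : nat) : hist1 t :=
  (hist (fun s => usubmx (x s)) t, hist (fun s => usubmx (u s)) t).

Definition H2 x u (t : nat) : hist2 t :=
  (hist (fun s => dsubmx (x s)) t, hist (fun s => dsubmx (u s)) t).

Definition apply_law (f : law) x u (t : nat) : 'cV[R]_(m1 + m2) :=
  col_mx (law1 f (usubmx (x t), H1 x u t))
         (law2 f (dsubmx (x t), (H1 x u t, H2 x u t))).

Section closed_loop.
Variables (A : 'M[R]_(n1 + n2)) (B : 'M[R]_(n1 + n2, m1 + m2)).

(* [trajectory t] is a pair (x, u) that is meaningful for x(0:t) and
   u(0:t-1) only. *)
Fixpoint trajectory (f : law) (z0 : 'cV[R]_(n1 + n2))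
    (v : nat -> 'cV[R]_(n1 + n2)) (t : nat) :
    (nat -> 'cV[R]_(n1 + n2)) * (nat -> 'cV[R]_(m1 + m2)) :=
  if t is r.+1 then
    let: (x, u) := trajectory f z0 v r in
    let ur := apply_law f x u r in
    (fun s => if s == r.+1 then A *m x r + B *m ur + v r else x s,
     fun s => if s == r then ur else u s)
  else (fun=> z0, fun=> 0).

Definition path_state (f : law) (z0 : 'cV[R]_(n1 + n2))
    (v : nat -> 'cV[R]_(n1 + n2)) (t : nat) : 'cV[R]_(n1 + n2) :=
  (trajectory f z0 v t).1 t.
Definition path_control (f : law) (z0 : 'cV[R]_(n1 + n2))
    (v : nat -> 'cV[R]_(n1 + n2)) (t : nat) : 'cV[R]_(m1 + m2) :=
  (trajectory f z0 v t.+1).2 t.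

Implicit Types (z : 'cV[R]_(n1 + n2)) (v : nat -> 'cV[R]_(n1 + n2)).

Lemma trajectory_state f z0 v t s : (s <= t)%N ->
  (trajectory f z0 v t).1 s = path_state f z0 v s.
Proof.
elim: t => [|t IHt]; first by rewrite leqn0 => /eqP ->.
rewrite leq_eqVlt => /predU1P[-> //|]; rewrite ltnS => st.
rewrite -IHt //=; case: (trajectory f z0 v t) => x u /=.
by rewrite ltn_eqF // ltnS.
Qed.

Lemma trajectory_control f z0 v t s : (s < t)%N ->
  (trajectory f z0 v t).2 s = path_control f z0 v s.
Proof.
elim: t => // t IHt; rewrite ltnS leq_eqVlt => /predU1P[-> //|st].
rewrite -IHt //=; case: (trajectory f z0 v t) => x u /=.
by rewrite ltn_eqF.
Qed.

Lemma eq_apply_law f x u x' u' t :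
  (forall s, (s <= t)%N -> x s = x' s) ->
  (forall s, (s < t)%N -> u s = u' s) ->
  apply_law f x u t = apply_law f x' u' t.
Proof.
move=> xx' uu'; rewrite /apply_law.
have -> : H1 x u t = H1 x' u' t.
  by congr pair; apply/matrixP => i s; rewrite !mxE ?xx' ?uu' // ltnW.
have -> : H2 x u t = H2 x' u' t.
  by congr pair; apply/matrixP => i s; rewrite !mxE ?xx' ?uu' // ltnW.
by rewrite xx'.
Qed.

Lemma path_controlE f z0 v t :
  path_control f z0 v t
  = apply_law f (path_state f z0 v) (path_control f z0 v) t.
Proof.
rewrite {1}/path_control /=.
have Ex s (st : (s <= t)%N) := trajectory_state f z0 v st.
have Eu s (st : (s < t)%N) := trajectory_control f z0 v st.
case: (trajectory f z0 v t) Ex Eu => x u /= Ex Eu.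
by rewrite eqxx; apply: eq_apply_law.
Qed.

Lemma path_stateS f z0 v t :
  path_state f z0 v t.+1
  = A *m path_state f z0 v t + B *m path_control f z0 v t + v t.
Proof.
rewrite /path_state /path_control /=.
by case: (trajectory f z0 v t) => x u /=; rewrite !eqxx.
Qed.

Context {Omega : Type}.
Variables (f : law) (x0 : Omega -> 'cV[R]_(n1 + n2))
  (v : nat -> Omega -> 'cV[R]_(n1 + n2)).

(* The closed-loop processes x and u under the law f. *)
Definition state (t : nat) (w : Omega) : 'cV[R]_(n1 + n2) :=
  path_state f (x0 w) (v^~ w) t.

Definition control (t : nat) (w : Omega) : 'cV[R]_(m1 + m2) :=
  path_control f (x0 w) (v^~ w) t.

Lemma state0 (w : Omega) : state 0 w = x0 w.
Proof. by []. Qed.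

Lemma stateS t w : state t.+1 w = A *m state t w + B *m control t w + v t w.
Proof. exact: path_stateS. Qed.

Lemma controlE t w : control t w = apply_law f (state^~ w) (control^~ w) t.
Proof. exact: path_controlE. Qed.

End closed_loop.

Section optimality.
Context {d : measure_display} {Omega : measurableType d}.
Variables (P : probability Omega R) (N : nat).
Variables (A : 'M[R]_(n1 + n2)) (B : 'M[R]_(n1 + n2, m1 + m2)).
Variables (Q : 'M[R]_(n1 + n2)) (W : 'M[R]_(m1 + m2)) (S : 'M[R]_(n1 + n2)).
Variables (x0 : Omega -> 'cV[R]_(n1 + n2))
  (v : nat -> Omega -> 'cV[R]_(n1 + n2)).

(* For positive definite weights the integrand is nonnegative, so the cost is
   well defined, possibly +oo. *)
Definition cost (f : law) : \bar R :=
  let x := state A B f x0 v in let u := control A B f x0 v in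
  ('E_P[fun w => (\sum_(t < N) (quad Q (x t w) + quad W (u t w))
                  + quad S (x N w))%R])%E.

Definition optimal (f : law) : Prop :=
  admissible N f /\ forall g, admissible N g -> (cost f <= cost g)%E.

(* F*(t) (x_1 - xh_1, x_2 - xhh_2)
     + [K_11 K_12 0; K_21 K_22 J] (xh_1, xh_2, xhh_2 - xh_2). *)
Definition estimator_feedback (F11 : 'M[R]_(m1, n1)) (F22 : 'M[R]_(m2, n2))
    (K : 'M[R]_(m1 + m2, n1 + n2)) (J : 'M[R]_(m2, n2))
    (x xh xhh : 'cV[R]_(n1 + n2)) : 'cV[R]_(m1 + m2) :=
  block_mx F11 0 0 F22
    *m col_mx (usubmx x - usubmx xh) (dsubmx x - dsubmx xhh)
  + row_mx K (col_mx 0 J) *m col_mx xh (dsubmx xhh - dsubmx xh).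

(* xh(t) = E[x(t) | H_1(t)] and xhh(t) = E[x(t) | H_1(t), H_2(t)] are taken
   along the closed loop of f itself. *)
Definition given_by_estimators (F11 : nat -> 'M[R]_(m1, n1))
    (F22 : nat -> 'M[R]_(m2, n2)) (K : nat -> 'M[R]_(m1 + m2, n1 + n2))
    (J : nat -> 'M[R]_(m2, n2)) (f : law) : Prop :=
  let x := state A B f x0 v in let u := control A B f x0 v in
  exists xh xhh : nat -> Omega -> 'cV[R]_(n1 + n2),
  forall t, (t < N)%N ->
    [/\ cond_expectation_vec P (fun w => H1 (x^~ w) (u^~ w) t) (x t) (xh t),
        cond_expectation_vec P
          (fun w => (H1 (x^~ w) (u^~ w) t, H2 (x^~ w) (u^~ w) t))
          (x t) (xhh t)
      & {ae P, forall w, u t w =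
          estimator_feedback (F11 t) (F22 t) (K t) (J t)
            (x t w) (xh t w) (xhh t w)}].

End optimality.
End two_players.

Arguments law : clear implicits.

(* Main.v *)
From HB Require Import structures.
Require Import Defs.
From mathcomp Require Import all_boot all_order all_algebra.
From mathcomp Require Import all_classical all_reals all_analysis.
From mathcomp Require Import measurable_realfun ring lra.

(* Write lambda for the costate, lambda(N) = S x(N), lambda(t) = Q x(t) + A' lambda(t+1),
   so that half the derivative of the cost in the direction of u(t) is
   grad(t) = R u(t) + B' lambda(t+1), R being the input weight (W below).

   Stationarity.  Let the linear optimal law be perturbed at time t by k h e_i, with h a
   square-integrable function of the information of player j.  The closed loop responds by k h
   times a deterministic trajectory, so optimality and backward induction on t give
   E[grad_j(t) | F_j(t)] = 0.

   Uniqueness.  For every admissible law, F_j(t) generates the same sigma-algebra, that of the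
   noise observed so far.  The cost being quadratic, stationarity makes the excess cost of any law
   equal to the positive definite form evaluated at the deviation of its trajectory from the linear
   optimal one; hence the optimal laws are those with almost surely the same control.

   Shape of the control.  Conditioning on H_1(t), which is contained in F_1(t) and in F_2(t),
   gives E[lambda(t) - P(t) x(t) | H_1(t)] = 0 and E[u(t) - K(t) x(t) | H_1(t)] = 0 by backward
   induction.  The same induction applies to (x_2, u_2, lambda_2) when "conditional mean zero"
   is replaced by "conditional mean given (H_1(t), H_2(t)) is a function of H_1(t)": x_1(t)
   and u_1(t) have this property because they are functions of H_1(t) and of noise that is
   independent of (H_1(t), H_2(t)).  It yields the gain J(t).  Since u_1 - F_11 x_1 is a function
   of H_1 and u_2 - F_22 x_2 a function of (H_1, H_2), this determines the control.

   Gaussianity is used only through finite second moments and zero means. *)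

Set Implicit Arguments.
Unset Strict Implicit.
Unset Printing Implicit Defensive.

Import Order.TTheory GRing.Theory Num.Theory.
Import numFieldNormedType.Exports.

Local Open Scope classical_set_scope.
Local Open Scope ring_scope.

(** * Measurable factorization *)

Section measurable_mx.
Context {d : measure_display} {T : measurableType d}.

(** The two players are not symmetric. The linear law feeds a perturbation at time t back into later
    inputs, and the first-order effect of these must be removed by stationarity at later times. For
    a perturbation of player 1 this works because F_1(t) is contained in both F_1(s) and F_2(s) for
    s > t. The test variable of player 2 is in general unknown to player 1 at all later times; there
    the lower block triangular form of A and B is used: an input of player 2 never moves x_1 or u_1.

    Measurability with respect to observations is carried by explicit factoring maps rather than by
    sub-sigma-algebras. Such a map can be evaluated again on the history produced by another law,
    and this is how an estimator moves between two laws whose histories agree only almost surely.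
    The need arises because the estimators of a law are conditional expectations along its own
    closed loop: two laws have to be compared forward in time, the controls before t deciding the
    estimators at t and these the controls at t. *)

Lemma measurable_mx_entry d' (U : measurableType d') m n (i : 'I_m) (j : 'I_n) :
  measurable_fun [set: 'M[U]_(m, n)] (fun M => M i j).
Proof.
move=> _ B mB; rewrite setTI; apply: sub_sigma_algebra.
by exists (i, j) => //; exists B => //; rewrite setTI.
Qed.

Lemma measurable_fun_mx d' (U : measurableType d') m n (f : T -> 'M[U]_(m, n)) :
  (forall i j, measurable_fun setT (fun w => f w i j)) -> measurable_fun setT f.
Proof.
move=> mf; apply: (@measurability _ _ _ _ _ _
  (\bigcup_(ij : 'I_m * 'I_n)
     preimage_set_system setT (fun M : 'M[U]_(m, n) => M ij.1 ij.2) measurable)) => //.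
by move=> _ [_ [[i j] _ [B mB <-]] <-]; rewrite setTI; exact: mf.
Qed.

End measurable_mx.

Section factors.
Context {T : Type}.

(** The Doob-Dynkin form of measurability of [X] with respect to [Y]. The equality holds at every
    point, so that neither a sigma-algebra nor a measure on [T] is involved. *)
Definition factors {d1 d2} {U1 : measurableType d1} {U2 : measurableType d2}
  (Y : T -> U1) (X : T -> U2) :=
  exists2 phi : U1 -> U2, measurable_fun setT phi & forall w, X w = phi (Y w).

Lemma factors_refl d1 (U1 : measurableType d1) (Y : T -> U1) : factors Y Y.
Proof. by exists id => //; exact: measurable_id. Qed.

Lemma factors_comp d1 d2 d3 (U1 : measurableType d1) (U2 : measurableType d2)
  (U3 : measurableType d3) (Y : T -> U1) (X : T -> U2) (phi : U2 -> U3) :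
  measurable_fun setT phi -> factors Y X -> factors Y (fun w => phi (X w)).
Proof.
move=> mphi [psi mpsi E]; exists (phi \o psi); first exact: measurableT_comp.
by move=> w /=; rewrite E.
Qed.

Lemma factors_trans d1 d2 d3 (U1 : measurableType d1) (U2 : measurableType d2)
  (U3 : measurableType d3) (Y : T -> U1) (X : T -> U2) (Z : T -> U3) :
  factors Y X -> factors X Z -> factors Y Z.
Proof.
move=> YX [phi mphi E]; have -> : Z = (fun w => phi (X w)) by apply/funext.
exact: factors_comp.
Qed.

Lemma factors_pair d1 d2 d3 (U1 : measurableType d1) (U2 : measurableType d2)
  (U3 : measurableType d3) (Y : T -> U1) (X : T -> U2) (Z : T -> U3) :
  factors Y X -> factors Y Z -> factors Y (fun w => (X w, Z w)).
Proof.
move=> [phi mphi Ephi] [psi mpsi Epsi]; exists (fun y => (phi y, psi y)).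
  exact: measurable_fun_pair.
by move=> w; rewrite Ephi Epsi.
Qed.

Lemma factors_fst d1 d2 d3 (U1 : measurableType d1) (U2 : measurableType d2)
  (U3 : measurableType d3) (Y : T -> U1) (X : T -> U2 * U3) :
  factors Y X -> factors Y (fun w => (X w).1).
Proof. by apply: factors_comp; exact: measurable_fst. Qed.

Lemma factors_snd d1 d2 d3 (U1 : measurableType d1) (U2 : measurableType d2)
  (U3 : measurableType d3) (Y : T -> U1) (X : T -> U2 * U3) :
  factors Y X -> factors Y (fun w => (X w).2).
Proof. by apply: factors_comp; exact: measurable_snd. Qed.

Lemma factors_entry d1 d2 (U1 : measurableType d1) (U2 : measurableType d2)
  (Y : T -> U1) m n (X : T -> 'M[U2]_(m, n)) i j :
  factors Y X -> factors Y (fun w => X w i j).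
Proof. exact: (factors_comp (@measurable_mx_entry _ U2 m n i j)). Qed.

Lemma factors_mx d1 d2 (U1 : measurableType d1) (U2 : measurableType d2)
  (Y : T -> U1) m n (X : T -> 'M[U2]_(m, n)) :
  (forall i j, factors Y (fun w => X w i j)) -> factors Y X.
Proof.
move=> H; have /choice[phi Hphi] : forall ij : 'I_m * 'I_n, exists phi : U1 -> U2,
    measurable_fun setT phi /\ forall w, X w ij.1 ij.2 = phi (Y w).
  by move=> [i j]; have [phi ? ?] := H i j; exists phi.
exists (fun y => \matrix_(i, j) phi (i, j) y).
  apply: measurable_fun_mx => i j; have [mphi _] := Hphi (i, j).
  by apply: (eq_measurable_fun (phi (i, j))) => // w _; rewrite mxE.
by move=> w; apply/matrixP => i j; rewrite mxE -(Hphi (i, j)).2.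
Qed.

Lemma factors_cst d1 d2 (U1 : measurableType d1) (U2 : measurableType d2)
  (Y : T -> U1) (c : U2) : factors Y (fun=> c).
Proof. by exists (fun=> c) => //; exact: measurable_cst. Qed.

End factors.

Section factors_linear.
Context {T : Type} {R : realType} {d1} {U1 : measurableType d1} (Y : T -> U1).

Lemma factorsD_real (X Z : T -> R) : factors Y X -> factors Y Z ->
  factors Y (fun w => X w + Z w).
Proof.
move=> [phi mphi Ephi] [psi mpsi Epsi]; exists (fun y => phi y + psi y).
  exact: measurable_funD.
by move=> w; rewrite Ephi Epsi.
Qed.

Lemma factorsZ_real (c : R) (X : T -> R) : factors Y X ->
  factors Y (fun w => c * X w).
Proof.
move=> [phi mphi Ephi]; exists (fun y => c * phi y).
  exact: measurable_funM.
by move=> w; rewrite Ephi.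
Qed.

Lemma factors_sum_real I (s : seq I) (p : pred I) (X : I -> T -> R) :
  (forall i, factors Y (X i)) -> factors Y (fun w => \sum_(i <- s | p i) X i w).
Proof.
move=> H; elim: s => [|i s IHs].
  by under eq_fun do rewrite big_nil; exact: factors_cst.
under eq_fun do rewrite big_cons; case: (p i) => //.
exact: factorsD_real.
Qed.

Lemma factors_mulmx m n p (M : 'M[R]_(m, n)) (X : T -> 'M[R]_(n, p)) :
  factors Y X -> factors Y (fun w => M *m X w).
Proof.
move=> H; apply: factors_mx => i j; under eq_fun do rewrite mxE.
by apply: factors_sum_real => k; apply: factorsZ_real; exact: factors_entry.
Qed.

Lemma factorsD m n (X Z : T -> 'M[R]_(m, n)) : factors Y X -> factors Y Z ->
  factors Y (fun w => X w + Z w).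
Proof.
move=> HX HZ; apply: factors_mx => i j; under eq_fun do rewrite mxE.
by apply: factorsD_real; exact: factors_entry.
Qed.

Lemma factorsN m n (X : T -> 'M[R]_(m, n)) : factors Y X ->
  factors Y (fun w => - X w).
Proof.
move=> HX; apply: factors_mx => i j; under eq_fun do rewrite mxE -mulN1r.
by apply: factorsZ_real; exact: factors_entry.
Qed.

Lemma factorsB m n (X Z : T -> 'M[R]_(m, n)) : factors Y X -> factors Y Z ->
  factors Y (fun w => X w - Z w).
Proof. by move=> HX HZ; apply: factorsD => //; exact: factorsN. Qed.

Lemma factors_usubmx m1 m2 n (X : T -> 'M[R]_(m1 + m2, n)) : factors Y X ->
  factors Y (fun w => usubmx (X w)).
Proof.
by move=> HX; apply: factors_mx => i j; under eq_fun do rewrite mxE; exact: factors_entry.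
Qed.

Lemma factors_dsubmx m1 m2 n (X : T -> 'M[R]_(m1 + m2, n)) : factors Y X ->
  factors Y (fun w => dsubmx (X w)).
Proof.
by move=> HX; apply: factors_mx => i j; under eq_fun do rewrite mxE; exact: factors_entry.
Qed.

Lemma factors_col_mx m1 m2 n (X : T -> 'M[R]_(m1, n)) (Z : T -> 'M[R]_(m2, n)) :
  factors Y X -> factors Y Z -> factors Y (fun w => col_mx (X w) (Z w)).
Proof.
move=> HX HZ; apply: factors_mx => i j; case: (split_ordP i) => k ->.
  by under eq_fun do rewrite col_mxEu; exact: factors_entry.
by under eq_fun do rewrite col_mxEd; exact: factors_entry.
Qed.

Lemma factors_submx m1 m2 n (X : T -> 'M[R]_(m1 + m2, n)) :
  factors Y (fun w => usubmx (X w)) -> factors Y (fun w => dsubmx (X w)) ->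
  factors Y X.
Proof.
move=> Hu Hd; have -> : X = fun w => col_mx (usubmx (X w)) (dsubmx (X w)).
  by apply/funext => w; rewrite vsubmxK.
exact: factors_col_mx.
Qed.

Lemma factors_hist n (x : T -> nat -> 'cV[R]_n) t :
  (forall s, (s < t)%N -> factors Y (x^~ s)) -> factors Y (fun w => hist (x w) t).
Proof.
move=> H; apply: factors_mx => i j; under eq_fun do rewrite mxE.
exact: factors_entry (H _ (ltn_ord j)).
Qed.

Lemma factors_of_hist n (x : T -> nat -> 'cV[R]_n) t s : (s < t)%N ->
  factors Y (fun w => hist (x w) t) -> factors Y (x^~ s).
Proof.
move=> st H; apply: factors_mx => i j; rewrite (ord1 j).
have := factors_entry i (Ordinal st) H.
by under eq_fun do rewrite mxE.
Qed.

End factors_linear.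

(** * Square integrability and conditional orthogonality *)

Section square_integrable.
Context {d : measure_display} {Omega : measurableType d} {R : realType}.
Variable P : probability Omega R.
Implicit Types X Z : Omega -> R.

Definition integ X := P.-integrable [set: Omega] (EFin \o X).

Lemma integ_measurable X : integ X -> measurable_fun setT X.
Proof. by move=> /measurable_int/measurable_EFinP. Qed.

Lemma integ_dom X Z : measurable_fun setT X -> (forall w, `|X w| <= Z w) ->
  integ Z -> integ X.
Proof.
move=> mX XZ; apply: le_integrable => //; first exact/measurable_EFinP.
by move=> w _ /=; rewrite lee_fin (le_trans (XZ w)) ?ler_norm.
Qed.

Lemma eq_integ X Z : X =1 Z -> integ X -> integ Z.
Proof. by move=> /funext ->. Qed.

Lemma integ_cst c : integ (fun=> c).
Proof. exact: finite_measure_integrable_cst. Qed.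

Lemma integD X Z : integ X -> integ Z -> integ (fun w => X w + Z w).
Proof. by move=> iX iZ; have := integrableD measurableT iX iZ. Qed.

Lemma integZ c X : integ X -> integ (fun w => c * X w).
Proof. by move=> iX; have := integrableZl measurableT c iX. Qed.

Lemma integ_sum I (s : seq I) (p : pred I) (X : I -> Omega -> R) :
  (forall i, p i -> integ (X i)) -> integ (fun w => \sum_(i <- s | p i) X i w).
Proof.
move=> H; elim: s => [|i s IHs].
  by under eq_fun do rewrite big_nil; exact: integ_cst.
under eq_fun do rewrite big_cons.
by case: (boolP (p i)) => // pi; apply: integD => //; exact: H.
Qed.

Definition sqint X := measurable_fun setT X /\ integ (fun w => X w ^+ 2).

Lemma sqint_mul X Z : sqint X -> sqint Z -> integ (fun w => X w * Z w).
Proof.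
move=> [mX iX] [mZ iZ]; apply: (integ_dom _ _ (integD iX iZ)).
  exact: measurable_funM.
(* The bound |X Z| <= X^2 + Z^2 comes from (|X| - |Z|)^2 >= 0. *)
move=> w; rewrite normrM -(real_normK (num_real (X w))).
rewrite -[Z w ^+ 2](real_normK (num_real _)).
have := sqr_ge0 (`|X w| - `|Z w|); have := normr_ge0 (X w); have := normr_ge0 (Z w).
nra.
Qed.

Lemma sqint_cst c : sqint (fun=> c).
Proof. by split; [exact: measurable_cst|exact: integ_cst]. Qed.

Lemma sqint_integ X : sqint X -> integ X.
Proof.
move=> sX; have := sqint_mul (sqint_cst 1) sX.
by apply: eq_integ => w; rewrite mul1r.
Qed.

Lemma sqintD X Z : sqint X -> sqint Z -> sqint (fun w => X w + Z w).
Proof.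
move=> sX sZ; split; first by apply: measurable_funD; [case: sX|case: sZ].
apply: (eq_integ _ (integD (integD (proj2 sX) (integZ 2 (sqint_mul sX sZ))) (proj2 sZ))).
by move=> w; ring.
Qed.

Lemma sqintZ c X : sqint X -> sqint (fun w => c * X w).
Proof.
move=> [mX iX]; split; first exact: measurable_funM.
by apply: (eq_integ _ (integZ (c ^+ 2) iX)) => w; rewrite exprMn.
Qed.

Lemma sqint_sum I (s : seq I) (p : pred I) (X : I -> Omega -> R) :
  (forall i, p i -> sqint (X i)) -> sqint (fun w => \sum_(i <- s | p i) X i w).
Proof.
move=> H; elim: s => [|i s IHs].
  by under eq_fun do rewrite big_nil; exact: sqint_cst.
under eq_fun do rewrite big_cons.
by case: (boolP (p i)) => // pi; apply: sqintD => //; exact: H.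
Qed.

Lemma sqint_indic (A : set Omega) : measurable A -> sqint (\1_A).
Proof.
move=> mA; have mI : measurable_fun setT (\1_A : Omega -> R) by exact: measurable_indic.
split=> //; apply: (integ_dom _ _ (integ_cst 1)); first exact: measurable_funX.
by move=> w; rewrite indicE; case: (_ \in _); rewrite ?expr1n ?expr0n/= ?normr1 ?normr0.
Qed.

Lemma integ_indicM (A : set Omega) X : measurable A -> integ X ->
  integ (fun w => \1_A w * X w).
Proof.
move=> mA iX; apply: (@integ_dom _ (fun w => `|X w|)).
- by apply: measurable_funM; [exact: measurable_indic|exact: integ_measurable].
- by move=> w; rewrite normrM indicE; case: (_ \in _); rewrite ?normr1 ?mul1r// normr0 mul0r.
- exact: integrable_norm.
Qed.

Definition sqintv n (X : Omega -> 'cV[R]_n) := forall i, sqint (fun w => X w i 0).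

Lemma sqintv_mulmx m n (M : 'M[R]_(m, n)) (X : Omega -> 'cV[R]_n) : sqintv X ->
  sqintv (fun w => M *m X w).
Proof.
move=> sX i; under eq_fun do rewrite mxE.
by apply: sqint_sum => j _; exact: sqintZ.
Qed.

Lemma sqintvD n (X Z : Omega -> 'cV[R]_n) : sqintv X -> sqintv Z ->
  sqintv (fun w => X w + Z w).
Proof. by move=> sX sZ i; under eq_fun do rewrite mxE; exact: sqintD. Qed.

Lemma sqintvB n (X Z : Omega -> 'cV[R]_n) : sqintv X -> sqintv Z ->
  sqintv (fun w => X w - Z w).
Proof.
move=> sX sZ i; under eq_fun do rewrite !mxE -mulN1r.
by apply: sqintD => //; exact: sqintZ.
Qed.

Lemma sqintv_usubmx m n (X : Omega -> 'cV[R]_(m + n)) : sqintv X ->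
  sqintv (fun w => usubmx (X w)).
Proof. by move=> sX i; under eq_fun do rewrite mxE; exact: sX. Qed.

Lemma sqintv_dsubmx m n (X : Omega -> 'cV[R]_(m + n)) : sqintv X ->
  sqintv (fun w => dsubmx (X w)).
Proof. by move=> sX i; under eq_fun do rewrite mxE; exact: sX. Qed.

Lemma sqintv_col_mx m n (X : Omega -> 'cV[R]_m) (Z : Omega -> 'cV[R]_n) :
  sqintv X -> sqintv Z -> sqintv (fun w => col_mx (X w) (Z w)).
Proof.
move=> sX sZ i; case: (split_ordP i) => k ->.
  by under eq_fun do rewrite col_mxEu; exact: sX.
by under eq_fun do rewrite col_mxEd; exact: sZ.
Qed.

Lemma sqintv_dot n (X Z : Omega -> 'cV[R]_n) : sqintv X -> sqintv Z ->
  integ (fun w => ((X w)^T *m Z w) 0 0).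
Proof.
move=> sX sZ; under eq_fun do rewrite mxE; apply: integ_sum => i _.
by under eq_fun do rewrite mxE; exact: sqint_mul.
Qed.

Lemma sqintv_quad n (M : 'M[R]_n) (X : Omega -> 'cV[R]_n) : sqintv X -> integ (fun w => quad M (X w)).
Proof.
move=> sX; rewrite /quad; under eq_fun do rewrite -mulmxA.
by apply: sqintv_dot => //; exact: sqintv_mulmx.
Qed.

Lemma Rint_ae_eq (A : set Omega) X Z : measurable A -> measurable_fun setT X ->
  measurable_fun setT Z -> {ae P, forall w, X w = Z w} ->
  \int[P]_(w in A) X w = \int[P]_(w in A) Z w.
Proof.
move=> mA mX mZ XZ; congr fine; apply: ae_eq_integral => //.
- exact/measurable_EFinP/measurable_funTS.
- exact/measurable_EFinP/measurable_funTS.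
by apply: filterS XZ => w /= -> _.
Qed.

(** Measurability of [Z] is assumed because [P] need not be complete. *)
Lemma integ_ae_eq X Z : measurable_fun setT Z ->
  {ae P, forall w, X w = Z w} -> integ X -> integ Z.
Proof.
move=> mZ XZ iX; have mX := integ_measurable iX; apply/integrableP; split.
  exact/measurable_EFinP.
rewrite (_ : (\int[P]_w _)%E = \int[P]_w `|(EFin \o X) w|)%E.
  by case/integrableP: iX.
apply: ae_eq_integral => //.
- by apply: measurableT_comp => //; exact/measurable_EFinP.
- by apply: measurableT_comp => //; exact/measurable_EFinP.
- by apply: filterS XZ => w /= -> _.
Qed.

Lemma Rint_indic (A : set Omega) X : measurable A ->
  \int[P]_(w in A) X w = \int[P]_w (\1_A w * X w).
Proof.
move=> mA; rewrite Rintegral_mkcond; apply: eq_Rintegral => w _ /=.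
by rewrite patchE indicE; case: (_ \in _); rewrite ?mul1r ?mul0r.
Qed.

Lemma ge0_Rint_eq0 X : integ X -> (forall w, 0 <= X w) -> \int[P]_w X w = 0 ->
  {ae P, forall w, X w = 0}.
Proof.
move=> iX X0 EX; have mX := integ_measurable iX.
have : ae_eq P setT (EFin \o X) (cst 0%E).
  apply/ae_eq_integral_abs => //; first exact/measurable_EFinP.
  under eq_integral do rewrite /= ger0_norm//.
  (* A real integral is [fine] of the extended one and would also be 0 if that were infinite;
     integrability excludes this. *)
  move: EX; rewrite /Rintegral => EX; rewrite -[LHS]fineK ?EX//.
  exact: integrable_fin_num iX.
by apply: filterS => w /(_ I) [].
Qed.

End square_integrable.

(** * Variables with vanishing conditional expectation *)

Section orth.
Context {d : measure_display} {Omega : measurableType d} {R : realType}.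
Variable P : probability Omega R.

(* E[X | Y] = 0 *)
Definition orth {d1} {T1 : measurableType d1} (Y : Omega -> T1) (X : Omega -> R) :=
  integ P X /\ forall E, measurable E -> \int[P]_(w in Y @^-1` E) X w = 0.

Section fixed.
Context {d1} {T1 : measurableType d1} (Y : Omega -> T1).
Hypothesis mY : measurable_fun setT Y.

Let mYE E : measurable E -> measurable (Y @^-1` E).
Proof. by move=> mE; rewrite -[_ @^-1` _]setTI; exact: mY. Qed.

Let integrS (A : set Omega) X : measurable A -> integ P X ->
  P.-integrable A (EFin \o X).
Proof. by move=> mA; apply: integrableS. Qed.

Lemma orthD X Z : orth Y X -> orth Y Z -> orth Y (fun w => X w + Z w).
Proof.
move=> [iX oX] [iZ oZ]; split; first exact: integD.
move=> E mE; rewrite RintegralD ?oX ?oZ ?addr0//; first exact: mYE.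
  by apply: integrS => //; exact: mYE.
by apply: integrS => //; exact: mYE.
Qed.

Lemma orthZ c X : orth Y X -> orth Y (fun w => c * X w).
Proof.
move=> [iX oX]; split; first exact: integZ.
move=> E mE; rewrite RintegralZl ?oX ?mulr0//; first exact: mYE.
by apply: integrS => //; exact: mYE.
Qed.

Lemma orth0 : orth Y (fun=> 0).
Proof.
split; first exact: integ_cst.
by move=> E mE; rewrite Rintegral_cst ?mul0r//; exact: mYE.
Qed.

Lemma orth_factors d2 (T2 : measurableType d2) (Y' : Omega -> T2) X :
  factors Y Y' -> orth Y X -> orth Y' X.
Proof.
move=> [phi mphi EY] [iX oX]; split=> // E mE.
have -> : Y' @^-1` E = Y @^-1` (phi @^-1` E).
  by apply/seteqP; split=> w /=; rewrite EY.
by apply: oX; rewrite -[_ @^-1` _]setTI; exact: mphi.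
Qed.

(** The event X > 0 and the whole space are both events of [Y], so |X|, which equals twice the
    positive part of X minus X, has integral 0. The measurability hypothesis is on preimages because
    [cond_expectation] provides it in that form. *)
Lemma orth_preimage_eq0 X :
  (forall U, measurable U -> g_sigma_algebra_preimage Y (X @^-1` U)) ->
  orth Y X -> {ae P, forall w, X w = 0}.
Proof.
move=> sX [iX oX]; pose A := X @^-1` `]0, +oo[%classic.
have [E mE] := sX _ (measurable_itv `]0, +oo[); rewrite setTI => EA.
have mA : measurable A by rewrite /A -EA; exact: mYE.
have AP w : A w = (0 < X w) by rewrite /A /= in_itv/= andbT.
have Xabs w : `|X w| = 2 * (\1_A w * X w) - X w.
  rewrite indicE; case: (boolP (w \in A)) => [|/negP] wA.
    have := set_mem wA; rewrite AP => X0; rewrite gtr0_norm// mul1r; lra.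
  have : ~ 0 < X w by rewrite -AP => X0; apply: wA; exact/mem_set.
  by move/negP; rewrite -leNgt => X0; rewrite ler0_norm// mul0r; lra.
have iA : integ P (fun w => \1_A w * X w) by exact: integ_indicM.
have : {ae P, forall w, `|X w| = 0}.
  apply: ge0_Rint_eq0 => //; first exact: integrable_norm.
  under eq_Rintegral do rewrite Xabs.
  rewrite RintegralB//; last exact: integZ.
  rewrite RintegralZl// -Rint_indic// /A -EA (oX _ mE) mulr0.
  have := oX setT measurableT; rewrite preimage_setT => ->; rewrite subrr//.
by apply: filterS => w /eqP; rewrite normr_eq0 => /eqP.
Qed.

Lemma orth_factors_eq0 X : factors Y X -> orth Y X -> {ae P, forall w, X w = 0}.
Proof.
move=> [phi mphi EX]; apply: orth_preimage_eq0 => U mU.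
exists (phi @^-1` U); first by rewrite -[_ @^-1` _]setTI; exact: mphi.
by rewrite setTI; apply/seteqP; split=> w /=; rewrite EX.
Qed.

Lemma orth_ae_eq X Z : measurable_fun setT Z -> {ae P, forall w, X w = Z w} ->
  orth Y X -> orth Y Z.
Proof.
move=> mZ XZ [iX oX]; split; first exact: integ_ae_eq iX.
move=> E mE; rewrite -(oX _ mE); apply/esym/Rint_ae_eq => //; first exact: mYE.
exact: integ_measurable iX.
Qed.

(** Corresponding events of [Y] and [Y'] differ by null sets. With the events written as indicators,
    this becomes an almost sure equality of integrands. *)
Lemma orth_ae_eqY (Y' : Omega -> T1) X : measurable_fun setT Y' ->
  {ae P, forall w, Y w = Y' w} -> orth Y X -> orth Y' X.
Proof.
move=> mY' YY' [iX oX]; split=> // E mE; rewrite -(oX _ mE).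
have mE' : measurable (Y' @^-1` E) by rewrite -[_ @^-1` _]setTI; exact: mY'.
have mX := integ_measurable iX.
rewrite [LHS]Rint_indic// [RHS]Rint_indic//; last exact: mYE.
apply: Rint_ae_eq => //.
- by apply: measurable_funM => //; exact: measurable_indic.
- by apply: measurable_funM => //; apply: measurable_indic; exact: mYE.
apply: filterS YY' => w /= YY'; congr (_ * _); rewrite !indicE; congr (nat_of_bool _)%:R.
by apply/idP/idP => /set_mem /= H; apply/mem_set; rewrite /= ?YY'// -?YY'.
Qed.

End fixed.

Lemma eq_orth {d1} {T1 : measurableType d1} (Y : Omega -> T1) X Z :
  X =1 Z -> orth Y X -> orth Y Z.
Proof. by move=> /funext ->. Qed.

(** Radon-Nikodym is applied on the space of values of [Y]: the charge taking E to the integral of X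
    over {Y in E} is dominated by the law of [Y], and composing its density with [Y] gives a
    conditional expectation that is a function of [Y] by construction. *)
Lemma condexp_exists {d1} {T1 : measurableType d1} (Y : Omega -> T1) X :
  measurable_fun setT Y -> integ P X ->
  exists Z : Omega -> R, factors Y Z /\ orth Y (fun w => X w - Z w).
Proof.
move=> mY iX.
have mYE E : measurable E -> measurable (Y @^-1` E).
  by move=> mE; rewrite -[_ @^-1` _]setTI; exact: mY.
pose Y' : {mfun Omega >-> T1} := HB.pack Y (isMeasurableFun.Build _ _ _ _ Y mY).
pose mu := distribution P Y'.
pose nu := fun E : set T1 => (\int[P]_(w in Y @^-1` E) (X w)%:E)%E.
have nu0 : nu set0 = 0%E by rewrite /nu preimage_set0 integral_set0.
have nufin A : measurable A -> nu A \is a fin_num.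
  move=> mA; apply: integrable_fin_num; first exact: mYE.
  by apply: integrableS iX => //; exact: mYE.
have nusa : semi_sigma_additive nu.
  move=> F mF tF mUF; rewrite /nu preimage_bigcup.
  have sa : semi_sigma_additive (induced_charge (iX : P.-integrable setT _)).
    exact: charge_semi_sigma_additive.
  apply: (sa (fun n => Y @^-1` F n)) => //.
  - by move=> n; exact: mYE.
  - apply/trivIsetP => /= i j _ _ ij; rewrite -preimage_setI.
    by move/trivIsetP : tF => /(_ _ _ _ _ ij) ->//; rewrite preimage_set0.
  - by rewrite -preimage_bigcup; exact: mYE.
pose nuC : {charge set T1 -> \bar R} :=
  HB.pack nu (isCharge.Build _ _ _ nu nu0 nufin nusa).
have numu : nuC `<< mu.
  apply/null_content_dominatesP => A mA muA0.
  apply: null_set_integral; [exact: mYE| |exact: muA0].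
  by apply: measurable_funTS; exact: measurable_int iX.
pose g := Radon_Nikodym nuC mu.
have gE A : measurable A -> nu A = (\int[mu]_(x in A) g x)%E.
  by move=> mA; rewrite -(Radon_Nikodym_integral numu mA).
have gfin y : g y \is a fin_num by exact: Radon_Nikodym_fin_num.
have ig : mu.-integrable setT g by exact: Radon_Nikodym_integrable.
have mg : measurable_fun setT g by exact: measurable_int ig.
pose Z w := fine (g (Y w)).
have EZ : EFin \o Z = g \o Y by apply/funext => w /=; rewrite fineK.
have iZ : integ P Z.
  rewrite /integ EZ; apply/integrableP; split; first exact: measurableT_comp.
  case/integrableP : ig => _.
  by rewrite ge0_integral_distribution//; exact: measurableT_comp.
exists Z; split.
  by exists (fine \o g) => //; exact: measurableT_comp.
split.
  by apply: (eq_integ _ (integD iX (integZ (-1) iZ))) => w; rewrite mulN1r.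
move=> E mE; rewrite RintegralB; last 3 first.
- exact: mYE.
- by apply: integrableS iX => //; exact: mYE.
- by apply: integrableS iZ => //; exact: mYE.
apply/eqP; rewrite subr_eq0; apply/eqP; congr fine.
rewrite -[LHS]/(nu E) gE// /mu /distribution integral_pushforward//.
  by apply: eq_integral => w _; rewrite /Z /= fineK.
rewrite -EZ; apply: integrableS iZ => //; exact: mYE.
Qed.

End orth.

(** * Moments of centered normal variables *)

(** Bundles a measurable function into the form that [distribution] takes; the equation serves to
    translate back. *)
Lemma mfun_exists d1 d2 (T1 : measurableType d1) (T2 : measurableType d2)
  (X : T1 -> T2) : measurable_fun setT X -> exists X' : {mfun T1 >-> T2}, X' = X :> (T1 -> T2).
Proof.
move=> mX; pose X' : {mfun T1 >-> T2} := HB.pack X (isMeasurableFun.Build _ _ _ _ X mX).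
by exists X'.
Qed.

Section normal_moments.
Context {R : realType}.
Local Notation mu := (@lebesgue_measure R).

(** The density is even and Lebesgue measure is invariant under reflection. This symmetry later
    yields the zero mean without computing a first moment. *)
Lemma normal_probN (s : R) (U : set R) : s != 0 -> measurable U ->
  normal_prob 0 s (-%R @^-1` U) = normal_prob 0 s U.
Proof.
move=> s0 mU; rewrite /normal_prob.
have mpdf : measurable_fun setT (fun x : R => (normal_pdf 0 s x)%:E).
  by apply/measurable_EFinP; exact: measurable_normal_pdf.
pose f := fun x : R => (normal_pdf 0 s x)%:E.
transitivity (\int[mu]_(x in -%R @^-1` U) (f \o (-%R : _ -> measurableTypeR R)) x)%E.
  apply: eq_integral => x _; congr EFin.
  by rewrite !normal_pdfE// /normal_fun !subr0 sqrrN.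
transitivity (\int[pushforward mu (-%R : _ -> measurableTypeR R)]_(x in U) f x)%E.
  apply: esym; apply: ge0_integral_pushforward.
  - exact: (@oppr_measurable R).
  - exact: mU.
  - exact: measurable_funTS.
  - by move=> x _; rewrite lee_fin normal_pdf_ge0.
by rewrite {}/f; apply: eq_measure_integral => A mA _; exact: lebesgue_measureN.
Qed.

(** The Radon-Nikodym derivative and [normal_pdf] have the same integral over every measurable set,
    hence agree almost everywhere; the change of variables formula can then be read with the
    explicit density. *)
Lemma ge0_integral_normal_prob (s : R) (f : R -> \bar R) :
  measurable_fun setT f -> (forall x, 0 <= f x)%E ->
  (\int[normal_prob 0 s]_x f x = \int[mu]_x (f x * (normal_pdf 0 s x)%:E))%E.
Proof.
move=> mf f0; have dom := normal_prob_dominates (0 : R) s.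
rewrite -(Radon_Nikodym_SigmaFinite.change_of_variables dom)//.
have mRN : measurable_fun setT
    (Radon_Nikodym_SigmaFinite.f (normal_prob 0 s) mu).
  exact: measurable_int (Radon_Nikodym_SigmaFinite.f_integrable dom).
have mpdf : measurable_fun setT (fun x : R => (normal_pdf 0 s x)%:E).
  by apply/measurable_EFinP; exact: measurable_normal_pdf.
apply: ae_eq_integral => //.
- exact: emeasurable_funM.
- exact: emeasurable_funM.
apply: ae_eqe_mul2l; apply: integral_ae_eq => //.
  exact: Radon_Nikodym_SigmaFinite.f_integrable.
by move=> E _ mE; rewrite -Radon_Nikodym_SigmaFinite.f_integral.
Qed.

(** The function x^2 times the density of standard deviation s is bounded by a multiple of the
    density of standard deviation 2s, whose integral is 1. *)
Lemma normal_second_moment (s : R) : s != 0 ->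
  (\int[normal_prob 0 s]_x (x ^+ 2)%:E < +oo)%E.
Proof.
move=> s0; rewrite ge0_integral_normal_prob; last 2 first.
- by apply/measurable_EFinP; exact: measurable_funX.
- by move=> x; rewrite lee_fin sqr_ge0.
pose s2 := 2 * s; have s20 : s2 != 0 by rewrite mulf_neq0.
have ss : 0 < s ^+ 2 by rewrite exprn_even_gt0.
(* With y = 3 x^2 / (8 s^2), the exponent splits as - x^2 / (2 s^2) = - x^2 / (8 s^2) - y, and y <=
   exp y gives x^2 exp(-y) <= (8/3) s^2. The quotient of the peaks changes the normalization. *)
pose C : R := 8 / 3 * s ^+ 2 * normal_peak s / normal_peak s2.
have p2 := normal_peak_gt0 s20; have p1 := normal_peak_gt0 s0.
have C0 : 0 <= C by apply: divr_ge0; [apply: mulr_ge0; [apply: mulr_ge0; [lra|exact: ltW]|exact: ltW]|exact: ltW].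
have mpdf k : measurable_fun setT (fun x : R => (normal_pdf 0 k x)%:E).
  by apply/measurable_EFinP; exact: measurable_normal_pdf.
apply: (@le_lt_trans _ _ (\int[mu]_x (C%:E * (normal_pdf 0 s2 x)%:E))%E).
  apply: ge0_le_integral => //.
  - by move=> x _; rewrite -EFinM lee_fin mulr_ge0 ?sqr_ge0 ?normal_pdf_ge0.
  - by apply: emeasurable_funM; [apply/measurable_EFinP; exact: measurable_funX|exact: mpdf].
  - by apply: emeasurable_funM; [exact: measurable_cst|exact: mpdf].
  move=> x _; rewrite -!EFinM lee_fin !normal_pdfE// /normal_fun !subr0.
  have -> : C * (normal_peak s2 * expR (- x ^+ 2 / (s2 ^+ 2 *+ 2))) =
    normal_peak s * (8 / 3 * s ^+ 2 * expR (- x ^+ 2 / (s2 ^+ 2 *+ 2))).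
    by rewrite /C; field; rewrite gt_eqF.
  rewrite mulrCA ler_pM2l//.
  have -> : - x ^+ 2 / (s ^+ 2 *+ 2) =
      - x ^+ 2 / (s2 ^+ 2 *+ 2) - 3 / 8 * x ^+ 2 / s ^+ 2.
    by rewrite /s2; field.
  rewrite expRD mulrCA [leRHS]mulrC ler_pM2l ?expR_gt0//.
  rewrite expRN ler_pdivrMr ?expR_gt0//.
  have := expR_ge1Dx (3 / 8 * x ^+ 2 / s ^+ 2).
  set y := expR _ => Hy.
  have -> : x ^+ 2 = 8 / 3 * s ^+ 2 * (3 / 8 * x ^+ 2 / s ^+ 2) by field.
  by apply: ler_wpM2l; [rewrite mulr_ge0// ltW|lra].
rewrite ge0_integralZl//.
- by rewrite integral_normal_pdf mule1 ltry.
- exact: mpdf.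
- by move=> x _; rewrite lee_fin normal_pdf_ge0.
Qed.

End normal_moments.

Section gaussian.
Context {d : measure_display} {Omega : measurableType d} {R : realType}.
Variable P : probability Omega R.

(** In the degenerate case X is almost surely 0. Otherwise the second moment is that of the normal
    law, and X and -X have the same law, so the mean equals its opposite. *)
Lemma centered_normal_moments (X : Omega -> R) (s : R) :
  measurable_fun setT X ->
  (forall U, measurable U -> P (X @^-1` U) = centered_normal s U) ->
  sqint P X /\ \int[P]_w X w = 0.
Proof.
move=> mX; rewrite /centered_normal; have [_ lawX|s0 lawX] := eqVneq s 0.
  have X0 : {ae P, forall w, 0 = X w}.
    exists (~` (X @^-1` [set 0])); split.
    - by apply: measurableC; rewrite -[_ @^-1` _]setTI; exact: mX.
    - have m0 : measurable (X @^-1` [set (0 : R)]).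
        by rewrite -[_ @^-1` _]setTI; exact: mX.
      rewrite probability_setC// lawX// diracE mem_set//=.
      by rewrite subee.
    - by move=> w /= H X0; apply: H; rewrite X0.
  split; last by rewrite -(Rint_ae_eq measurableT _ _ X0)// Rintegral_cst// mul0r.
  split=> //; apply: (integ_ae_eq _ _ (@integ_cst _ _ _ P 0)).
    exact: measurable_funX.
  by apply: filterS X0 => w /= <-; rewrite expr0n.
have [X' EX'] := mfun_exists (mX : measurable_fun setT (X : Omega -> measurableTypeR R)).
have iX2 : integ P (fun w => X w ^+ 2).
  apply/integrableP; split; first by apply/measurable_EFinP; exact: measurable_funX.
  apply: le_lt_trans (normal_second_moment s0).
  rewrite (_ : (\int[normal_prob 0 s]_x (x ^+ 2)%:E =
      \int[distribution P X']_x (x ^+ 2)%:E)%E); last first.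
    apply: eq_measure_integral => A mA _.
    change (normal_prob 0 s A = P (X' @^-1` A)).
    by rewrite EX'; exact/esym/lawX.
  rewrite ge0_integral_distribution//=; last 2 first.
  - by apply/measurable_EFinP; exact: measurable_funX.
  - by move=> y; rewrite lee_fin sqr_ge0.
  rewrite EX'; under eq_integral do rewrite ger0_norm ?sqr_ge0//.
  by [].
split=> //; have sX : sqint P X by [].
have iX := sqint_integ sX.
have mXn : measurable_fun setT (fun w => - X w) by exact: measurable_funN.
have [Xn EXn] := mfun_exists (mXn : measurable_fun setT ((fun w => - X w) : Omega -> measurableTypeR R)).
have mE : measurable_fun setT (EFin : measurableTypeR R -> \bar R).
  exact: (@EFin_measurable R).
have EX : (\int[P]_w (- X w)%:E = \int[P]_w (X w)%:E)%E.
  transitivity (\int[distribution P Xn]_y y%:E)%E.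
    rewrite (integral_distribution mE) ?EXn//.
    by apply: (eq_integ _ (integZ (-1) iX)) => w; rewrite mulN1r.
  transitivity (\int[distribution P X']_y y%:E)%E; last first.
    by rewrite (integral_distribution mE) ?EX'.
  apply: eq_measure_integral => A mA _.
  change (P (Xn @^-1` A) = P (X' @^-1` A)); rewrite EX' EXn.
  apply: etrans (esym (lawX _ mA)); rewrite -normal_probN// -lawX//.
  by rewrite -[_ @^-1` _]setTI; exact: (@oppr_measurable R).
have : \int[P]_w (-1 * X w) = \int[P]_w X w.
  by rewrite /Rintegral; under eq_integral do rewrite mulN1r; rewrite EX.
rewrite RintegralZl//; lra.
Qed.

End gaussian.

(** * Independence *)

Section independence.
Context {d : measure_display} {Omega : measurableType d} {R : realType}.
Variable P : probability Omega R.

Definition indep {d1 d2} {T1 : measurableType d1} {T2 : measurableType d2}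
    (Y : Omega -> T1) (e : Omega -> T2) :=
  forall A B, measurable A -> measurable B ->
    P (Y @^-1` A `&` e @^-1` B) = (P (Y @^-1` A) * P (e @^-1` B))%E.

Lemma indep_factors d1 d2 d3 (T1 : measurableType d1) (T2 : measurableType d2)
    (T3 : measurableType d3) (Y : Omega -> T1) (e : Omega -> T2) (Y' : Omega -> T3) :
  factors Y Y' -> indep Y e -> indep Y' e.
Proof.
move=> [phi mphi EY] ie A B mA mB.
have -> : Y' @^-1` A = Y @^-1` (phi @^-1` A).
  by apply/seteqP; split=> w /=; rewrite EY.
by apply: ie => //; rewrite -[_ @^-1` _]setTI; exact: mphi.
Qed.

(** Independence makes the law of (Y, e) a product, by uniqueness on rectangles, and Fubini
    integrates [e] out with [Y] frozen. [F] is extended-real valued because single sections of [g]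
    may fail to be integrable. *)
Lemma indep_fubini d1 d2 (T1 : measurableType d1) (T2 : measurableType d2)
    (Y : Omega -> T1) (e : {mfun Omega >-> T2}) (g : T1 * T2 -> R) :
  measurable_fun setT Y -> indep Y e -> measurable_fun setT g ->
  integ P (fun w => g (Y w, e w)) ->
  let F y := (\int[distribution P e]_z (g (y, z))%:E)%E in
  [/\ measurable_fun setT F, P.-integrable setT (F \o Y) &
     (\int[P]_w (g (Y w, e w))%:E = \int[P]_w F (Y w))%E].
Proof.
move=> mY ie mg ig F; have [Y' EY] := mfun_exists mY.
have mYe : measurable_fun setT (fun w => (Y w, e w)) by exact: measurable_fun_pair.
have [W EW] := mfun_exists mYe.
have mG : measurable_fun setT (EFin \o g) by exact/measurable_EFinP.
pose mu := distribution P Y'; pose nu := distribution P e.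
have law A : measurable A -> (mu \x nu)%E A = distribution P W A.
  apply: product_measure_unique => A1 A2 mA1 mA2.
  change (P (W @^-1` (A1 `*` A2)) = (P (Y' @^-1` A1) * P (e @^-1` A2))%E).
  by rewrite EW EY -ie.
have iG : ((mu \x nu)%E).-integrable setT (EFin \o g).
  apply/integrableP; split=> //.
  rewrite (_ : (\int[(mu \x nu)]_p _ = \int[distribution P W]_p `|(EFin \o g) p|)%E); last first.
    by apply: eq_measure_integral => A mA _; exact: law.
  rewrite ge0_integral_distribution//; last exact: measurableT_comp.
  by rewrite EW; case/integrableP : ig.
have mF : measurable_fun setT F by exact: measurable_fubini_F iG.
have iF : mu.-integrable setT F by exact: integrable_fubini_F iG.
split=> //.
  apply/integrableP; split; first exact: measurableT_comp.
  case/integrableP : iF => _; rewrite ge0_integral_distribution ?EY//.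
  exact: measurableT_comp.
transitivity (\int[distribution P W]_p (EFin \o g) p)%E.
  by rewrite integral_distribution ?EW.
transitivity (\int[(mu \x nu)]_p (EFin \o g) p)%E.
  by apply: eq_measure_integral => A mA _; exact/esym/law.
rewrite -(integral12_prod_meas1 iG) integral_distribution ?EY//.
apply/integrableP; split; first exact: measurableT_comp.
case/integrableP : iF => _; rewrite ge0_integral_distribution ?EY//.
exact: measurableT_comp.
Qed.

(** Freezing: if X = psi(Y1, e) with [e] independent of [Y], and [Y1] is a function of [Y], then
    E[X | Y] is the mean of psi(y, e) at y = Y1. The information in [Y] beyond [Y1] does not
    enter. *)
Lemma indep_condexp d1 d2 d3 (T1 : measurableType d1) (T2 : measurableType d2)
    (T3 : measurableType d3) (Y : Omega -> T1) (e : Omega -> T2)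
    (Y1 : Omega -> T3) (X : Omega -> R) :
  measurable_fun setT Y -> measurable_fun setT e -> indep Y e -> factors Y Y1 ->
  factors (fun w => (Y1 w, e w)) X -> integ P X ->
  exists Z : Omega -> R, factors Y1 Z /\ orth P Y (fun w => X w - Z w).
Proof.
move=> mY me ie YY1 [psi mpsi EX] iX.
have mY1 : measurable_fun setT Y1.
  case: YY1 => phi mphi /funext ->; exact: measurableT_comp.
have ie1 : indep Y1 e by exact: indep_factors ie.
case: YY1 => chi mchi EY1.
have [e' Ee] := mfun_exists me; subst e.
have iX1 : integ P (fun w => psi (Y1 w, e' w)) by apply: eq_integ iX.
have [mF iF _] := indep_fubini mY1 ie1 mpsi iX1.
set F := (fun y => _) in mF iF.
(* [fine] replaces infinite values by 0; integrability of [F] along [Y1] confines them to a null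
   set. *)
pose Z w := fine (F (Y1 w)).
have mZ : measurable_fun setT Z by exact: measurableT_comp (measurableT_comp mF mY1).
have iZ : integ P Z.
  apply: le_integrable iF => //; first exact/measurable_EFinP.
  move=> w _ /=; rewrite /Z; case: (F (Y1 w)) => [r| |] //=; rewrite ?normr0 ?leey//.
have ZF : {ae P, forall w, (Z w)%:E = F (Y1 w)}.
  by apply: filterS (integrable_ae measurableT iF) => w /(_ I) /= /fineK.
have mYE E : measurable E -> measurable (Y @^-1` E).
  by move=> mE; rewrite -[_ @^-1` _]setTI; exact: mY.
exists Z; split; first by exists (fine \o F) => //; exact: measurableT_comp.
split; first by apply: (eq_integ _ (integD iX (integZ (-1) iZ))) => w; rewrite mulN1r.
move=> E mE; rewrite RintegralB; last 3 first.
- exact: mYE.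
- by apply: integrableS iX => //; exact: mYE.
- by apply: integrableS iZ => //; exact: mYE.
apply/eqP; rewrite subr_eq0; apply/eqP.
rewrite [LHS]Rint_indic; last exact: mYE.
rewrite [RHS]Rint_indic; last exact: mYE.
(* Fubini is used at the level of the larger variable [Y], so that the indicator of the test event
   is constant in the inner integral. *)
pose g (p : T1 * T2) : R := \1_E p.1 * psi (chi p.1, p.2).
have mg : measurable_fun setT g.
  apply: measurable_funM.
    by apply: (measurableT_comp (measurable_indic mE)); exact: measurable_fst.
  apply: (measurableT_comp mpsi); apply: measurable_fun_pair.
    by apply: (measurableT_comp mchi); exact: measurable_fst.
  exact: measurable_snd.
have gE w : g (Y w, e' w) = \1_(Y @^-1` E) w * X w by rewrite /g /= -EY1 -EX.
have ig : integ P (fun w => g (Y w, e' w)).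
  by apply: (eq_integ (fun w => esym (gE w))); apply: integ_indicM => //; exact: mYE.
have [_ _] := indep_fubini mY ie mg ig.
under eq_integral do rewrite gE.
rewrite /Rintegral => ->; congr fine; apply: ae_eq_integral => //.
- have [mFg _ _] := indep_fubini mY ie mg ig; exact: measurableT_comp mFg mY.
- by apply/measurable_EFinP/measurable_funM => //; apply: measurable_indic; exact: mYE.
apply: filterS ZF => w ZF _.
rewrite EFinM ZF /g/= EY1.
have -> : \1_(Y @^-1` E) w = \1_E (Y w) :> R.
  by rewrite !indicE.
have [wE|wE] := boolP (Y w \in E).
  rewrite indicE wE mul1e; apply: eq_integral => z _; by rewrite mul1r.
by rewrite indicE (negbTE wE) mul0e; under eq_integral do rewrite mul0r; rewrite integral0.
Qed.

End independence.

(** * Independence of the past from the present noise *)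

Section noise.
Context {d : measure_display} {Omega : measurableType d} {R : realType}.
Variable P : probability Omega R.
Variables (n N : nat) (x0 : Omega -> 'cV[R]_n) (v : nat -> Omega -> 'cV[R]_n).

(** The initial state counts as the noise of time 0 and [v] is shifted by one, so that [noise t] is
    the disturbance entering x(t). *)
Definition noise t : Omega -> 'cV[R]_n := if t is r.+1 then v r else x0.

Hypothesis mnoise : forall t, (t <= N)%N -> measurable_fun setT (noise t).
Hypothesis mindep : mutually_independent P
    (fun i : option 'I_N => if i is Some t then v t else x0).

Lemma noise_prob_bigcap (B : nat -> set 'cV[R]_n) t : (t <= N.+1)%N ->
  (forall s, (s < t)%N -> measurable (B s)) ->
  P (\bigcap_(s in `I_t) noise s @^-1` B s) =
  (\prod_(s < t) P (noise s @^-1` B s))%E.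
Proof.
move=> tN mB.
(* [insub r] is [None] for r >= N, so [ix] is injective only up to time N; this is the origin of the
   bound t <= N + 1. *)
pose ix (s : nat) : option 'I_N := if s is r.+1 then insub r else None.
pose xi (i : option 'I_N) : nat := if i is Some r then r.+1 else 0.
have ixK s : (s <= N)%N -> xi (ix s) = s.
  by case: s => //= r rN; rewrite insubT.
have st (s : 'I_t) : (s <= N)%N by rewrite -ltnS (leq_trans (ltn_ord s)).
pose E := [set ix s | s : 'I_t]%SET.
have inE' i : i \in E -> (xi i < t)%N by move=> /imsetP[s _ ->]; rewrite ixK ?st.
have Xi (i : option 'I_N) : noise (xi i) = if i is Some r then v r else x0 by case: i.
have := mindep (E := E) (G := fun i => noise (xi i) @^-1` B (xi i)).
have H i : i \in E -> g_sigma_algebra_preimage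
    (if i is Some t0 then v t0 else x0) (noise (xi i) @^-1` B (xi i)).
  by move=> /inE' it; exists (B (xi i)); [exact: mB|rewrite setTI Xi].
move=> /(_ H) EP; transitivity (P (\bigcap_(i in [set` E]) noise (xi i) @^-1` B (xi i))).
  congr (P _); apply/seteqP; split=> w /= Hw.
    by move=> i /= /inE' it; apply: Hw.
  move=> s /= ts; have sN : (s <= N)%N by rewrite -ltnS (leq_trans ts).
  have := Hw (ix s); rewrite /= ixK//; apply.
  by apply/imsetP; exists (Ordinal ts).
rewrite EP big_imset /=; first by apply: eq_bigr => s _; rewrite ixK ?st.
move=> s r _ _ sr; apply/val_inj => /=.
by rewrite -(ixK _ (st s)) -(ixK _ (st r)) sr.
Qed.

(** Uniqueness of finite measures on a generating family stable under intersection: with B fixed,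
    both sides are finite measures in A, and on boxes, whose columns are constrained separately,
    they agree by independence of the whole family. *)
Lemma indep_hist_noise t : (t <= N)%N ->
  indep P (fun w => hist (noise^~ w) t) (noise t).
Proof.
move=> tN A B mA mB.
pose H w := hist (noise^~ w) t.
have mH : measurable_fun setT H.
  apply: measurable_fun_mx => i j; apply: (eq_measurable_fun (fun w => noise j w i 0)).
    by move=> w _; rewrite mxE.
  apply: (measurableT_comp (@measurable_mx_entry _ R n 1 i 0)).
  by apply: mnoise; rewrite (leq_trans _ tN)// ltnW.
have [H' EH] := mfun_exists mH.
have mE C : measurable C -> measurable (noise t @^-1` C).
  by move=> mC; rewrite -[_ @^-1` _]setTI; exact: mnoise.
have m1m (D : set Omega) (mD : measurable D) : {m : {measure set 'M[R]_(n, t) -> \bar R} |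
    forall A, m A = P (H @^-1` A `&` D)}.
  unshelve eexists (pushforward (mrestr P mD) H'); first by [].
  move=> C; by rewrite /= /pushforward /mrestr EH.
have [m1 Em1] := m1m _ (mE _ mB).
have [m2 Em2] : {m : {measure set 'M[R]_(n, t) -> \bar R} |
    forall A, m A = (P (noise t @^-1` B) * P (H @^-1` A))%E}.
  have p0 : 0 <= fine (P (noise t @^-1` B)) by exact: fine_ge0.
  exists (mscale (NngNum p0) (distribution P H')) => C.
  rewrite /= /mscale /= fineK ?fin_num_measure//; last exact: mE.
  by congr (_ * P _)%E; rewrite EH.
suff : m1 A = m2 A by rewrite Em1 Em2 muleC.
pose box (C : 'I_t -> set 'cV[R]_n) := [set M : 'M[R]_(n, t) | forall j, C j (col j M)].
have mbox C : (forall j, measurable (C j)) -> measurable (box C).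
  move=> mC; rewrite (_ : box C = \bigcap_(j in [set: 'I_t]) (col j @^-1` C j)); last first.
    by apply/seteqP; split=> M /= H1; [move=> j _; exact: H1|move=> j; exact: H1].
  apply: fin_bigcap_measurable => // j _; rewrite -[_ @^-1` _]setTI.
  have mcol : measurable_fun setT (fun M : 'M[R]_(n, t) => col j M); last exact: mcol.
  apply: measurable_fun_mx => i k; apply: (eq_measurable_fun (fun M : 'M[R]_(n, t) => M i j)).
    by move=> M _; rewrite mxE.
  exact: measurable_mx_entry.
apply: (measure_unique [set box C | C in [set C | forall j, measurable (C j)]] (fun=> setT)) => //.
- apply/seteqP; split; last first.
    apply: smallest_sub; first exact: sigma_algebra_measurable.
    by move=> _ [C mC <-]; exact: mbox.
  apply: smallest_sub; first exact: smallest_sigma_algebra.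
  move=> _ [[i j] _ [D mD <-]]; apply: sub_sigma_algebra.
  (* A condition on the entry (i, j) is the box constraining column j only. *)
  exists (fun k => if k == j then [set c : 'cV[R]_n | D (c i 0)] else setT).
    move=> k; case: eqP => // _; rewrite -[X in measurable X]setTI.
    exact: (@measurable_mx_entry _ R n 1 i 0).
  rewrite setTI; apply/seteqP; split=> M /= HM.
    by have := HM j; rewrite eqxx /= mxE.
  by move=> k; case: eqP => // ->; rewrite /= mxE.
- move=> _ _ [C mC <-] [D mD <-]; exists (fun j => C j `&` D j).
    by move=> j; exact: measurableI.
  apply/seteqP; split=> M /= HM; first by split=> j; case: (HM j).
  by move=> j; split; case: HM.
- by move=> _; exists (fun=> setT) => //; apply/seteqP; split.
- by rewrite bigcup_const.
- move=> _ [C mC <-]; rewrite Em1 Em2.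
  (* Appending B as the side at time t turns the joint event into one intersection over the times up
     to t. *)
  pose BB s := if insub s is Some j then C j else B.
  have BBj (j : 'I_t) : BB j = C j by rewrite /BB valK.
  have BBt : BB t = B by rewrite /BB insubF ?ltnn.
  have mBB s : measurable (BB s) by rewrite /BB; case: insub.
  have HE : H @^-1` box C = \bigcap_(s in `I_t) noise s @^-1` BB s.
    apply/seteqP; split=> w /= HC.
      move=> s /= st; have := HC (Ordinal st); rewrite -BBj /=.
      congr (BB s _); apply/matrixP => i j; by rewrite !mxE (ord1 j).
    move=> j; have := HC j (ltn_ord j); rewrite /= BBj.
    congr (C j _); apply/matrixP => i k; by rewrite !mxE (ord1 k).
  have -> : H @^-1` box C `&` noise t @^-1` B = \bigcap_(s in `I_t.+1) noise s @^-1` BB s.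
    rewrite HE -BBt; apply/seteqP; split=> w /=.
      move=> [H1 H2] s /=; rewrite ltnS leq_eqVlt => /predU1P[->//|]; exact: H1.
    by move=> H1; split; [move=> s /= st; apply: H1; exact: ltnW|exact: (H1 t (ltnSn t))].
  rewrite HE noise_prob_bigcap//; first rewrite noise_prob_bigcap ?leqW//.
  by rewrite big_ord_recr /= BBt muleC.
- move=> _; rewrite Em1 (le_lt_trans (probability_le1 _ _)) ?ltry//.
  by rewrite preimage_setT setTI; exact: mE.
Qed.
End noise.

(** * Quadratic forms, Riccati recursions and the linear-quadratic cost *)

Section entries.
Context {R : realType} {m n : nat}.
Implicit Types X Y : 'M[R]_(m, n).

(** Unlike [mxE], these rules open a single operation and leave products and blocks folded. *)
Lemma entryD X Y i j : (X + Y) i j = X i j + Y i j. Proof. by rewrite mxE. Qed.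

Lemma entryN X i j : (- X) i j = - X i j. Proof. by rewrite mxE. Qed.

Lemma entryZ c X i j : (c *: X) i j = c * X i j. Proof. by rewrite mxE. Qed.

End entries.

Section quadratic.
Context {R : realType}.

Lemma quadD n (M : 'M[R]_n) (x y : 'cV[R]_n) : M^T = M ->
  quad M (x + y) = quad M x + 2 * (y^T *m (M *m x)) 0 0 + quad M y.
Proof.
move=> sM; rewrite /quad [(x + y)^T]linearD /= !mulmxDl !mulmxDr !entryD.
have -> : (x^T *m M *m y) 0 0 = (y^T *m (M *m x)) 0 0.
  by rewrite -[in LHS](trmxK (x^T *m M *m y)) [LHS]mxE !trmx_mul trmxK sM.
by rewrite -(mulmxA y^T M x); ring.
Qed.

Lemma quadZ n (M : 'M[R]_n) (c : R) (x : 'cV[R]_n) : quad M (c *: x) = c ^+ 2 * quad M x.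
Proof. by rewrite /quad [(c *: x)^T]linearZ /= -!scalemxAl -scalemxAr !entryZ expr2 mulrA. Qed.

Lemma quadDl n (M M' : 'M[R]_n) (x : 'cV[R]_n) :
  quad (M + M') x = quad M x + quad M' x.
Proof. by rewrite /quad mulmxDr mulmxDl entryD. Qed.

Lemma quad0 n (M : 'M[R]_n) : quad M 0 = 0.
Proof. by rewrite /quad mulmx0 mxE. Qed.

Definition possemidefmx n (M : 'M[R]_n) : Prop :=
  M^T = M /\ forall z : 'cV[R]_n, 0 <= quad M z.

Lemma posdef_semidef n (M : 'M[R]_n) : posdefmx M -> possemidefmx M.
Proof.
move=> [sM pM]; split=> // z; have [->|z0] := eqVneq z 0; first by rewrite quad0.
exact/ltW/pM.
Qed.

Lemma posdef_eq0 n (M : 'M[R]_n) z : posdefmx M -> quad M z = 0 -> z = 0.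
Proof.
move=> [sM pM] Mz; apply/eqP; apply: contraT => /pM; by rewrite Mz ltxx.
Qed.

Lemma posdef_unit n (M : 'M[R]_n) : posdefmx M -> M \in unitmx.
Proof.
move=> pM; rewrite -row_free_unit -kermx_eq0; apply/eqP/row_matrixP => i.
rewrite row0; set r := row i _; apply: trmx_inj; rewrite trmx0.
apply: (posdef_eq0 pM); rewrite /quad trmxK.
have -> : r *m M = 0 by rewrite /r -row_mul mulmx_ker row0.
by rewrite mul0mx mxE.
Qed.

(** Cauchy-Schwarz for the inner product of M, as the i-th coordinate of z is the M-product of z
    with the i-th column of the inverse of M. It bounds the entries of an input by the cost. *)
Lemma posdef_entry_bound n (M : 'M[R]_n) (i : 'I_n) : posdefmx M ->
  exists c, forall z : 'cV[R]_n, z i 0 ^+ 2 <= c * quad M z.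
Proof.
move=> pM; have uM := posdef_unit pM; have [sM _] := pM.
pose y := invmx M *m (delta_mx i 0 : 'cV[R]_n).
have My : M *m y = delta_mx i 0 by rewrite /y mulKVmx.
exists (quad M y) => z.
have zi : z i 0 = (y^T *m (M *m z)) 0 0.
  have -> : y^T *m (M *m z) = (delta_mx i 0)^T *m z.
    by rewrite mulmxA -My [(M *m y)^T]trmx_mul sM.
  by rewrite trmx_delta -rowE mxE.
have q0 := (posdef_semidef pM).2 y.
have [q|q] := eqVneq (quad M y) 0.
  have y0 := posdef_eq0 pM q; rewrite zi y0 trmx0 mul0mx mxE expr0n.
  by rewrite /= mulr_ge0// (posdef_semidef pM).2.
have qp : 0 < quad M y by rewrite lt_neqAle eq_sym q.
(* With q = quad M y, the form at q z - z_i y equals q (q quad M z - z_i^2). *)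
have := (posdef_semidef pM).2 (quad M y *: z + (- z i 0) *: y).
rewrite quadD// !quadZ [(_ *: y)^T]linearZ /= -!scalemxAr -scalemxAl !entryZ -zi.
move=> H; rewrite -(ler_pM2l qp); nra.
Qed.

Lemma possemidef_add n (M M' : 'M[R]_n) : possemidefmx M -> posdefmx M' ->
  posdefmx (M + M').
Proof.
move=> [sM pM] [sM' pM']; split; first by rewrite linearD /= sM sM'.
by move=> z z0; rewrite quadDl; have := pM z; have := pM' z z0; lra.
Qed.

Lemma possemidef_congr m n (M : 'M[R]_n) (B : 'M[R]_(n, m)) : possemidefmx M ->
  possemidefmx (B^T *m M *m B).
Proof.
move=> [sM pM]; split; first by rewrite !trmx_mul trmxK sM mulmxA.
by move=> z; have := pM (B *m z); rewrite /quad trmx_mul !mulmxA.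
Qed.

Lemma posdef_drsubmx n1 n2 (M : 'M[R]_(n1 + n2)) : posdefmx M ->
  posdefmx (drsubmx M).
Proof.
move=> [sM pM]; split; first by rewrite -[in RHS]sM trmx_drsub.
move=> z z0; have := pM (col_mx 0 z).
have -> : quad M (col_mx 0 z) = quad (drsubmx M) z.
  rewrite /quad -[in LHS](submxK M) tr_col_mx mul_row_block mul_row_col.
  by rewrite trmx0 !mul0mx mulmx0 !add0r.
apply; apply: contra z0 => /eqP /(congr1 dsubmx).
by rewrite col_mxKd linear0 => ->.
Qed.

End quadratic.

(** * Semidefiniteness of the Riccati iterates and invertibility of the input weight *)

Section riccati_theory.
Context {R : realType} {n m : nat}.
Variables (N : nat) (A : 'M[R]_n) (B : 'M[R]_(n, m)).
Variables (Q : 'M[R]_n) (W : 'M[R]_m) (S : 'M[R]_n).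
Variables (Pm : nat -> 'M[R]_n) (K : nat -> 'M[R]_(m, n)).
Hypotheses (pQ : posdefmx Q) (pW : posdefmx W) (pS : posdefmx S).
Hypothesis ric : riccati N A B Q W S Pm K.

Let normal_eq t : (t < N)%N -> possemidefmx (Pm t.+1) ->
  (B^T *m Pm t.+1 *m B + W) *m K t = - (B^T *m Pm t.+1 *m A).
Proof.
move=> tN pP; have [_ /(_ _ tN)[_ ->]] := ric.
rewrite mulmxN mulKVmx//; apply: posdef_unit.
by apply: possemidef_add => //; exact: possemidef_congr.
Qed.

Let riccati_step t : (t < N)%N -> possemidefmx (Pm t.+1) -> possemidefmx (Pm t).
Proof.
move=> tN pP; have E := normal_eq tN pP.
have [_ /(_ _ tN)[PE _]] := ric.
(* The symmetrized form of the recursion, valid at the optimal gain, is a sum of semidefinite terms;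
   in the given form semidefiniteness is not visible. *)
have -> : Pm t = (A + B *m K t)^T *m Pm t.+1 *m (A + B *m K t) +
    (K t)^T *m W *m K t + Q.
  rewrite PE; congr (_ + _); apply/esym.
  rewrite [(A + _)^T]linearD /= trmx_mul !mulmxDl !mulmxDr !mulmxA -!addrA.
  congr (_ + _); rewrite -[RHS]addr0; congr (_ + _).
  have : (K t)^T *m ((B^T *m Pm t.+1 *m B + W) *m K t) =
      (K t)^T *m - (B^T *m Pm t.+1 *m A) by rewrite E.
  by rewrite mulmxDl mulmxDr mulmxN !mulmxA => ->; rewrite subrr.
have [sQ pQ'] := posdef_semidef pQ.
have [s1 p1] := possemidef_congr (A + B *m K t) pP.
have [s2 p2] := possemidef_congr (K t) (posdef_semidef pW).
have trD (X Y : 'M[R]_n) : (X + Y)^T = X^T + Y^T by exact: linearD.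
move: s1 p1 s2 p2.
set X := (A + _)^T *m _ *m _; set Y := (K t)^T *m W *m K t => s1 p1 s2 p2.
split; first by rewrite trD trD s1 s2 sQ.
by move=> z; rewrite !quadDl !addr_ge0// ?p1 ?p2 ?pQ'.
Qed.

Lemma riccati_semidef t : (t <= N)%N -> possemidefmx (Pm t).
Proof.
move=> tN; rewrite -(subKn tN); elim: (N - t)%N => [|k IHk].
  by rewrite subn0; have [-> _] := ric; exact: posdef_semidef.
(* For k >= N truncated subtraction gives N - k = N - (k + 1) = 0, and the induction hypothesis is
   the goal. *)
have [kN|Nk] := ltnP k N; last first.
  by move: IHk; rewrite (eqP Nk) (eqP (leqW Nk : (N <= k.+1)%N)).
apply: riccati_step; first by rewrite ltn_subrL (leq_ltn_trans _ kN).
by rewrite -subSn// subSS.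
Qed.

Lemma riccati_unit t : (t < N)%N -> B^T *m Pm t.+1 *m B + W \in unitmx.
Proof.
move=> tN; apply: posdef_unit; apply: possemidef_add => //.
exact/possemidef_congr/riccati_semidef.
Qed.

Lemma riccati_gain t : (t < N)%N ->
  (B^T *m Pm t.+1 *m B + W) *m K t = - (B^T *m Pm t.+1 *m A).
Proof. by move=> tN; apply: normal_eq => //; exact: riccati_semidef. Qed.

End riccati_theory.

(** * Adjoint equation and exact expansion of the quadratic cost *)

Section lq_cost.
Context {R : realType} {n m : nat}.
Variables (N : nat) (A : 'M[R]_n) (B : 'M[R]_(n, m)).
Variables (Q : 'M[R]_n) (W : 'M[R]_m) (S : 'M[R]_n).
Implicit Types (x dx : nat -> 'cV[R]_n) (u du : nat -> 'cV[R]_m).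

Definition lq_cost x u :=
  \sum_(t < N) (quad Q (x t) + quad W (u t)) + quad S (x N).

(** For k <= N this is the costate at time N - k; counting from the end makes the backward equation
    structurally recursive. *)
Fixpoint costate_rev x k : 'cV[R]_n :=
  if k is j.+1 then Q *m x (N - k)%N + A^T *m costate_rev x j else S *m x N.

(* The costate solves the backward equation lambda(N) = S x(N),
   lambda(t) = Q x(t) + A' lambda(t+1); the gradient is half the derivative of
   the cost in the direction of u(t). *)
Definition costate x t := costate_rev x (N - t).
Definition gradient x u t := W *m u t + B^T *m costate x t.+1.

Lemma costateN x : costate x N = S *m x N.
Proof. by rewrite /costate subnn. Qed.

Lemma costateE x t : (t < N)%N ->
  costate x t = Q *m x t + A^T *m costate x t.+1.
Proof.
move=> tN; rewrite /costate -(subnSK tN) /=; congr (Q *m x _ + _).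
by rewrite subnSK// subKn// ltnW.
Qed.

Hypotheses (sQ : Q^T = Q) (sW : W^T = W) (sS : S^T = S).

(** Summation by parts: in the increment of dx(t)' lambda(t), the term dx(t)' A' lambda(t+1) from
    the dynamics cancels against the one from the backward equation. *)
Lemma costate_duality x dx du k : (k <= N)%N ->
  dx 0%N = 0 -> (forall t, (t < N)%N -> dx t.+1 = A *m dx t + B *m du t) ->
  ((dx k)^T *m costate x k) 0 0 =
  \sum_(t < k) (((du t)^T *m (B^T *m costate x t.+1)) 0 0 -
                ((dx t)^T *m (Q *m x t)) 0 0).
Proof.
move=> + dx0 dxS; elim: k => [_|k IHk kN].
  by rewrite big_ord0 dx0 trmx0 mul0mx mxE.
rewrite big_ord_recr /= -IHk 1?ltnW// (costateE _ kN) (dxS _ kN).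
rewrite [(_ + _)^T]linearD /= !trmx_mul mulmxDl mulmxDr !entryD -!mulmxA; ring.
Qed.

(** Duality at time N trades the terminal cross term and the state cross terms for costates acting
    on the inputs, so that the linear part of the expansion involves [du] alone. *)
Lemma lq_cost_expand x u dx du :
  dx 0%N = 0 -> (forall t, (t < N)%N -> dx t.+1 = A *m dx t + B *m du t) ->
  lq_cost (fun t => x t + dx t) (fun t => u t + du t) =
  lq_cost x u + 2 * (\sum_(t < N) ((du t)^T *m gradient x u t) 0 0) +
  lq_cost dx du.
Proof.
move=> dx0 dxS; have := costate_duality x (leqnn N) dx0 dxS.
rewrite costateN sumrB => ED.
rewrite /lq_cost quadD// ED.
under eq_bigr do rewrite !quadD//.
rewrite (eq_bigr (fun t : 'I_N => (quad Q (x t) + quad W (u t)) +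
   2 * ((dx t)^T *m (Q *m x t)) 0 0 + 2 * ((du t)^T *m (W *m u t)) 0 0
   + (quad Q (dx t) + quad W (du t)))); last by move=> t _; ring.
rewrite !big_split /= -!mulr_sumr.
under [\sum_(t < N) ((du t)^T *m gradient x u t) 0 0]eq_bigr do
  rewrite /gradient mulmxDr entryD.
rewrite big_split /=; ring.
Qed.

Lemma lq_costZ c x u :
  lq_cost (fun t => c *: x t) (fun t => c *: u t) = c ^+ 2 * lq_cost x u.
Proof.
rewrite /lq_cost mulrDr mulr_sumr quadZ; congr (_ + _).
by apply: eq_bigr => t _; rewrite !quadZ mulrDr.
Qed.

Lemma lq_cost_ge x u t : possemidefmx Q -> possemidefmx W -> possemidefmx S ->
  (t < N)%N -> quad W (u t) <= lq_cost x u.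
Proof.
move=> [_ pQ] [_ pW] [_ pS] tN; rewrite /lq_cost (bigD1 (Ordinal tN)) //=.
have H : 0 <= \sum_(i < N | i != Ordinal tN) (quad Q (x i) + quad W (u i)).
  by apply: sumr_ge0 => i _; rewrite addr_ge0.
by have := pQ (x t); have := pS (x N); lra.
Qed.

Lemma lq_cost_ge0 x u : possemidefmx Q -> possemidefmx W -> possemidefmx S ->
  0 <= lq_cost x u.
Proof.
move=> [_ pQ] [_ pW] [_ pS]; rewrite addr_ge0// sumr_ge0// => i _.
by rewrite addr_ge0.
Qed.

End lq_cost.

(** * Information along the closed loop *)

Section closed_loop.
Context {d : measure_display} {Omega : measurableType d} {R : realType}.
Context {n1 n2 m1 m2 : nat}.
Variables (N : nat).
Variables (A11 : 'M[R]_(n1, n1)) (A21 : 'M[R]_(n2, n1)) (A22 : 'M[R]_(n2, n2)).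
Variables (B11 : 'M[R]_(n1, m1)) (B21 : 'M[R]_(n2, m1)) (B22 : 'M[R]_(n2, m2)).
Let A := block_mx A11 0 A21 A22.
Let B := block_mx B11 0 B21 B22.
Variables (x0 : Omega -> 'cV[R]_(n1 + n2)) (v : nat -> Omega -> 'cV[R]_(n1 + n2)).

Implicit Types f g : law R n1 n2 m1 m2.

Local Notation x f := (state A B f x0 v).
Local Notation u f := (control A B f x0 v).
Local Notation e := (noise x0 v).

(* In the notation of the paper, info1 t, info2 t, hist1of t and common t are
   F_1(t), F_2(t), H_1(t) and (H_1(t), H_2(t)) along the processes x and u. *)
Definition info1 (x : nat -> Omega -> 'cV[R]_(n1 + n2))
    (u : nat -> Omega -> 'cV[R]_(m1 + m2)) t w :=
  (usubmx (x t w), H1 (x^~ w) (u^~ w) t).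

Definition common (x : nat -> Omega -> 'cV[R]_(n1 + n2))
    (u : nat -> Omega -> 'cV[R]_(m1 + m2)) t w :=
  (H1 (x^~ w) (u^~ w) t, H2 (x^~ w) (u^~ w) t).

Definition info2 (x : nat -> Omega -> 'cV[R]_(n1 + n2))
    (u : nat -> Omega -> 'cV[R]_(m1 + m2)) t w :=
  (dsubmx (x t w), common x u t w).

Definition hist1of (x : nat -> Omega -> 'cV[R]_(n1 + n2))
    (u : nat -> Omega -> 'cV[R]_(m1 + m2)) t w := H1 (x^~ w) (u^~ w) t.

Lemma usub_control f t w :
  usubmx (u f t w) = law1 f (info1 (x f) (u f) t w).
Proof. by rewrite controlE /apply_law col_mxKu. Qed.

Lemma dsub_control f t w :
  dsubmx (u f t w) = law2 f (info2 (x f) (u f) t w).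
Proof. by rewrite controlE /apply_law col_mxKd. Qed.

Lemma usub_stateS f t w :
  usubmx (x f t.+1 w) = A11 *m usubmx (x f t w) + B11 *m usubmx (u f t w) + usubmx (v t w).
Proof.
rewrite stateS !linearD /= -[in LHS](vsubmxK (x f t w)) -[in LHS](vsubmxK (u f t w)).
by rewrite /A /B !mul_block_col !col_mxKu !mul0mx !addr0.
Qed.

Section factoring.
Context {d1} {T1 : measurableType d1} (Y : Omega -> T1).
Variables (X : nat -> Omega -> 'cV[R]_(n1 + n2)) (U : nat -> Omega -> 'cV[R]_(m1 + m2)).

Lemma factors_hist1of t :
  (forall s, (s < t)%N -> factors Y (fun w => usubmx (X s w))) ->
  (forall s, (s < t)%N -> factors Y (fun w => usubmx (U s w))) ->
  factors Y (hist1of X U t).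
Proof.
by move=> HX HU; apply: factors_pair; exact: factors_hist.
Qed.

Lemma factors_info1 t :
  (forall s, (s <= t)%N -> factors Y (fun w => usubmx (X s w))) ->
  (forall s, (s < t)%N -> factors Y (fun w => usubmx (U s w))) ->
  factors Y (info1 X U t).
Proof.
move=> HX HU; apply: factors_pair; first exact: HX.
by apply: factors_hist1of => // s st; apply: HX; exact: ltnW.
Qed.

Lemma factors_common t :
  (forall s, (s < t)%N -> factors Y (X s)) ->
  (forall s, (s < t)%N -> factors Y (U s)) ->
  factors Y (common X U t).
Proof.
move=> HX HU; apply: factors_pair; apply: factors_pair; apply: factors_hist => s st.
- by apply: factors_usubmx; exact: HX.
- by apply: factors_usubmx; exact: HU.
- by apply: factors_dsubmx; exact: HX.
- by apply: factors_dsubmx; exact: HU.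
Qed.

Lemma factors_info2 t :
  factors Y (fun w => dsubmx (X t w)) ->
  (forall s, (s < t)%N -> factors Y (X s)) ->
  (forall s, (s < t)%N -> factors Y (U s)) ->
  factors Y (info2 X U t).
Proof. by move=> Hx HX HU; apply: factors_pair => //; exact: factors_common. Qed.

End factoring.

Section observed.
Variables (X : nat -> Omega -> 'cV[R]_(n1 + n2)) (U : nat -> Omega -> 'cV[R]_(m1 + m2)).

Lemma hist1of_state s t : (s < t)%N ->
  factors (hist1of X U t) (fun w => usubmx (X s w)).
Proof.
move=> st; apply: (@factors_of_hist _ _ _ _ _ _ (fun w r => usubmx (X r w)) t s) => //.
exact: factors_fst (factors_refl (hist1of X U t)).
Qed.

Lemma hist1of_control s t : (s < t)%N ->
  factors (hist1of X U t) (fun w => usubmx (U s w)).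
Proof.
move=> st; apply: (@factors_of_hist _ _ _ _ _ _ (fun w r => usubmx (U r w)) t s) => //.
exact: factors_snd (factors_refl (hist1of X U t)).
Qed.

Lemma info1_hist1of t : factors (info1 X U t) (hist1of X U t).
Proof. exact: factors_snd (factors_refl _). Qed.

Lemma info1_state s t : (s <= t)%N ->
  factors (info1 X U t) (fun w => usubmx (X s w)).
Proof.
rewrite leq_eqVlt => /predU1P[->|st]; first exact: factors_fst (factors_refl _).
exact: factors_trans (info1_hist1of t) (hist1of_state st).
Qed.

Lemma info1_control s t : (s < t)%N ->
  factors (info1 X U t) (fun w => usubmx (U s w)).
Proof. by move=> st; exact: factors_trans (info1_hist1of t) (hist1of_control st). Qed.

Lemma common_hist1of t : factors (common X U t) (hist1of X U t).
Proof. exact: factors_fst (factors_refl _). Qed.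

Lemma common_state s t : (s < t)%N -> factors (common X U t) (X s).
Proof.
move=> st; apply: factors_submx.
  exact: factors_trans (common_hist1of t) (hist1of_state st).
apply: (@factors_of_hist _ _ _ _ _ _ (fun w r => dsubmx (X r w)) t s) => //.
exact: factors_fst (factors_snd (factors_refl (common X U t))).
Qed.

Lemma common_control s t : (s < t)%N -> factors (common X U t) (U s).
Proof.
move=> st; apply: factors_submx.
  exact: factors_trans (common_hist1of t) (hist1of_control st).
apply: (@factors_of_hist _ _ _ _ _ _ (fun w r => dsubmx (U r w)) t s) => //.
exact: factors_snd (factors_snd (factors_refl (common X U t))).
Qed.

Lemma info2_common t : factors (info2 X U t) (common X U t).
Proof. exact: factors_snd (factors_refl _). Qed.

Lemma info2_dstate t : factors (info2 X U t) (fun w => dsubmx (X t w)).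
Proof. exact: factors_fst (factors_refl _). Qed.

Lemma info2_state s t : (s < t)%N -> factors (info2 X U t) (X s).
Proof. by move=> st; exact: factors_trans (info2_common t) (common_state st). Qed.

Lemma info2_control s t : (s < t)%N -> factors (info2 X U t) (U s).
Proof. by move=> st; exact: factors_trans (info2_common t) (common_control st). Qed.

Lemma info1_mono s t : (s <= t)%N -> factors (info1 X U t) (info1 X U s).
Proof.
move=> st; apply: factors_info1 => r rs; first by apply: info1_state; exact: leq_trans st.
by apply: info1_control; exact: leq_trans st.
Qed.

Lemma info2_mono s t : (s <= t)%N -> factors (info2 X U t) (info2 X U s).
Proof.
rewrite leq_eqVlt => /predU1P[->|st]; first exact: factors_refl.
apply: factors_info2; first by apply: factors_dsubmx; exact: info2_state.
- by move=> r rs; apply: info2_state; exact: ltn_trans st.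
- by move=> r rs; apply: info2_control; exact: ltn_trans st.
Qed.

Lemma info2_info1 s t : (s < t)%N -> factors (info2 X U t) (info1 X U s).
Proof.
move=> st; apply: factors_info1 => r rs; apply: factors_usubmx.
  by apply: info2_state; exact: leq_ltn_trans st.
by apply: info2_control; exact: ltn_trans st.
Qed.

Lemma hist1of_mono s t : (s <= t)%N -> factors (hist1of X U t) (hist1of X U s).
Proof.
move=> st; apply: factors_hist1of => r rs.
  by apply: hist1of_state; exact: leq_trans st.
by apply: hist1of_control; exact: leq_trans st.
Qed.

Lemma common_mono s t : (s <= t)%N -> factors (common X U t) (common X U s).
Proof.
move=> st; apply: factors_common => r rs.
  by apply: common_state; exact: leq_trans st.
by apply: common_control; exact: leq_trans st.
Qed.

End observed.

Lemma factors_law1 d1 (T1 : measurableType d1) (Y : Omega -> T1) f t :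
  admissible N f -> (t < N)%N -> factors Y (info1 (x f) (u f) t) ->
  factors Y (fun w => usubmx (u f t w)).
Proof.
move=> af tN YF; have -> : (fun w => usubmx (u f t w)) =
    (fun w => law1 f (info1 (x f) (u f) t w)).
  by apply/funext => w; exact: usub_control.
exact: factors_comp (af t tN).1 YF.
Qed.

Lemma factors_law2 d1 (T1 : measurableType d1) (Y : Omega -> T1) f t :
  admissible N f -> (t < N)%N -> factors Y (info2 (x f) (u f) t) ->
  factors Y (fun w => dsubmx (u f t w)).
Proof.
move=> af tN YF; have -> : (fun w => dsubmx (u f t w)) =
    (fun w => law2 f (info2 (x f) (u f) t w)).
  by apply/funext => w; exact: dsub_control.
exact: factors_comp (af t tN).2 YF.
Qed.

Lemma factors_control d1 (T1 : measurableType d1) (Y : Omega -> T1) f t :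
  admissible N f -> (t < N)%N ->
  (forall s, (s <= t)%N -> factors Y (x f s)) ->
  (forall s, (s < t)%N -> factors Y (u f s)) ->
  factors Y (u f t).
Proof.
move=> af tN HX HU; apply: factors_submx.
  apply: factors_law1 => //; apply: factors_info1 => s st; apply: factors_usubmx.
    exact: HX.
  exact: HU.
apply: factors_law2 => //; apply: factors_info2 => [|s st|//].
  by apply: factors_dsubmx; exact: HX.
by apply: HX; exact: ltnW.
Qed.

Lemma factors_stateS d1 (T1 : measurableType d1) (Y : Omega -> T1) f t :
  factors Y (x f t) -> factors Y (u f t) -> factors Y (v t) ->
  factors Y (x f t.+1).
Proof.
move=> HX HU HV; have -> : x f t.+1 = (fun w => A *m x f t w + B *m u f t w + v t w).
  by apply/funext => w; exact: stateS.
by apply: factorsD => //; apply: factorsD; exact: factors_mulmx.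
Qed.

(** The control is claimed only before N, since admissibility says nothing about the law from N
    on. *)
Lemma noise_state d1 (T1 : measurableType d1) (Y : Omega -> T1) f t :
  admissible N f -> (t <= N)%N -> (forall s, (s <= t)%N -> factors Y (e s)) ->
  forall s, (s <= t)%N -> factors Y (x f s) /\ ((s < N)%N -> factors Y (u f s)).
Proof.
move=> af tN He s; elim/ltn_ind: s => s IHs st.
have HX : factors Y (x f s).
  case: s IHs st => [|s] IHs st; first exact: (He 0%N).
  have [HX HU] := IHs s (ltnSn s) (ltnW st).
  by apply: factors_stateS => //; [apply: HU; exact: leq_trans tN|exact: (He s.+1)].
split=> // sN; apply: factors_control => // r.
  rewrite leq_eqVlt => /predU1P[->//|rs].
  by have [] := IHs r rs (leq_trans (ltnW rs) st).
move=> rs; have [_] := IHs r rs (leq_trans (ltnW rs) st); apply.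
exact: ltn_trans sN.
Qed.

(* The information available to a player does not depend on the admissible law:
   it is the sigma-algebra of the noise observed so far. *)
Lemma info1_law f g t : admissible N f -> admissible N g -> (t <= N)%N ->
  forall s, (s <= t)%N -> factors (info1 (x g) (u g) t) (fun w => usubmx (x f s w)) /\
    ((s < N)%N -> factors (info1 (x g) (u g) t) (fun w => usubmx (u f s w))).
Proof.
move=> af ag tN s; elim/ltn_ind: s => s IHs st.
have HX : factors (info1 (x g) (u g) t) (fun w => usubmx (x f s w)).
  case: s IHs st => [|s] IHs st; first exact: (info1_state (x g) (u g) (leq0n t)).
  have [HX HU] := IHs s (ltnSn s) (ltnW st).
  (* The last summand is the first block of the noise, recovered from the trajectory of [g] and fed
     into the dynamics under [f]. *)
  have -> : (fun w => usubmx (x f s.+1 w)) = (fun w =>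
      (A11 *m usubmx (x f s w) + B11 *m usubmx (u f s w)) +
      (usubmx (x g s.+1 w) - (A11 *m usubmx (x g s w) + B11 *m usubmx (u g s w)))).
    by apply/funext => w; rewrite !usub_stateS [_ + usubmx (v s w) - _]addrC addKr.
  apply: factorsD.
    by apply: factorsD; apply: factors_mulmx => //; apply: HU; exact: leq_trans tN.
  apply: factorsB; first exact: info1_state.
  apply: factorsD; apply: factors_mulmx; first by apply: info1_state; exact: ltnW.
  exact: info1_control.
split=> // sN; apply: factors_law1 => //; apply: factors_info1 => r.
  rewrite leq_eqVlt => /predU1P[->//|rs].
  by have [] := IHs r rs (leq_trans (ltnW rs) st).
move=> rs; have [_] := IHs r rs (leq_trans (ltnW rs) st); apply.
exact: ltn_trans sN.
Qed.

Lemma info2_law f g t : admissible N f -> admissible N g -> (t <= N)%N ->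
  [/\ forall s, (s < t)%N -> factors (info2 (x g) (u g) t) (x f s),
      forall s, (s < t)%N -> factors (info2 (x g) (u g) t) (u f s) &
      factors (info2 (x g) (u g) t) (fun w => dsubmx (x f t w))].
Proof.
move=> af ag tN; set Y := info2 _ _ t.
have stepE s w : x f s.+1 w = (A *m x f s w + B *m u f s w) +
    (x g s.+1 w - (A *m x g s w + B *m u g s w)).
  by rewrite !stateS [_ + v s w - _]addrC addKr.
have XU s : (s < t)%N -> factors Y (x f s) /\ factors Y (u f s).
  elim/ltn_ind: s => s IHs st.
  have HX : factors Y (x f s).
    case: s IHs st => [|s] IHs st; first exact: (info2_state (x g) (u g) st).
    have [HX HU] := IHs s (ltnSn s) (ltnW st).
    rewrite (funext (stepE s)).
    apply: factorsD; first by apply: factorsD; apply: factors_mulmx.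
    apply: factorsB; first exact: info2_state.
    apply: factorsD; apply: factors_mulmx; first by apply: info2_state; exact: ltnW.
    by apply: info2_control; exact: ltnW.
  split=> //; apply: factors_control => // [|r|r rs].
  - exact: leq_trans tN.
  - rewrite leq_eqVlt => /predU1P[->//|rs].
    by have [] := IHs r rs (ltn_trans rs st).
  - by have [_] := IHs r rs (ltn_trans rs st).
split; [by move=> s /XU[]|by move=> s /XU[]|].
(* At the current time only the second block of the state is observed, so only that block of the
   last noise is recovered. *)
case: t tN @Y XU => [|t] tN Y XU; first exact: (info2_dstate (x g) (u g) 0).
have [HX HU] := XU t (ltnSn t).
have -> : (fun w => dsubmx (x f t.+1 w)) = (fun w =>
    dsubmx (A *m x f t w + B *m u f t w) +
    (dsubmx (x g t.+1 w) - dsubmx (A *m x g t w + B *m u g t w))).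
  by apply/funext => w; rewrite stepE [LHS]linearD [X in _ + X]linearB.
apply: factorsD.
  by apply: factors_dsubmx; apply: factorsD; exact: factors_mulmx.
apply: factorsB; first exact: info2_dstate.
apply: factors_dsubmx; apply: factorsD; apply: factors_mulmx.
  exact: info2_state.
exact: info2_control.
Qed.

Lemma info2_law_control f g t : admissible N f -> admissible N g -> (t < N)%N ->
  factors (info2 (x g) (u g) t) (fun w => dsubmx (u f t w)).
Proof.
move=> af ag tN; have [HX HU Hd] := info2_law af ag (ltnW tN).
by apply: factors_law2 => //; exact: factors_info2.
Qed.

End closed_loop.

(** * Stationarity of the linear optimal law *)

Section square_integrable_span.
Context {d : measure_display} {Omega : measurableType d} {R : realType}.
Variable P : probability Omega R.

(** Square integrability for values in an arbitrary [lmodType], such as the products of matrix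
    spaces on which [L1] and [L2] act. An expansion over finitely many fixed vectors can be pushed
    through an abstract linear map. *)
Definition sqspan (V : lmodType R) (Z : Omega -> V) :=
  exists (I : finType) (c : I -> Omega -> R) (b : I -> V),
    (forall k, sqint P (c k)) /\ forall w, Z w = \sum_k c k w *: b k.

Lemma sqspan_mx m n (M : Omega -> 'M[R]_(m, n)) :
  (forall i j, sqint P (fun w => M w i j)) -> sqspan M.
Proof.
move=> sM; exists _, (fun ij w => M w ij.1 ij.2), (fun ij => delta_mx ij.1 ij.2).
split=> [[i j]|w]; first exact: sM.
by rewrite -(pair_bigA _ (fun i j => M w i j *: delta_mx i j)) -matrix_sum_delta.
Qed.

Lemma sqspan_pair (V V' : lmodType R) (Z : Omega -> V) (Z' : Omega -> V') :
  sqspan Z -> sqspan Z' -> sqspan (fun w => (Z w, Z' w) : (V * V')%type).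
Proof.
move=> [I [c [b [sc EZ]]]] [I' [c' [b' [sc' EZ']]]].
exists (I + I')%type, (fun k => match k with inl i => c i | inr i => c' i end),
  (fun k => match k with inl i => (b i, 0) | inr i => (0, b' i) end).
split=> [[]//|w]; rewrite big_sumType /= EZ EZ'.
have E1 (s : seq I) : \sum_(i <- s) c i w *: ((b i, 0) : V * V') =
    (\sum_(i <- s) c i w *: b i, 0).
  elim: s => [|i s IHs]; first by rewrite !big_nil.
  by rewrite !big_cons IHs; congr pair; rewrite /= scaler0 addr0.
have E2 (s : seq I') : \sum_(i <- s) c' i w *: ((0, b' i) : V * V') =
    (0, \sum_(i <- s) c' i w *: b' i).
  elim: s => [|i s IHs]; first by rewrite !big_nil.
  by rewrite !big_cons IHs; congr pair; rewrite /= scaler0 addr0.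
by rewrite E1 E2; congr pair; rewrite /= ?addr0 ?add0r.
Qed.

Lemma sqspan_linear (V : lmodType R) n (L : {linear V -> 'cV[R]_n}) (Z : Omega -> V) :
  sqspan Z -> sqintv P (fun w => L (Z w)).
Proof.
move=> [I [c [b [sc EZ]]]] i.
have -> : (fun w => L (Z w) i 0) = (fun w => \sum_k (L (b k) i 0) * c k w).
  apply/funext => w; rewrite EZ linear_sum summxE; apply: eq_bigr => k _.
  by rewrite linearZ entryZ mulrC.
by apply: sqint_sum => k _; exact: sqintZ.
Qed.

Lemma sqspan_hist n (z : nat -> Omega -> 'cV[R]_n) t :
  (forall s, (s < t)%N -> sqintv P (z s)) -> sqspan (fun w => hist (z^~ w) t).
Proof.
move=> sz; apply: sqspan_mx => i j; under eq_fun do rewrite mxE.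
exact: sz.
Qed.

End square_integrable_span.

(** The domain of a law depends on the time, so a function given at the single time t has to be
    transported along s = t to become a family that is 0 at other times. *)
Lemma dependent_family (d : measure_display) (R : realType)
    (T : nat -> measurableType d) (t : nat) (phi : T t -> R) :
  measurable_fun setT phi -> exists h : forall s, T s -> R,
    [/\ forall s, measurable_fun setT (h s), forall s y, s != t -> h s y = 0 &
        h t = phi].
Proof.
move=> mphi; exists (fun s => if t =P s is ReflectT ts then
   eq_rect t (fun k => T k -> R) phi s ts else fun=> 0); split.
- move=> s; case: eqP => [ts|_]; last exact: measurable_cst.
  by case: _ / ts.
- by move=> s y /eqP st; case: eqP => // ts; case: st.
- by case: eqP => // ts; rewrite (eq_axiomK ts).
Qed.

Lemma linear_coef_eq0 (R : realFieldType) (a b : R) : 0 <= b ->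
  (forall k, 0 <= 2 * k * a + k ^+ 2 * b) -> a = 0.
Proof.
(* The minimizer would be - a / b; the denominator b + 1 also covers b = 0 and still makes the value
   negative unless a = 0. *)
move=> b0 /(_ (- a / (b + 1))).
have -> : 2 * (- a / (b + 1)) * a + (- a / (b + 1)) ^+ 2 * b =
    - (a ^+ 2 * (b + 2)) / (b + 1) ^+ 2 by field; lra.
rewrite mulNr oppr_ge0 pmulr_lle0 ?invr_gt0 ?exprn_gt0//; last by lra.
rewrite pmulr_lle0; last by lra.
by move=> H; apply/eqP; rewrite -sqrf_eq0 eq_le H sqr_ge0.
Qed.

Section integral_of_sums.
Context {d : measure_display} {Omega : measurableType d} {R : realType}.
Variable P : probability Omega R.

Lemma Rint_sum I (s : seq I) (F : I -> Omega -> R) : (forall i, integ P (F i)) ->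
  \int[P]_w (\sum_(i <- s) F i w) = \sum_(i <- s) \int[P]_w F i w.
Proof.
move=> iF; elim: s => [|i s IHs].
  by under eq_Rintegral do rewrite big_nil; rewrite Rintegral_cst// mul0r big_nil.
under eq_Rintegral do rewrite big_cons.
have iS := @integ_sum _ _ _ P I s xpredT F (fun i _ => iF i).
by rewrite RintegralD ?IHs ?big_cons//; exact: iF.
Qed.

Lemma Rint_dot_eq0 n (X : Omega -> R) (c : 'cV[R]_n) (G : Omega -> 'cV[R]_n) :
  sqint P X -> sqintv P G -> (forall i, \int[P]_w (X w * G w i 0) = 0) ->
  \int[P]_w (X w * (c^T *m G w) 0 0) = 0.
Proof.
move=> sX sG XG.
have E w : X w * (c^T *m G w) 0 0 = \sum_i c i 0 * (X w * G w i 0).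
  by rewrite mxE mulr_sumr; apply: eq_bigr => i _; rewrite mxE mulrCA.
under eq_Rintegral do rewrite E.
rewrite Rint_sum => [|i]; last by apply: integZ; exact: sqint_mul.
by rewrite big1// => i _; rewrite RintegralZl ?XG ?mulr0//; exact: sqint_mul.
Qed.

End integral_of_sums.

Lemma dot_submx (R : pzRingType) n1 n2 (y z : 'cV[R]_(n1 + n2)) :
  y^T *m z = (usubmx y)^T *m usubmx z + (dsubmx y)^T *m dsubmx z.
Proof. by rewrite -[y in LHS]vsubmxK -[z in LHS]vsubmxK tr_col_mx mul_row_col. Qed.

Section stationarity.
Context {d : measure_display} {Omega : measurableType d} {R : realType}.
Context {n1 n2 m1 m2 : nat}.
Variables (P : probability Omega R) (N : nat).
Variables (A11 : 'M[R]_(n1, n1)) (A21 : 'M[R]_(n2, n1)) (A22 : 'M[R]_(n2, n2)).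
Variables (B11 : 'M[R]_(n1, m1)) (B21 : 'M[R]_(n2, m1)) (B22 : 'M[R]_(n2, m2)).
Let A := block_mx A11 0 A21 A22.
Let B := block_mx B11 0 B21 B22.
Variables (Q S : 'M[R]_(n1 + n2)) (W : 'M[R]_(m1 + m2)).
Variables (x0 : Omega -> 'cV[R]_(n1 + n2)) (v : nat -> Omega -> 'cV[R]_(n1 + n2)).
Variables (F11 : nat -> 'M[R]_(m1, n1)) (F22 : nat -> 'M[R]_(m2, n2)).
Variables (L1 : forall t, {linear local_hist R n1 m1 t -> 'cV[R]_m1})
  (L2 : forall t,
     {linear (local_hist R n1 m1 t * local_hist R n2 m2 t)%type -> 'cV[R]_m2}).
Hypotheses (pQ : posdefmx Q) (pW : posdefmx W) (pS : posdefmx S).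
Hypothesis sq_noise : forall t, (t <= N)%N -> sqintv P (noise x0 v t).

Let fs := linear_law F11 F22 L1 L2.
Local Notation x f := (state A B f x0 v).
Local Notation u f := (control A B f x0 v).
Let C f w := lq_cost N Q W S (x f ^~ w) (u f ^~ w).
Let grad w t := gradient N A B Q W S (x fs ^~ w) (u fs ^~ w) t.

Hypothesis opt : optimal P N A B Q W S x0 v fs.

Lemma sqint_state_control t : (t <= N)%N ->
  (forall s, (s <= t)%N -> sqintv P (x fs s)) /\
  (forall s, (s < t)%N -> sqintv P (u fs s)).
Proof.
have ctrl s : (forall r, (r <= s)%N -> sqintv P (x fs r)) ->
    (forall r, (r < s)%N -> sqintv P (u fs r)) -> sqintv P (u fs s).
  move=> HX HU.
  have -> : u fs s = (fun w => col_mx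
      (F11 s *m usubmx (x fs s w) + L1 s (H1 (x fs ^~ w) (u fs ^~ w) s))
      (F22 s *m dsubmx (x fs s w) + L2 s (H1 (x fs ^~ w) (u fs ^~ w) s,
                                          H2 (x fs ^~ w) (u fs ^~ w) s))).
    by apply/funext => w; rewrite controlE.
  have s1 : sqspan P (fun w => H1 (x fs ^~ w) (u fs ^~ w) s).
    apply: sqspan_pair; apply: (sqspan_hist (z := fun s w => usubmx (_ s w))) => r rs;
      apply: sqintv_usubmx; [exact/HX/ltnW|exact: HU].
  have s2 : sqspan P (fun w => H2 (x fs ^~ w) (u fs ^~ w) s).
    apply: sqspan_pair; apply: (sqspan_hist (z := fun s w => dsubmx (_ s w))) => r rs;
      apply: sqintv_dsubmx; [exact/HX/ltnW|exact: HU].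
  apply: sqintv_col_mx; apply: sqintvD.
  - by apply: sqintv_mulmx; apply: sqintv_usubmx; exact: HX.
  - exact: sqspan_linear.
  - by apply: sqintv_mulmx; apply: sqintv_dsubmx; exact: HX.
  - by apply: sqspan_linear; exact: sqspan_pair.
elim: t => [_|t IHt tN].
  by split=> // s; rewrite leqn0 => /eqP ->; exact: (sq_noise (leq0n N)).
have [HX HU] := IHt (ltnW tN).
have Ht := ctrl t HX HU.
split=> s.
  rewrite leq_eqVlt => /predU1P[->|]; last by rewrite ltnS; exact: HX.
  have -> : x fs t.+1 = (fun w => A *m x fs t w + B *m u fs t w + v t w).
    by apply/funext => w; exact: stateS.
  apply: sqintvD; last exact: (sq_noise tN).
  by apply: sqintvD; apply: sqintv_mulmx => //; exact: HX.
by rewrite ltnS leq_eqVlt => /predU1P[->|/HU].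
Qed.

Lemma sqint_costate t : (t <= N)%N ->
  sqintv P (fun w => costate N A Q S (x fs ^~ w) t).
Proof.
move=> tN; have [HX _] := sqint_state_control (leqnn N).
rewrite /costate; elim: (N - t)%N => [|k IHk] /=.
  by apply: sqintv_mulmx; exact: HX.
apply: sqintvD; apply: sqintv_mulmx => //.
by apply: HX; exact: leq_subr.
Qed.

Lemma sqint_gradient t : (t < N)%N -> sqintv P (grad^~ t).
Proof.
move=> tN; have [_ HU] := sqint_state_control (leqnn N).
by apply: sqintvD; apply: sqintv_mulmx; [exact: HU|exact: sqint_costate].
Qed.

Lemma cost_eq_integral f : cost P N A B Q W S x0 v f = (\int[P]_w (C f w)%:E)%E.
Proof. by rewrite /cost unlock. Qed.

Lemma integ_cost : integ P (C fs).
Proof.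
have [HX HU] := sqint_state_control (leqnn N).
apply: integD; last by apply: sqintv_quad; exact: HX.
apply: integ_sum => t _; apply: integD; apply: sqintv_quad.
  exact/HX/ltnW.
exact: HU.
Qed.

(** Along the perturbation the cost is C + 2 k X l + k^2 X^2 c, with l the linear form in the
    gradient and c the cost of the deterministic trajectory. Optimality for every real k forces the
    coefficient of k to have zero mean. *)
Lemma stationary dx du (X : Omega -> R) :
  dx 0%N = 0 -> (forall t, (t < N)%N -> dx t.+1 = A *m dx t + B *m du t) ->
  sqint P X ->
  (forall k : R, exists2 g, admissible N g & forall w,
     (forall t, (t <= N)%N -> x g t w = x fs t w + (k * X w) *: dx t) /\
     (forall t, (t < N)%N -> u g t w = u fs t w + (k * X w) *: du t)) ->
  \int[P]_w (X w * \sum_(t < N) ((du t)^T *m grad w t) 0 0) = 0.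
Proof.
move=> dx0 dxS sX H; have [sQ _] := pQ; have [sW _] := pW; have [sS _] := pS.
pose l w := \sum_(t < N) ((du t)^T *m grad w t) 0 0.
have sl : sqint P l.
  apply: sqint_sum => t _; under eq_fun do rewrite mxE.
  by apply: sqint_sum => i _; apply: sqintZ; exact: sqint_gradient.
have iXl : integ P (fun w => X w * l w) by exact: sqint_mul.
have iX2 : integ P (fun w => X w ^+ 2) by case: sX.
set a := \int[P]_w _.
pose b := lq_cost N Q W S dx du * \int[P]_w (X w ^+ 2).
have key k : 0 <= 2 * k * a + k ^+ 2 * b.
  have [g ag Hg] := H k.
  have Eg w : C g w = C fs w + ((2 * k) * (X w * l w) +
      (k ^+ 2 * lq_cost N Q W S dx du) * X w ^+ 2).
    have [Hx Hu] := Hg w.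
    have -> : C g w = lq_cost N Q W S (fun t => x fs t w + (k * X w) *: dx t)
       (fun t => u fs t w + (k * X w) *: du t).
      rewrite /C /lq_cost Hx//; congr (_ + _); apply: eq_bigr => t _.
      by rewrite Hx ?Hu// ltnW.
    rewrite (lq_cost_expand (A := A) (B := B))//; last 2 first.
    - by rewrite dx0 scaler0.
    - by move=> t tN; rewrite dxS// scalerDr !scalemxAr.
    rewrite lq_costZ -/(C fs w) -!addrA; congr (_ + _).
    have -> : \sum_(t < N) (((k * X w) *: du t)^T *m
        gradient N A B Q W S (x fs ^~ w) (u fs ^~ w) t) 0 0 = (k * X w) * l w.
      rewrite /l mulr_sumr; apply: eq_bigr => t _.
      by rewrite [(_ *: du t)^T]linearZ /= -scalemxAl entryZ.
    ring.
  have i1 : integ P (fun w => (2 * k) * (X w * l w)) by exact: integZ.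
  have i2 : integ P (fun w => (k ^+ 2 * lq_cost N Q W S dx du) * X w ^+ 2).
    exact: integZ.
  have i12 := integD i1 i2.
  have iC := integ_cost.
  have iCg : integ P (C g).
    by apply: (eq_integ (fun w => esym (Eg w))); exact: integD iC i12.
  have le : \int[P]_w C fs w <= \int[P]_w C g w.
    rewrite /Rintegral fine_le ?integrable_fin_num//.
    by have [_ /(_ g ag)] := opt; rewrite !cost_eq_integral.
  move: le; rewrite (eq_Rintegral _ (fun w (_ : w \in setT) => Eg w)) [leRHS]RintegralD// lerDl RintegralD//.
  by rewrite RintegralZl// RintegralZl// /b mulrA.
have b0 : 0 <= b.
  apply: mulr_ge0; first by apply: lq_cost_ge0; exact: posdef_semidef.
  by apply: Rintegral_ge0 => w _; exact: sqr_ge0.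
exact: linear_coef_eq0 b0 key.
Qed.

(** * Linear response of the closed loop to additional inputs *)

Section superposition.
Variable a : nat -> 'cV[R]_(m1 + m2).

Let fa : law R n1 n2 m1 m2 :=
  Law (fun t y => law1 fs y + usubmx (a t)) (fun t y => law2 fs y + dsubmx (a t)).

(* Response of the noiseless closed loop to the extra input a(t), which the
   linear law then feeds back. *)
Definition impulse_state := path_state A B fa 0 (fun=> 0).
Definition impulse_control := path_control A B fa 0 (fun=> 0).

Lemma impulse_state0 : impulse_state 0 = 0. Proof. by []. Qed.

Lemma impulse_stateS t :
  impulse_state t.+1 = A *m impulse_state t + B *m impulse_control t.
Proof. by rewrite /impulse_state path_stateS addr0. Qed.

Lemma impulse_controlE t :
  impulse_control t = apply_law fs impulse_state impulse_control t + a t.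
Proof.
by rewrite /impulse_control path_controlE /apply_law /= -[a t in RHS]vsubmxK add_col_mx.
Qed.

Lemma histD n (z z' : nat -> 'cV[R]_n) (c : R) t :
  hist (fun s => z s + c *: z' s) t = c *: hist z' t + hist z t.
Proof. by apply/matrixP => i j; rewrite !mxE addrC. Qed.

Lemma apply_law_superpose (X dX : nat -> 'cV[R]_(n1 + n2))
    (U dU : nat -> 'cV[R]_(m1 + m2)) (c : R) t :
  apply_law fs (fun s => X s + c *: dX s) (fun s => U s + c *: dU s) t =
  apply_law fs X U t + c *: apply_law fs dX dU t.
Proof.
have E1 : H1 (fun s => X s + c *: dX s) (fun s => U s + c *: dU s) t =
    c *: H1 dX dU t + H1 X U t.
  congr pair; rewrite -histD; apply: (congr1 (fun z => hist z t)); apply/funext => s; by rewrite linearD linearZ.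
have E2 : H2 (fun s => X s + c *: dX s) (fun s => U s + c *: dU s) t =
    c *: H2 dX dU t + H2 X U t.
  congr pair; rewrite -histD; apply: (congr1 (fun z => hist z t)); apply/funext => s; by rewrite linearD linearZ.
rewrite /apply_law /= scale_col_mx add_col_mx E1 E2.
have -> : (c *: H1 dX dU t + H1 X U t, c *: H2 dX dU t + H2 X U t) =
  c *: (H1 dX dU t, H2 dX dU t) + (H1 X U t, H2 X U t) by [].
have EU : usubmx (X t + c *: dX t) = usubmx (X t) + c *: usubmx (dX t).
  by rewrite linearD linearZ.
have ED : dsubmx (X t + c *: dX t) = dsubmx (X t) + c *: dsubmx (dX t).
  by rewrite linearD linearZ.
rewrite EU ED (linearP (L1 t)) (linearP (L2 t)) !mulmxDr -!scalemxAr !scalerDr.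
by congr col_mx; rewrite [X in _ + X = _]addrC addrACA.
Qed.

Lemma apply_law0 t : apply_law fs (fun=> 0) (fun=> 0) t = 0.
Proof.
(* At zero trajectories, c = -1 makes the value of the law at 0 equal to itself minus itself. *)
have := apply_law_superpose (fun=> 0) (fun=> 0) (fun=> 0) (fun=> 0) (-1) t.
have E k : (fun _ : nat => (0 : 'cV[R]_k) + -1 *: 0) = (fun=> 0).
  by apply/funext => s; rewrite scaler0 addr0.
by rewrite !E scaleN1r subrr.
Qed.

(** The claim is pathwise, so that c may be the value of a random variable at [w]. The law [g] is
    compared with the linear law along the closed loop of [g] itself. *)
Lemma superpose g w (c : R) k :
  (forall s, (s < k)%N -> apply_law g (x g ^~ w) (u g ^~ w) s =
     apply_law fs (x g ^~ w) (u g ^~ w) s + c *: a s) ->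
  (forall s, (s <= k)%N -> x g s w = x fs s w + c *: impulse_state s) /\
  (forall s, (s < k)%N -> u g s w = u fs s w + c *: impulse_control s).
Proof.
elim: k => [_|k IHk H].
  by split=> // s; rewrite leqn0 => /eqP ->; rewrite impulse_state0 scaler0 addr0.
have [HX HU] := IHk (fun s sk => H s (leqW sk)).
have Hu : u g k w = u fs k w + c *: impulse_control k.
  rewrite controlE H// (eq_apply_law fs HX HU) apply_law_superpose -controlE.
  by rewrite impulse_controlE scalerDr addrA.
split=> s.
  rewrite leq_eqVlt => /predU1P[->|]; last by rewrite ltnS; exact: HX.
  rewrite !stateS HX// Hu impulse_stateS !mulmxDr -!scalemxAr scalerDr.
  by rewrite [X in X + _ = _]addrACA [LHS]addrAC.
by rewrite ltnS leq_eqVlt => /predU1P[->|/HU].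
Qed.

Lemma impulse_causal t : (forall s, (s < t)%N -> a s = 0) ->
  (forall s, (s <= t)%N -> impulse_state s = 0) /\
  (forall s, (s < t)%N -> impulse_control s = 0).
Proof.
elim: t => [_|t IHt H]; first by split=> // s; rewrite leqn0 => /eqP ->.
have [HX HU] := IHt (fun s st => H s (leqW st)).
have Ht : impulse_control t = 0.
  by rewrite impulse_controlE H// addr0 (eq_apply_law fs HX HU) apply_law0.
split=> s.
  rewrite leq_eqVlt => /predU1P[->|]; last by rewrite ltnS; exact: HX.
  by rewrite impulse_stateS HX// Ht !mulmx0 addr0.
by rewrite ltnS leq_eqVlt => /predU1P[->|/HU].
Qed.

Lemma impulse_control_at t : (forall s, (s < t)%N -> a s = 0) ->
  impulse_control t = a t.
Proof.
move=> H; have [HX HU] := impulse_causal H.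
by rewrite impulse_controlE (eq_apply_law fs HX HU) apply_law0 add0r.
Qed.

(** The law of player 1 reads only x_1 and u_1, and these are driven by nothing else; an extra input
    of player 2 therefore never reaches them. *)
Lemma impulse_triangular : (forall s, usubmx (a s) = 0) ->
  forall t, usubmx (impulse_state t) = 0 /\ usubmx (impulse_control t) = 0.
Proof.
move=> a0.
have ctrl t : (forall s, (s <= t)%N -> usubmx (impulse_state s) = 0) ->
    (forall s, (s < t)%N -> usubmx (impulse_control s) = 0) ->
    usubmx (impulse_control t) = 0.
  move=> HX HU; rewrite impulse_controlE linearD /= a0 addr0 /apply_law col_mxKu /=.
  rewrite HX// mulmx0 add0r.
  have -> : H1 impulse_state impulse_control t = 0.
    by congr pair; apply/matrixP => i j; rewrite mxE ?HX ?HU ?mxE// ltnW.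
  exact: linear0.
suff H t : (forall s, (s <= t)%N -> usubmx (impulse_state s) = 0) /\
    (forall s, (s < t)%N -> usubmx (impulse_control s) = 0).
  move=> t; have [HX HU] := H t; split; [exact: HX|exact: ctrl].
elim: t => [|t [HX HU]].
  by split=> // s; rewrite leqn0 => /eqP ->; rewrite impulse_state0 linear0.
have Ht := ctrl t HX HU.
split=> s.
  rewrite leq_eqVlt => /predU1P[->|]; last by rewrite ltnS; exact: HX.
  rewrite impulse_stateS linearD /= -[impulse_state t]vsubmxK -[impulse_control t]vsubmxK.
  by rewrite /A /B !mul_block_col !col_mxKu HX// Ht !mulmx0 !mul0mx !addr0.
by rewrite ltnS leq_eqVlt => /predU1P[->|/HU].
Qed.

End superposition.

Let sgrad t (tN : (t < N)%N) : sqintv P (grad^~ t) := sqint_gradient tN.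

(** Of the inputs moved by an impulse at t, those before t vanish by causality and those after t are
    removed by [tail]. The premises guarded by s = t offer the coincidence of the two closed loops
    up to the impulse, which identifies a perturbation evaluated on the information under [g] with
    the given [X]. *)
Lemma stationary_impulse t a (X : Omega -> R) : (t < N)%N -> sqint P X ->
  (forall s, s != t -> a s = 0) ->
  (forall k : R, exists2 g, admissible N g & forall w s, (s < N)%N ->
     (s = t -> forall r, (r <= t)%N -> x g r w = x fs r w) ->
     (s = t -> forall r, (r < t)%N -> u g r w = u fs r w) ->
     apply_law g (x g ^~ w) (u g ^~ w) s =
     apply_law fs (x g ^~ w) (u g ^~ w) s + (k * X w) *: a s) ->
  (forall s, (t < s < N)%N ->
     \int[P]_w (X w * ((impulse_control a s)^T *m grad w s) 0 0) = 0) ->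
  \int[P]_w (X w * ((a t)^T *m grad w t) 0 0) = 0.
Proof.
move=> tN sX at0 H tail.
have a0 s : (s < t)%N -> a s = 0 by move=> st; rewrite at0// ltn_eqF.
have [D0 eta0] := impulse_causal a0.
have : \int[P]_w (X w * \sum_(s < N) ((impulse_control a s)^T *m grad w s) 0 0) = 0.
  apply: (@stationary (impulse_state a)) => // [s _|k].
    exact: impulse_stateS.
  have [g ag Hg] := H k; exists g => // w.
  (* Before t the guarded premises are vacuous, so superposition up to t shows that nothing has
     moved yet; this discharges them when superposition is applied up to N. *)
  have [X1 U1] : (forall s, (s <= t)%N -> x g s w = x fs s w) /\
      (forall s, (s < t)%N -> u g s w = u fs s w).
    have [|HX HU] := @superpose a g w (k * X w) t.
      move=> s st; apply: Hg; first exact: ltn_trans tN.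
        by move=> ts; rewrite ts ltnn in st.
      by move=> ts; rewrite ts ltnn in st.
    by split=> s st; rewrite ?HX ?HU ?D0 ?eta0// scaler0 addr0.
  by apply: superpose => s sN; apply: Hg.
under eq_Rintegral do rewrite mulr_sumr.
have iF (s : 'I_N) : integ P (fun w => X w * ((impulse_control a s)^T *m grad w s) 0 0).
  apply: sqint_mul => //; under eq_fun do rewrite mxE.
  by apply: sqint_sum => i _; apply: sqintZ; exact: sgrad.
rewrite Rint_sum// (bigD1 (Ordinal tN)) //= big1 ?addr0 ?impulse_control_at//.
move=> s; rewrite -val_eqE /= neq_ltn => /orP[st|ts].
  under eq_Rintegral do rewrite eta0// trmx0 mul0mx mxE mulr0.
  by rewrite Rintegral_cst// mul0r.
by apply: tail; rewrite ts ltn_ord.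
Qed.

(** Strong induction on N - t: stationarity at later times, tested with the same [X], supplies the
    last premise of [stationary_impulse]. *)
Lemma stationary_players t : (t < N)%N ->
  (forall X : Omega -> R, factors (info1 (x fs) (u fs) t) X -> sqint P X ->
     forall i, \int[P]_w (X w * usubmx (grad w t) i 0) = 0) /\
  (forall X : Omega -> R, factors (info2 (x fs) (u fs) t) X -> sqint P X ->
     forall i, \int[P]_w (X w * dsubmx (grad w t) i 0) = 0).
Proof.
have [k] := ubnP (N - t)%N; elim: k t => // k IHk t tk tN.
have IH s : (t < s < N)%N -> _ := fun ts => IHk s (leq_trans (ltn_sub2l tN (proj1 (andP ts))) tk) (proj2 (andP ts)).
have afs : admissible N fs by case: opt.
split=> X YX sX i.
- have [phi mphi EX] := YX.
  have [h [mh h0 ht]] := dependent_family (T := fun s => ('cV[R]_n1 * local_hist R n1 m1 s)%type : measurableType _) mphi.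
  pose b : 'cV[R]_m1 := delta_mx i 0.
  pose a s : 'cV[R]_(m1 + m2) := if s == t then col_mx b 0 else 0.
  have := @stationary_impulse t a X tN sX.
  have -> : a t = col_mx b 0 by rewrite /a eqxx.
  have -> : (fun w => X w * ((col_mx b (0 : 'cV[R]_m2))^T *m grad w t) 0 0) =
      (fun w => X w * usubmx (grad w t) i 0).
    apply/funext => w; rewrite dot_submx col_mxKu col_mxKd trmx0 mul0mx addr0.
    by rewrite trmx_delta -rowE mxE.
  apply.
  + by move=> s /negPf st; rewrite /a st.
  (* Since [h] is [phi] at time t and 0 elsewhere, the law is altered at the single time t; later
     inputs change by feedback alone. *)
  + move=> c; exists (Law (fun s y => law1 fs y + (c * h s y) *: b) (law2 fs)).
      move=> s sN; split; last exact: (afs s sN).2.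
      have [m1s _] := afs s sN.
      apply: measurable_fun_mx => p q; apply: (eq_measurable_fun
        (fun y => law1 fs y p q + c * h s y * b p q)).
        by move=> y _; rewrite [RHS]entryD [X in _ = _ + X]entryZ.
      apply: measurable_funD.
        exact: measurableT_comp (@measurable_mx_entry _ R _ _ p q) m1s.
      by apply: measurable_funM; [apply: measurable_funM; [exact: measurable_cst|exact: mh]|exact: measurable_cst].
    move=> w s sN HX HU; rewrite /apply_law /a /=.
    have [st|st] := eqVneq s t; last first.
      by rewrite h0// mulr0 scale0r scaler0 !addr0.
    subst s.
    rewrite ht scale_col_mx add_col_mx scaler0 addr0; congr (col_mx (_ + (_ * _) *: _) _).
    rewrite EX; congr phi; rewrite /info1 HX//; congr pair; congr pair.
      by apply/matrixP => p q; rewrite !mxE HX// ltnW.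
    by apply/matrixP => p q; rewrite !mxE HU.
  (* Both inputs react later, but [X] is then known to both players: to player 1 by recall, to
     player 2 because t < s. *)
  + move=> s ts; have [IH1 IH2] := IH s ts; have /andP[/ltnW ts' sN] := ts.
    have sg := sgrad sN.
    under eq_Rintegral do rewrite dot_submx entryD mulrDr.
    have F1 := factors_trans (info1_mono (x fs) (u fs) ts') YX.
    have F2 : factors (info2 (x fs) (u fs) s) X.
      by apply: factors_trans YX; apply: info2_info1; case/andP: ts.
    have i1 c (G : Omega -> 'cV[R]_c) (y : 'cV[R]_c) : sqintv P G ->
        integ P (fun w => X w * (y^T *m G w) 0 0).
      move=> sG; apply: sqint_mul => //; under eq_fun do rewrite mxE.
      by apply: sqint_sum => j _; apply: sqintZ; exact: sG.
    rewrite RintegralD//; [|by apply: i1; exact: sqintv_usubmx|by apply: i1; exact: sqintv_dsubmx].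
    rewrite !Rint_dot_eq0 ?addr0//.
    + exact: sqintv_dsubmx.
    + by move=> j; exact: IH2.
    + exact: sqintv_usubmx.
    + by move=> j; exact: IH1.
- have [phi mphi EX] := YX.
  have [h [mh h0 ht]] := dependent_family (T := fun s => ('cV[R]_n2 * (local_hist R n1 m1 s * local_hist R n2 m2 s))%type : measurableType _) mphi.
  pose b : 'cV[R]_m2 := delta_mx i 0.
  pose a s : 'cV[R]_(m1 + m2) := if s == t then col_mx 0 b else 0.
  have := @stationary_impulse t a X tN sX.
  have -> : a t = col_mx 0 b by rewrite /a eqxx.
  have -> : (fun w => X w * ((col_mx (0 : 'cV[R]_m1) b)^T *m grad w t) 0 0) =
      (fun w => X w * dsubmx (grad w t) i 0).
    apply/funext => w; rewrite dot_submx col_mxKu col_mxKd trmx0 mul0mx add0r.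
    by rewrite trmx_delta -rowE mxE.
  apply.
  + by move=> s /negPf st; rewrite /a st.
  + move=> c; exists (Law (law1 fs) (fun s y => law2 fs y + (c * h s y) *: b)).
      move=> s sN; split; first exact: (afs s sN).1.
      have [_ m2s] := afs s sN.
      apply: measurable_fun_mx => p q; apply: (eq_measurable_fun
        (fun y => law2 fs y p q + c * h s y * b p q)).
        by move=> y _; rewrite [RHS]entryD [X in _ = _ + X]entryZ.
      apply: measurable_funD.
        exact: measurableT_comp (@measurable_mx_entry _ R _ _ p q) m2s.
      by apply: measurable_funM; [apply: measurable_funM; [exact: measurable_cst|exact: mh]|exact: measurable_cst].
    move=> w s sN HX HU; rewrite /apply_law /a /=.
    have [st|st] := eqVneq s t; last first.
      by rewrite h0// mulr0 scale0r scaler0 !addr0.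
    subst s.
    rewrite ht scale_col_mx add_col_mx scaler0 addr0; congr (col_mx _ (_ + (_ * _) *: _)).
    rewrite EX; congr phi; rewrite /info2 HX//; congr pair; congr (pair (pair _ _) (pair _ _));
      by apply/matrixP => p q; rewrite !mxE ?HX ?HU// ltnW.
  + move=> s ts; have [_ IH2] := IH s ts; have /andP[/ltnW ts' sN] := ts.
    have sg := sgrad sN.
    (* The response of u_1 vanishes, so only the stationarity of player 2 enters, and player 2
       recalls [X]. *)
    have a0 r : usubmx (a r) = 0.
      by rewrite /a; case: eqP => _; rewrite ?col_mxKu ?linear0.
    have [_ e0] := impulse_triangular a0 s.
    under eq_Rintegral do rewrite dot_submx e0 trmx0 mul0mx add0r.
    apply: Rint_dot_eq0 => //; first exact: sqintv_dsubmx.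
    move=> j; apply: IH2 => //.
    exact: factors_trans (info2_mono (x fs) (u fs) ts') YX.
Qed.

End stationarity.

(** * Uniqueness of the optimal control *)

Section measurable_quadratic.
Context {d : measure_display} {Omega : measurableType d} {R : realType}.

Lemma measurable_quad n (M : 'M[R]_n) (X : Omega -> 'cV[R]_n) :
  measurable_fun setT X -> measurable_fun setT (fun w => quad M (X w)).
Proof.
move=> mX; have mXi i : measurable_fun setT (fun w => X w i 0).
  exact: measurableT_comp (@measurable_mx_entry _ R _ _ i 0) mX.
rewrite /quad; under eq_fun do rewrite -mulmxA mxE.
apply: measurable_sum => i; under eq_fun do rewrite !mxE.
apply: measurable_funM => //; apply: measurable_sum => j.
by apply: measurable_funM.
Qed.

Lemma measurable_lq_cost n m N (Q S : 'M[R]_n) (W : 'M[R]_m)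
    (x : nat -> Omega -> 'cV[R]_n) (u : nat -> Omega -> 'cV[R]_m) :
  (forall t, (t <= N)%N -> measurable_fun setT (x t)) ->
  (forall t, (t < N)%N -> measurable_fun setT (u t)) ->
  measurable_fun setT (fun w => lq_cost N Q W S (x ^~ w) (u ^~ w)).
Proof.
move=> mx mu; apply: measurable_funD; last by apply: measurable_quad; exact: mx.
apply: measurable_sum => t; apply: measurable_funD; apply: measurable_quad.
  exact/mx/ltnW.
exact: mu.
Qed.

End measurable_quadratic.

Section uniqueness.
Context {d : measure_display} {Omega : measurableType d} {R : realType}.
Context {n1 n2 m1 m2 : nat}.
Variables (P : probability Omega R) (N : nat).
Variables (A11 : 'M[R]_(n1, n1)) (A21 : 'M[R]_(n2, n1)) (A22 : 'M[R]_(n2, n2)).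
Variables (B11 : 'M[R]_(n1, m1)) (B21 : 'M[R]_(n2, m1)) (B22 : 'M[R]_(n2, m2)).
Let A := block_mx A11 0 A21 A22.
Let B := block_mx B11 0 B21 B22.
Variables (Q S : 'M[R]_(n1 + n2)) (W : 'M[R]_(m1 + m2)).
Variables (x0 : Omega -> 'cV[R]_(n1 + n2)) (v : nat -> Omega -> 'cV[R]_(n1 + n2)).
Variables (F11 : nat -> 'M[R]_(m1, n1)) (F22 : nat -> 'M[R]_(m2, n2)).
Variables (L1 : forall t, {linear local_hist R n1 m1 t -> 'cV[R]_m1})
  (L2 : forall t,
     {linear (local_hist R n1 m1 t * local_hist R n2 m2 t)%type -> 'cV[R]_m2}).
Hypotheses (pQ : posdefmx Q) (pW : posdefmx W) (pS : posdefmx S).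
Hypothesis sq_noise : forall t, (t <= N)%N -> sqintv P (noise x0 v t).

Let fs := linear_law F11 F22 L1 L2.
Local Notation x f := (state A B f x0 v).
Local Notation u f := (control A B f x0 v).
Let C f w := lq_cost N Q W S (x f ^~ w) (u f ^~ w).

Lemma measurable_noise t : (t <= N)%N -> measurable_fun setT (noise x0 v t).
Proof.
move=> tN; apply: measurable_fun_mx => i j; rewrite (ord1 j).
by case: (sq_noise tN i).
Qed.

Lemma measurable_closed_loop f : admissible N f ->
  (forall t, (t <= N)%N -> measurable_fun setT (x f t)) /\
  (forall t, (t < N)%N -> measurable_fun setT (u f t)).
Proof.
move=> af; pose Y w := hist (noise x0 v ^~ w) N.+1.
have mY : measurable_fun setT Y.
  apply: measurable_fun_mx => i j; apply: (eq_measurable_fun (fun w => noise x0 v j w i 0)).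
    by move=> w _; rewrite mxE.
  apply: (measurableT_comp (@measurable_mx_entry _ R _ _ i 0)).
  by apply: measurable_noise; rewrite -ltnS.
have fm k (X : Omega -> 'cV[R]_k) : factors Y X -> measurable_fun setT X.
  by case=> phi mphi /funext ->; exact: measurableT_comp.
have He s : (s <= N)%N -> factors Y (noise x0 v s).
  move=> sN; apply: (@factors_of_hist _ _ _ _ _ _ (fun w r => noise x0 v r w) N.+1) => //.
  exact: factors_refl.
split=> t tN; apply: fm.
  by have [] := noise_state A11 A21 A22 B11 B21 B22 af (leqnn N) He tN.
have [_] := noise_state A11 A21 A22 B11 B21 B22 af (leqnn N) He (ltnW tN).
exact.
Qed.

Lemma control_ae_state_ae f g :
  (forall t, (t < N)%N -> {ae P, forall w, u f t w = u g t w}) ->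
  forall t, (t <= N)%N -> {ae P, forall w, x f t w = x g t w}.
Proof.
move=> ufg; elim=> [_|t IHt tN].
  by apply: aeW => w; rewrite !state0.
have := IHt (ltnW tN); apply: filterS2 (ufg _ tN) => w uE xE.
by rewrite !stateS uE xE.
Qed.

Lemma measurable_cost f : admissible N f -> measurable_fun setT (C f).
Proof.
by move=> /measurable_closed_loop[mx mu]; exact: measurable_lq_cost.
Qed.

Lemma ae_forall_lt (p : nat -> Omega -> Prop) k :
  (forall t, (t < k)%N -> {ae P, forall w, p t w}) ->
  {ae P, forall w, forall t, (t < k)%N -> p t w}.
Proof.
elim: k => [_|k IHk H]; first exact: aeW.
have := IHk (fun t tk => H t (leqW tk)).
apply: filterS2 (H k (ltnSn k)) => w pk plt t.
by rewrite ltnS leq_eqVlt => /predU1P[->//|]; exact: plt.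
Qed.

Lemma control_ae_cost f g : admissible N f -> admissible N g ->
  (forall t, (t < N)%N -> {ae P, forall w, u f t w = u g t w}) ->
  cost P N A B Q W S x0 v f = cost P N A B Q W S x0 v g.
Proof.
move=> af ag ufg; rewrite !cost_eq_integral; apply: ae_eq_integral => //.
- exact/measurable_EFinP/measurable_cost.
- exact/measurable_EFinP/measurable_cost.
have Hu := ae_forall_lt ufg.
have Hx : {ae P, forall w, forall t, (t < N.+1)%N -> x f t w = x g t w}.
  by apply: ae_forall_lt => t tN; exact: (control_ae_state_ae ufg).
apply: filterS2 Hu Hx => w uE xE _; congr EFin; rewrite /C /lq_cost xE//.
congr (_ + _); apply: eq_bigr => t _; rewrite xE ?uE//; exact: leqW.
Qed.

Hypothesis opt : optimal P N A B Q W S x0 v fs.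

Lemma optimal_control_unique f : admissible N f ->
  (cost P N A B Q W S x0 v f <= cost P N A B Q W S x0 v fs)%E ->
  forall t, (t < N)%N -> {ae P, forall w, u f t w = u fs t w}.
Proof.
move=> af; rewrite !cost_eq_integral => lefs.
have afs : admissible N fs by case: opt.
have [mx mu] := measurable_closed_loop af.
have [sxs sus] := sqint_state_control A11 A21 A22 B11 B21 B22 F11 F22 L1 L2 sq_noise (leqnn N).
have iCs : integ P (C fs) by exact: integ_cost.
have pQ' := posdef_semidef pQ; have pW' := posdef_semidef pW; have pS' := posdef_semidef pS.
(* The cost of [f] is at most that of the linear law, which is finite. *)
have iC : integ P (C f).
  apply/integrableP; split; first exact/measurable_EFinP/measurable_cost.
  under eq_integral do rewrite /= ger0_norm ?lq_cost_ge0//.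
  apply: le_lt_trans lefs _; rewrite ltey_eq.
  by rewrite (integrable_fin_num measurableT iCs).
(* Admissibility puts no bound on the inputs of [f]; the finite cost does, because W is positive
   definite. Square integrability is what makes the cross terms of the expansion integrable. *)
have su t : (t < N)%N -> sqintv P (u f t).
  move=> tN i; have [c Hc] := posdef_entry_bound i pW.
  have mui : measurable_fun setT (fun w => u f t w i 0).
    exact: measurableT_comp (@measurable_mx_entry _ R _ _ i 0) (mu t tN).
  split=> //.
  have iW : integ P (fun w => quad W (u f t w)).
    apply: integ_dom iC; first by apply: measurable_quad; exact: mu.
    by move=> w; rewrite ger0_norm; [exact: lq_cost_ge|exact: pW'.2].
  apply: integ_dom (integZ c iW); first exact: measurable_funX.
  by move=> w; rewrite ger0_norm ?sqr_ge0.
have sx t : (t <= N)%N -> sqintv P (x f t).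
  elim: t => [_|t IHt tN]; first exact: (sq_noise (leq0n N)).
  have -> : x f t.+1 = (fun w => A *m x f t w + B *m u f t w + v t w).
    by apply/funext => w; exact: stateS.
  apply: sqintvD; last exact: (sq_noise tN).
  by apply: sqintvD; apply: sqintv_mulmx; [exact/IHt/ltnW|exact: su].
pose dx t w := x f t w - x fs t w; pose du t w := u f t w - u fs t w.
pose D w := lq_cost N Q W S (dx ^~ w) (du ^~ w).
have sdx t : (t <= N)%N -> sqintv P (dx t).
  by move=> tN; apply: sqintvB; [exact: sx|exact: sxs].
have sdu t : (t < N)%N -> sqintv P (du t).
  by move=> tN; apply: sqintvB; [exact: su|exact: sus].
have iD : integ P D.
  apply: integD; last by apply: sqintv_quad; exact: sdx.
  apply: integ_sum => t _; apply: integD; apply: sqintv_quad; last exact: sdu.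
  exact/sdx/ltnW.
pose grad t w := gradient N A B Q W S (x fs ^~ w) (u fs ^~ w) t.
have sg t : (t < N)%N -> sqintv P (grad t) by exact: sqint_gradient.
pose l w := \sum_(t < N) ((du t w)^T *m grad t w) 0 0.
have il t : (t < N)%N -> integ P (fun w => ((du t w)^T *m grad t w) 0 0).
  by move=> tN; apply: sqintv_dot; [exact: sdu|exact: sg].
have E w : C f w = C fs w + (2 * l w + D w).
  have -> : C f w = lq_cost N Q W S (fun t => x fs t w + dx t w) (fun t => u fs t w + du t w).
    by congr lq_cost; apply/funext => t; rewrite addrC subrK.
  have [sQ _] := pQ; have [sW _] := pW; have [sS _] := pS.
  rewrite (lq_cost_expand (A := A) (B := B))// ?addrA//.
    by rewrite /dx !state0 subrr.
  move=> t tN; rewrite /dx /du !stateS !mulmxBr opprD addrACA subrr addr0.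
  by rewrite opprD addrACA.
have El : \int[P]_w l w = 0.
  rewrite /l Rint_sum => [|t]; last exact: il.
  rewrite big1// => t _.
  have [st1 st2] := stationary_players pQ pW pS sq_noise opt (ltn_ord t).
  under eq_Rintegral do rewrite dot_submx entryD.
  have s1 := sqintv_usubmx (sdu t (ltn_ord t)).
  have s2 := sqintv_dsubmx (sdu t (ltn_ord t)).
  have g1 := sqintv_usubmx (sg t (ltn_ord t)).
  have g2 := sqintv_dsubmx (sg t (ltn_ord t)).
  (* The deviation of u_1 is an admissible test variable because the input of [f] is a function of
     the information along the linear law. *)
  have F1 : factors (info1 (x fs) (u fs) t) (fun w => usubmx (du t w)).
    have -> : (fun w => usubmx (du t w)) = (fun w => usubmx (u f t w) - usubmx (u fs t w)).
      by apply/funext => w; exact: linearB.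
    apply: factorsB.
      by have [_] := info1_law A11 A21 A22 B11 B21 B22 x0 v af afs (ltnW (ltn_ord t)) (leqnn t); apply.
    by have [_] := info1_law A11 A21 A22 B11 B21 B22 x0 v afs afs (ltnW (ltn_ord t)) (leqnn t); apply.
  have F2 : factors (info2 (x fs) (u fs) t) (fun w => dsubmx (du t w)).
    have -> : (fun w => dsubmx (du t w)) = (fun w => dsubmx (u f t w) - dsubmx (u fs t w)).
      by apply/funext => w; exact: linearB.
    apply: factorsB; first exact: (info2_law_control A11 A21 A22 B11 B21 B22 x0 v af afs (ltn_ord t)).
    exact: (info2_law_control A11 A21 A22 B11 B21 B22 x0 v afs afs (ltn_ord t)).
  have dot0 k (X G : Omega -> 'cV[R]_k) : sqintv P X -> sqintv P G ->
      (forall i, \int[P]_w (X w i 0 * G w i 0) = 0) ->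
      \int[P]_w ((X w)^T *m G w) 0 0 = 0.
    move=> sX sG H; under eq_Rintegral do rewrite mxE.
    rewrite Rint_sum => [|i]; last by under eq_fun do rewrite mxE; exact: sqint_mul.
    by apply: big1 => i _; under eq_Rintegral do rewrite mxE; exact: H.
  rewrite RintegralD//; [|exact: sqintv_dot|exact: sqintv_dot].
  rewrite !dot0 ?addr0// => i.
    by apply: st2; [exact: factors_entry F2|exact: s2].
  by apply: st1; [exact: factors_entry F1|exact: s1].
have iil : integ P l by apply: integ_sum => t _; exact: il.
have i2l : integ P (fun w => 2 * l w) by exact: integZ.
have D0 w : 0 <= D w by exact: lq_cost_ge0.
have ED : \int[P]_w D w = 0.
  apply/eqP; rewrite eq_le; apply/andP; split; last exact: Rintegral_ge0.
  have le : \int[P]_w C f w <= \int[P]_w C fs w.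
    by rewrite /Rintegral fine_le ?integrable_fin_num.
  move: le; rewrite (eq_Rintegral _ (fun w (_ : w \in setT) => E w)).
  have i2D := integD i2l iD.
  rewrite [leLHS]RintegralD// gerDl RintegralD// RintegralZl// El mulr0 add0r.
  exact.
have aeD := ge0_Rint_eq0 iD D0 ED.
move=> t tN; apply: filterS aeD => w Dw.
have Wdu : quad W (du t w) = 0.
  apply/eqP; rewrite eq_le pW'.2 andbT -[leRHS]Dw; exact: lq_cost_ge.
by apply/eqP; rewrite -subr_eq0; apply/eqP; exact: posdef_eq0 Wdu.
Qed.

Lemma optimal_iff_control f : admissible N f ->
  optimal P N A B Q W S x0 v f <->
  forall t, (t < N)%N -> {ae P, forall w, u f t w = u fs t w}.
Proof.
have [afs ofs] := opt; move=> af; split=> [[_ of_]|ufs].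
  by apply: optimal_control_unique => //; exact: of_.
by split=> // g ag; rewrite (control_ae_cost af afs ufs); exact: ofs.
Qed.

End uniqueness.

(** * Projections of the costate *)

Section closed_class.
Context {Omega : Type} {R : realType}.
Implicit Type C : (Omega -> R) -> Prop.

(** Abstracts what it means for a variable to be negligible at a given time. The Riccati argument is
    carried out modulo such a class, once for variables of conditional mean zero and once for those
    whose conditional mean reduces to the history of player 1. *)
Definition lin_closed C :=
  [/\ C (fun=> 0), forall X Z, C X -> C Z -> C (fun w => X w + Z w) &
      forall c X, C X -> C (fun w => c * X w)].

Definition entrywise n C (X : Omega -> 'cV[R]_n) := forall i, C (fun w => X w i 0).

Variable C : (Omega -> R) -> Prop.
Hypothesis lC : lin_closed C.

Lemma entrywise_mulmx m n (M : 'M[R]_(m, n)) (X : Omega -> 'cV[R]_n) :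
  entrywise C X -> entrywise C (fun w => M *m X w).
Proof.
move=> cX i; have [C0 CD CZ] := lC; under eq_fun do rewrite mxE.
elim: (index_enum _) => [|j s IHs]; first by under eq_fun do rewrite big_nil.
by under eq_fun do rewrite big_cons; apply: CD => //; apply: CZ; exact: cX.
Qed.

Lemma entrywiseD n (X Z : Omega -> 'cV[R]_n) : entrywise C X -> entrywise C Z ->
  entrywise C (fun w => X w + Z w).
Proof.
by move=> cX cZ i; have [_ CD _] := lC; under eq_fun do rewrite mxE; exact: CD.
Qed.

Lemma entrywiseN n (X : Omega -> 'cV[R]_n) : entrywise C X ->
  entrywise C (fun w => - X w).
Proof.
move=> cX i; have [_ _ CZ] := lC; under eq_fun do rewrite mxE -mulN1r.
exact: CZ.
Qed.

Lemma entrywiseB n (X Z : Omega -> 'cV[R]_n) : entrywise C X -> entrywise C Z ->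
  entrywise C (fun w => X w - Z w).
Proof. by move=> cX cZ; apply: entrywiseD => //; exact: entrywiseN. Qed.

Lemma entrywise_usubmx m n (X : Omega -> 'cV[R]_(m + n)) : entrywise C X ->
  entrywise C (fun w => usubmx (X w)).
Proof. by move=> cX i; under eq_fun do rewrite mxE; exact: cX. Qed.

Lemma entrywise_dsubmx m n (X : Omega -> 'cV[R]_(m + n)) : entrywise C X ->
  entrywise C (fun w => dsubmx (X w)).
Proof. by move=> cX i; under eq_fun do rewrite mxE; exact: cX. Qed.

Lemma entrywise_col_mx m n (X : Omega -> 'cV[R]_m) (Z : Omega -> 'cV[R]_n) :
  entrywise C X -> entrywise C Z -> entrywise C (fun w => col_mx (X w) (Z w)).
Proof.
move=> cX cZ i; case: (split_ordP i) => k ->.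
  by under eq_fun do rewrite col_mxEu; exact: cX.
by under eq_fun do rewrite col_mxEd; exact: cZ.
Qed.

End closed_class.

Lemma eq_entrywise (Omega : Type) (R : realType) (C : (Omega -> R) -> Prop) n
    (X Z : Omega -> 'cV[R]_n) : X =1 Z -> entrywise C X -> entrywise C Z.
Proof. by move=> /funext ->. Qed.

Lemma subr_telescope3 (V : zmodType) (a b c e : V) : a + b - (b - c) - (c - e) = a + e.
Proof.
by rewrite !opprB [X in X + _]addrACA subrr addr0 addrACA subrr addr0.
Qed.

Section lq_projection.
Context {Omega : Type} {R : realType} {n m : nat}.
Variables (N : nat) (A : 'M[R]_n) (B : 'M[R]_(n, m)).
Variables (Q : 'M[R]_n) (W : 'M[R]_m) (S : 'M[R]_n).
Variables (Pm : nat -> 'M[R]_n) (K : nat -> 'M[R]_(m, n)).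
Hypotheses (pQ : posdefmx Q) (pW : posdefmx W) (pS : posdefmx S).
Hypothesis ric : riccati N A B Q W S Pm K.
Variable C : nat -> (Omega -> R) -> Prop.
Variables (x : nat -> Omega -> 'cV[R]_n) (u : nat -> Omega -> 'cV[R]_m)
  (l : nat -> Omega -> 'cV[R]_n).
Hypothesis lC : forall t, (t <= N)%N -> lin_closed (C t).
Hypothesis CS : forall t X, (t < N)%N -> C t.+1 X -> C t X.
Hypothesis final : entrywise (C N) (fun w => l N w - S *m x N w).
Hypothesis adjoint : forall t, (t < N)%N ->
  entrywise (C t) (fun w => l t w - (Q *m x t w + A^T *m l t.+1 w)).
Hypothesis critical : forall t, (t < N)%N ->
  entrywise (C t) (fun w => W *m u t w + B^T *m l t.+1 w).
Hypothesis dynamics : forall t, (t < N)%N ->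
  entrywise (C t) (fun w => x t.+1 w - (A *m x t w + B *m u t w)).

(** Modulo the class, replacing l(t+1) by P(t+1) x(t+1) and then x(t+1) by A x + B u in the
    criticality condition leaves (B' P(t+1) B + W) (u - K x), and the matrix in front is
    invertible. *)
Let gain_step t : (t < N)%N ->
  entrywise (C t.+1) (fun w => l t.+1 w - Pm t.+1 *m x t.+1 w) ->
  entrywise (C t) (fun w => u t w - K t *m x t w).
Proof.
move=> tN Hl; have lCt := lC (ltnW tN).
have a : entrywise (C t) (fun w => l t.+1 w - Pm t.+1 *m x t.+1 w).
  by move=> i; apply: CS => //; exact: Hl.
have uM := riccati_unit pQ pW pS ric tN.
have gM := riccati_gain pQ pW pS ric tN.
pose Mi := invmx (B^T *m Pm t.+1 *m B + W).
have := entrywise_mulmx lCt Mi (entrywiseB lCt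
  (entrywiseB lCt (critical tN) (entrywise_mulmx lCt B^T a))
  (entrywise_mulmx lCt (B^T *m Pm t.+1) (dynamics tN))).
apply: eq_entrywise => w; rewrite -[RHS](mulKmx uM); congr (_ *m _).
rewrite (mulmxBr B^T) (mulmxBr (_ *m _)) (mulmxA B^T) subr_telescope3.
rewrite mulmxBr (mulmxA _ (K t)) gM mulNmx opprK.
by rewrite mulmxDr mulmxDl !mulmxA [LHS]addrC [X in X + _ = _]addrC [LHS]addrAC.
Qed.

(** Adding to the adjoint relation the multiples A' of the costate relation, A' P(t+1) of the
    dynamics and A' P(t+1) B of the gain relation eliminates l(t+1), x(t+1) and u(t); the
    coefficient left on x(t) is the Riccati iterate. *)
Let costate_step t : (t < N)%N ->
  entrywise (C t.+1) (fun w => l t.+1 w - Pm t.+1 *m x t.+1 w) ->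
  entrywise (C t) (fun w => l t w - Pm t *m x t w).
Proof.
move=> tN Hl; have lCt := lC (ltnW tN).
have a : entrywise (C t) (fun w => l t.+1 w - Pm t.+1 *m x t.+1 w).
  by move=> i; apply: CS => //; exact: Hl.
have g := gain_step tN Hl.
have [_ /(_ _ tN)[PE _]] := ric.
have := entrywiseD lCt (entrywiseD lCt (entrywiseD lCt (adjoint tN)
   (entrywise_mulmx lCt A^T a)) (entrywise_mulmx lCt (A^T *m Pm t.+1) (dynamics tN)))
   (entrywise_mulmx lCt (A^T *m Pm t.+1 *m B) g).
apply: eq_entrywise => w; rewrite PE.
rewrite !mulmxBr !mulmxDr !mulmxDl !mulmxA !opprD.
set q := Q *m _; set al := A^T *m l _ _; set px := A^T *m _ *m x t.+1 w.
set pa := _ *m A *m x t w; set pb := _ *m B *m u t w; set pk := _ *m K t *m _.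
rewrite -!addrA; congr (_ + _).
by rewrite !addKr [RHS]addrA [RHS]addrC.
Qed.

Lemma lq_projection_costate t : (t <= N)%N ->
  entrywise (C t) (fun w => l t w - Pm t *m x t w).
Proof.
move=> tN; rewrite -(subKn tN); elim: (N - t)%N => [|k IHk].
  by rewrite subn0; have [-> _] := ric.
have [kN|Nk] := ltnP k N; last first.
  by move: IHk; rewrite (eqP Nk) (eqP (leqW Nk : (N <= k.+1)%N)).
apply: costate_step; first by rewrite ltn_subrL (leq_ltn_trans _ kN).
by rewrite -subSn// subSS.
Qed.

Lemma lq_projection_gain t : (t < N)%N ->
  entrywise (C t) (fun w => u t w - K t *m x t w).
Proof. by move=> tN; apply: gain_step => //; exact: lq_projection_costate. Qed.

End lq_projection.

(** * Estimators along the linear optimal law *)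

Lemma dsub_mulmx (R : pzRingType) m1 m2 n1 n2 (M : 'M[R]_(m1 + m2, n1 + n2))
    (z : 'cV[R]_(n1 + n2)) :
  dsubmx (M *m z) = dlsubmx M *m usubmx z + drsubmx M *m dsubmx z.
Proof.
by rewrite -[M in LHS]submxK -[z in LHS]vsubmxK mul_block_col col_mxKd.
Qed.

Section orth_extra.
Context {d : measure_display} {Omega : measurableType d} {R : realType}.
Variable P : probability Omega R.

Lemma factors_measurable d1 d2 (T1 : measurableType d1) (T2 : measurableType d2)
  (Y : Omega -> T1) (X : Omega -> T2) :
  measurable_fun setT Y -> factors Y X -> measurable_fun setT X.
Proof. by move=> mY [phi mphi /funext ->]; exact: measurableT_comp. Qed.

Lemma lin_closed_orth d1 (T1 : measurableType d1) (Y : Omega -> T1) :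
  measurable_fun setT Y -> lin_closed (orth P Y).
Proof.
by move=> mY; split; [exact: orth0|move=> X Z; exact: orthD|move=> c X; exact: orthZ].
Qed.

(** Freezing with a constant [Y1] shows that the conditional mean is a constant; the zero mean of
    [X] then makes it 0. *)
Lemma orth_indep d1 d2 (T1 : measurableType d1) (T2 : measurableType d2)
    (Y : Omega -> T1) (e : Omega -> T2) (X : Omega -> R) :
  measurable_fun setT Y -> measurable_fun setT e -> indep P Y e ->
  factors e X -> integ P X -> \int[P]_w X w = 0 -> orth P Y X.
Proof.
move=> mY me ie eX iX X0.
have [Z [[phi _ EZ] oZ]] : exists Z : Omega -> R,
    factors (fun=> tt) Z /\ orth P Y (fun w => X w - Z w).
  apply: (indep_condexp mY me ie) => //; first exact: factors_cst.
  by apply: factors_trans eX; exact: factors_snd (factors_refl _).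
have [_ /(_ _ measurableT)] := oZ; rewrite preimage_setT.
under eq_Rintegral do rewrite EZ.
rewrite RintegralB//; last exact: integ_cst.
rewrite X0 Rintegral_cst//.
have -> : fine (P setT) = 1 by have -> : P setT = 1%E by exact: probability_setT.
rewrite mulr1 sub0r => /eqP.
rewrite oppr_eq0 => /eqP phi0.
by apply: (eq_orth _ oZ) => w; rewrite EZ phi0 subr0.
Qed.

(* X is integrable and E[X | Y] is a function of Y1. *)
Definition reduces {d1 d2} {T1 : measurableType d1} {T2 : measurableType d2}
    (Y : Omega -> T1) (Y1 : Omega -> T2) (X : Omega -> R) :=
  integ P X /\ exists Z : Omega -> R, factors Y1 Z /\ orth P Y (fun w => X w - Z w).

Lemma lin_closed_reduces d1 d2 (T1 : measurableType d1) (T2 : measurableType d2)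
    (Y : Omega -> T1) (Y1 : Omega -> T2) :
  measurable_fun setT Y -> lin_closed (reduces Y Y1).
Proof.
move=> mY; split.
- split; first exact: integ_cst.
  exists (fun=> 0); split; first exact: factors_cst.
  by apply: (eq_orth _ (orth0 P mY)) => w; rewrite subr0.
- move=> X Z [iX [X' [fX oX]]] [iZ [Z' [fZ oZ]]]; split; first exact: integD.
  exists (fun w => X' w + Z' w); split; first exact: factorsD_real.
  by apply: (eq_orth _ (orthD mY oX oZ)) => w; rewrite opprD addrACA.
- move=> c X [iX [X' [fX oX]]]; split; first exact: integZ.
  exists (fun w => c * X' w); split; first exact: factorsZ_real.
  by apply: (eq_orth _ (orthZ mY c oX)) => w; rewrite mulrBr.
Qed.

Lemma orth_reduces d1 d2 (T1 : measurableType d1) (T2 : measurableType d2)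
    (Y : Omega -> T1) (Y1 : Omega -> T2) X : orth P Y X -> reduces Y Y1 X.
Proof.
move=> oX; split; first by case: oX.
exists (fun=> 0); split; first exact: factors_cst.
by apply: (eq_orth _ oX) => w; rewrite subr0.
Qed.

End orth_extra.

Section estimators.
Context {d : measure_display} {Omega : measurableType d} {R : realType}.
Context {n1 n2 m1 m2 : nat}.
Variables (P : probability Omega R) (N : nat).
Variables (A11 : 'M[R]_(n1, n1)) (A21 : 'M[R]_(n2, n1)) (A22 : 'M[R]_(n2, n2)).
Variables (B11 : 'M[R]_(n1, m1)) (B21 : 'M[R]_(n2, m1)) (B22 : 'M[R]_(n2, m2)).
Let A := block_mx A11 0 A21 A22.
Let B := block_mx B11 0 B21 B22.
Variables (Q S : 'M[R]_(n1 + n2)) (W : 'M[R]_(m1 + m2)).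
Variables (x0 : Omega -> 'cV[R]_(n1 + n2)) (v : nat -> Omega -> 'cV[R]_(n1 + n2)).
Variables (F11 : nat -> 'M[R]_(m1, n1)) (F22 : nat -> 'M[R]_(m2, n2)).
Variables (L1 : forall t, {linear local_hist R n1 m1 t -> 'cV[R]_m1})
  (L2 : forall t,
     {linear (local_hist R n1 m1 t * local_hist R n2 m2 t)%type -> 'cV[R]_m2}).
Variables (Pm : nat -> 'M[R]_(n1 + n2)) (K : nat -> 'M[R]_(m1 + m2, n1 + n2))
  (Pt : nat -> 'M[R]_n2) (J : nat -> 'M[R]_(m2, n2)).
Hypotheses (pQ : posdefmx Q) (pW : posdefmx W) (pS : posdefmx S).
Hypothesis sq_noise : forall t, (t <= N)%N -> sqintv P (noise x0 v t).
Hypothesis mean_noise : forall t, (t <= N)%N -> forall i, \int[P]_w noise x0 v t w i 0 = 0.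
Hypothesis mindep : mutually_independent P
    (fun i : option 'I_N => if i is Some t then v t else x0).
Hypothesis ric : riccati N A B Q W S Pm K.
Hypothesis ric2 : riccati N A22 B22 (drsubmx Q) (drsubmx W) (drsubmx S) Pt J.

Let fs := linear_law F11 F22 L1 L2.
Hypothesis opt : optimal P N A B Q W S x0 v fs.

Local Notation x := (state A B fs x0 v).
Local Notation u := (control A B fs x0 v).
Local Notation e := (noise x0 v).
Local Notation Y1 := (hist1of x u).
Local Notation Y := (common x u).
Local Notation He t := (fun w => hist (e ^~ w) t).

Let afs : admissible N fs. Proof. by case: opt. Qed.

Let measurable_e t : (t <= N)%N -> measurable_fun setT (e t).
Proof. exact: (measurable_noise sq_noise). Qed.

Let noise_common_law f t : admissible N f -> (t <= N)%N ->
  factors (He t) (common (state A B f x0 v) (control A B f x0 v) t).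
Proof.
move=> af tN; have H s : (s < t)%N -> forall r, (r <= s)%N -> factors (He t) (e r).
  move=> st r rs; apply: (@factors_of_hist _ _ _ _ _ _ (fun w r => e r w) t) => //.
    exact: leq_ltn_trans st.
  exact: factors_refl.
apply: factors_common => s st; have sN := leq_trans st tN;
  have [Hx Hu] := noise_state A11 A21 A22 B11 B21 B22 af (ltnW sN) (H s st) (leqnn s).
  exact: Hx.
exact: Hu.
Qed.

Let noise_common t (tN : (t <= N)%N) : factors (He t) (Y t) :=
  noise_common_law afs tN.

Let mHe t : (t <= N)%N -> measurable_fun setT (He t).
Proof.
move=> tN; apply: measurable_fun_mx => i j.
apply: (eq_measurable_fun (fun w => e j w i 0)); first by move=> w _; rewrite mxE.
apply: (measurableT_comp (@measurable_mx_entry _ R _ _ i 0)).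
by apply: measurable_e; rewrite (leq_trans _ tN)// ltnW.
Qed.

Lemma measurable_common f t : admissible N f -> (t <= N)%N ->
  measurable_fun setT (common (state A B f x0 v) (control A B f x0 v) t).
Proof. by move=> af tN; apply: factors_measurable (mHe tN) (noise_common_law af tN). Qed.

Let mY t : (t <= N)%N -> measurable_fun setT (Y t).
Proof. by move=> tN; apply: factors_measurable (mHe tN) (noise_common tN). Qed.

Let mY1 t : (t <= N)%N -> measurable_fun setT (Y1 t).
Proof. by move=> tN; apply: factors_measurable (mY tN) (common_hist1of x u t). Qed.

Let indepY t : (t <= N)%N -> indep P (Y t) (e t).
Proof.
move=> tN; apply: indep_factors (noise_common tN) _.
by apply: (@indep_hist_noise _ _ _ P _ N) => //; exact: measurable_e.
Qed.

Let indepYv t : (t < N)%N -> indep P (Y t) (v t).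
Proof.
(* [v t] is the noise of time t + 1, independent of the common history at t + 1 and hence of the one
   at t. *)
move=> tN; apply: indep_factors (common_mono x u (leqnSn t)) _.
exact: (indepY tN).
Qed.

Let orth_v t : (t < N)%N -> entrywise (orth P (Y t)) (v t).
Proof.
move=> tN i; apply: (orth_indep (mY (ltnW tN)) (measurable_e tN) (indepYv tN)).
- exact: factors_entry (factors_refl _).
- exact: sqint_integ (sq_noise tN i).
- exact: (mean_noise tN).
Qed.

Let sxu := sqint_state_control A11 A21 A22 B11 B21 B22 F11 F22 L1 L2 sq_noise (leqnn N).
Let l t w := costate N A Q S (x ^~ w) t.
Let grad t w := gradient N A B Q W S (x ^~ w) (u ^~ w) t.

Let indic_factors d1 d2 (T1 : measurableType d1) (T2 : measurableType d2)
    (Z1 : Omega -> T1) (Z2 : Omega -> T2) (E : set T2) : measurable E ->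
  factors Z1 Z2 -> factors Z1 (\1_(Z2 @^-1` E) : Omega -> R).
Proof.
move=> mE F; apply: factors_trans F _; exists \1_E; first exact: measurable_indic.
by move=> w; rewrite !indicE.
Qed.

(** Indicators of events of the common history are square-integrable functions of the information of
    player 2, hence valid test variables. *)
Let critical_common t : (t < N)%N ->
  entrywise (orth P (Y t)) (fun w => dsubmx (grad t w)).
Proof.
move=> tN i.
have sg : sqint P (fun w => dsubmx (grad t w) i 0).
  by apply: sqintv_dsubmx; exact: sqint_gradient.
split; first exact: sqint_integ.
move=> E mE; have mYE : measurable (Y t @^-1` E).
  by rewrite -[_ @^-1` _]setTI; exact: (mY (ltnW tN)).
rewrite Rint_indic//.
have [_ st2] := stationary_players pQ pW pS sq_noise opt tN.
apply: (st2 (\1_(Y t @^-1` E))); last exact: sqint_indic.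
exact: indic_factors (info2_common x u t).
Qed.

Let critical_hist1 t : (t < N)%N -> entrywise (orth P (Y1 t)) (grad t).
Proof.
move=> tN.
have mYE E : measurable E -> measurable (Y1 t @^-1` E).
  by move=> mE; rewrite -[_ @^-1` _]setTI; exact: (mY1 (ltnW tN)).
have [st1 _] := stationary_players pQ pW pS sq_noise opt tN.
have sg : sqintv P (grad t) by exact: sqint_gradient.
apply: (eq_entrywise (X := fun w => col_mx (usubmx (grad t w)) (dsubmx (grad t w)))).
  by move=> w; rewrite vsubmxK.
apply: entrywise_col_mx => i.
  split; first by apply: sqint_integ; exact: sqintv_usubmx.
  move=> E mE; rewrite Rint_indic//; last exact: mYE.
  apply: (st1 (\1_(Y1 t @^-1` E))); last by apply: sqint_indic; exact: mYE.
  exact: indic_factors (info1_hist1of x u t).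
exact: orth_factors (common_hist1of x u t) (critical_common tN i).
Qed.

(** The final and adjoint relations hold exactly; the dynamics hold up to [v t], which has zero mean
    given the history. *)
Let gain_hist1 t : (t < N)%N ->
  entrywise (orth P (Y1 t)) (fun w => u t w - K t *m x t w).
Proof.
apply: (lq_projection_gain (l := l) pQ pW pS ric (C := fun t => orth P (Y1 t))) => {t}.
- by move=> t tN; apply: lin_closed_orth; exact: mY1.
- by move=> t X tN; apply: orth_factors; exact: hist1of_mono.
- have lN := lin_closed_orth P (mY1 (leqnn N)).
  move=> i; apply: (eq_orth (X := fun=> 0)); last by case: lN.
  by move=> w; rewrite /l costateN subrr mxE.
- move=> t tN; have lt := lin_closed_orth P (mY1 (ltnW tN)).
  move=> i; apply: (eq_orth (X := fun=> 0)); last by case: lt.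
  by move=> w; rewrite /l costateE// subrr mxE.
- exact: critical_hist1.
- move=> t tN; apply: (eq_entrywise (X := v t)).
    by move=> w; rewrite stateS [_ + v t w]addrC addrK.
  by move=> i; exact: orth_factors (common_hist1of x u t) (orth_v tN i).
Qed.

(** * Conditional means that reduce to the history of player 1 *)

Local Notation C t := (reduces P (Y t) (Y1 t)).

Let linC t : (t <= N)%N -> lin_closed (C t).
Proof. by move=> tN; apply: lin_closed_reduces; exact: mY. Qed.

Let reduces_next t (X : Omega -> R) : (t <= N)%N -> integ P X ->
  factors (fun w => (Y1 t w, e t w)) X -> C t X.
Proof.
move=> tN iX fX; split=> //.
apply: (indep_condexp (mY tN) (measurable_e tN) (indepY tN)) => //.
exact: common_hist1of.
Qed.

Let hist1_noise_state t : (t <= N)%N ->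
  factors (fun w => (Y1 t w, e t w)) (fun w => usubmx (x t w)).
Proof.
set Z := fun w => _; move=> tN.
have Z1 : factors Z (Y1 t) by exact: factors_fst (factors_refl _).
have Z2 : factors Z (e t) by exact: factors_snd (factors_refl _).
case: t tN @Z Z1 Z2 => [|t] tN Z Z1 Z2.
  exact: (factors_usubmx (X := x 0%N)).
have -> : (fun w => usubmx (x t.+1 w)) = (fun w =>
    A11 *m usubmx (x t w) + B11 *m usubmx (u t w) + usubmx (v t w)).
  by apply/funext => w; exact: usub_stateS.
apply: factorsD; last exact: factors_usubmx.
apply: factorsD; apply: factors_mulmx; apply: factors_trans Z1 _.
  exact: hist1of_state.
exact: hist1of_control.
Qed.

Let hist1_noise_control t : (t < N)%N ->
  factors (fun w => (Y1 t w, e t w)) (fun w => usubmx (u t w)).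
Proof.
move=> tN; apply: (factors_law1 afs tN); apply: factors_pair.
  exact: hist1_noise_state (ltnW tN).
exact: factors_fst (factors_refl _).
Qed.

Let reduces_state1 t : (t <= N)%N -> entrywise (C t) (fun w => usubmx (x t w)).
Proof.
move=> tN i; apply: reduces_next => //.
  by apply: sqint_integ; apply: sqintv_usubmx; exact: sxu.1.
exact: factors_entry (hist1_noise_state tN).
Qed.

Let reduces_control1 t : (t < N)%N -> entrywise (C t) (fun w => usubmx (u t w)).
Proof.
move=> tN i; apply: reduces_next; first exact: ltnW.
  by apply: sqint_integ; apply: sqintv_usubmx; exact: sxu.2.
exact: factors_entry (hist1_noise_control tN).
Qed.

(** The tower property alone leaves a function of H_1(t+1). But H_1(t+1) adds to H_1(t) only x_1(t)
    and u_1(t), which are functions of H_1(t) and the noise of time t; freezing that noise brings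
    the conditional mean down to H_1(t). *)
Let reducesS t X : (t < N)%N -> C t.+1 X -> C t X.
Proof.
move=> tN [iX [Z [fZ oZ]]].
have fZ' : factors (fun w => (Y1 t w, e t w)) Z.
  apply: factors_trans fZ; apply: factors_hist1of => s;
    rewrite ltnS leq_eqVlt => /predU1P[->|st].
  - exact: hist1_noise_state (ltnW tN).
  - by apply: factors_trans (hist1of_state x u st); exact: factors_fst (factors_refl _).
  - exact: hist1_noise_control.
  - by apply: factors_trans (hist1of_control x u st); exact: factors_fst (factors_refl _).
have iZ : integ P Z.
  have [iXZ _] := oZ; apply: (eq_integ _ (integD iX (integZ (-1) iXZ))) => w; ring.
have [_ [Z' [fZ2 oZ2]]] := reduces_next (ltnW tN) iZ fZ'.
split=> //; exists Z'; split=> //.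
have oZ1 := orth_factors (common_mono x u (leqnSn t)) oZ.
by apply: (eq_orth _ (orthD (mY (ltnW tN)) oZ1 oZ2)) => w; ring.
Qed.

(** Every contribution of x_1 and u_1 lies in the class, so modulo the class the second blocks form
    a linear-quadratic system with the lower-right blocks as data. *)
Let gain_common t : (t < N)%N ->
  entrywise (C t) (fun w => dsubmx (u t w) - J t *m dsubmx (x t w)).
Proof.
have oC s X : (s <= N)%N -> orth P (Y s) X -> C s X by move=> _; exact: orth_reduces.
apply: (lq_projection_gain (l := fun t w => dsubmx (l t w))
  (posdef_drsubmx pQ) (posdef_drsubmx pW) (posdef_drsubmx pS) ric2
  (C := fun t => C t) (x := fun t w => dsubmx (x t w)) (u := fun t w => dsubmx (u t w))) => {t}.
- exact: linC.
- exact: reducesS.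
- apply: (eq_entrywise (X := fun w => dlsubmx S *m usubmx (x N w))).
    by move=> w; rewrite /l costateN dsub_mulmx addrK.
  apply: entrywise_mulmx; [exact: (linC (leqnn N))|exact: reduces_state1 (leqnn N)].
- move=> t tN.
  apply: (eq_entrywise (X := fun w => dlsubmx Q *m usubmx (x t w))).
    move=> w; rewrite /l (costateE _ _ _ _ tN) [dsubmx (_ + _)]linearD /= !dsub_mulmx.
    by rewrite /A tr_block_mx block_mxKdl block_mxKdr trmx0 mul0mx add0r -[X in _ = X - _]addrA addrK.
  apply: entrywise_mulmx; [exact: (linC (ltnW tN))|exact: reduces_state1 (ltnW tN)].
- move=> t tN.
  apply: (eq_entrywise (X := fun w => dsubmx (grad t w) - dlsubmx W *m usubmx (u t w))).
    move=> w; rewrite /grad /gradient [dsubmx (_ + _)]linearD /= !dsub_mulmx.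
    rewrite /B tr_block_mx block_mxKdl block_mxKdr trmx0 mul0mx add0r.
    by rewrite addrC -addrA addKr.
  apply: entrywiseB; first exact: linC (ltnW tN).
    by move=> i; apply: oC; [exact: ltnW|exact: critical_common].
  apply: entrywise_mulmx; [exact: (linC (ltnW tN))|exact: reduces_control1 tN].
- move=> t tN.
  apply: (eq_entrywise (X := fun w => A21 *m usubmx (x t w) + B21 *m usubmx (u t w) + dsubmx (v t w))).
    move=> w; rewrite stateS [dsubmx (_ + _)]linearD /= [dsubmx (_ + _)]linearD /= !dsub_mulmx.
    rewrite /A /B !block_mxKdl !block_mxKdr.
    by rewrite [X in X + _ - _]addrACA [X in X - _]addrAC addrK.
  have lt := linC (ltnW tN).
  apply: (entrywiseD lt); first apply: (entrywiseD lt).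
  + apply: entrywise_mulmx; [exact: lt|exact: reduces_state1 (ltnW tN)].
  + apply: entrywise_mulmx; [exact: lt|exact: reduces_control1 tN].
  + apply: entrywise_dsubmx => i; apply: oC; [exact: ltnW|exact: orth_v].
Qed.

Let vector_reduction d1 d2 (T1 : measurableType d1) (T2 : measurableType d2) k
    (Z1 : Omega -> T1) (Z2 : Omega -> T2) (X : Omega -> 'cV[R]_k) :
  (forall i, exists Z : Omega -> R,
     factors Z2 Z /\ orth P Z1 (fun w => X w i 0 - Z w)) ->
  exists Z : Omega -> 'cV[R]_k,
    factors Z2 Z /\ entrywise (orth P Z1) (fun w => X w - Z w).
Proof.
move=> /choice[Z HZ]; exists (fun w => \col_i Z i w); split.
  apply: factors_mx => i j; under eq_fun do rewrite mxE.
  by have [] := HZ i.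
move=> i; under eq_fun do rewrite !mxE.
by have [] := HZ i.
Qed.

Let entrywise_eq0 d1 (T1 : measurableType d1) k (Z1 : Omega -> T1)
    (X : Omega -> 'cV[R]_k) : measurable_fun setT Z1 -> factors Z1 X ->
  entrywise (orth P Z1) X -> {ae P, forall w, X w = 0}.
Proof.
move=> mZ1 fX oX.
have H i : {ae P, forall w, X w i 0 = 0}.
  by apply: (orth_factors_eq0 mZ1 _ (oX i)); exact: factors_entry.
have : {ae P, forall w, forall t, (t < k)%N -> forall i : 'I_k, i = t :> nat -> X w i 0 = 0}.
  apply: ae_forall_lt => t tk; apply: filterS (H (Ordinal tk)) => w Xw i it.
  by rewrite -Xw; congr (X w _ 0); exact/val_inj.
by apply: filterS => w Xw; apply/matrixP => i j; rewrite (ord1 j) mxE; exact: (Xw i).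
Qed.

Let feedback_usubmx t xt xh xhh :
  usubmx (estimator_feedback (F11 t) (F22 t) (K t) (J t) xt xh xhh) =
  F11 t *m (usubmx xt - usubmx xh) + usubmx (K t *m xh).
Proof.
rewrite /estimator_feedback mul_row_col mul_block_col mul_col_mx !mul0mx addr0 add0r.
rewrite [usubmx (_ + _)]linearD /= [usubmx (_ + _)]linearD /= !col_mxKu addr0.
by [].
Qed.

Let feedback_dsubmx t xt xh xhh :
  dsubmx (estimator_feedback (F11 t) (F22 t) (K t) (J t) xt xh xhh) =
  F22 t *m (dsubmx xt - dsubmx xhh) +
  (dsubmx (K t *m xh) + J t *m (dsubmx xhh - dsubmx xh)).
Proof.
rewrite /estimator_feedback mul_row_col mul_block_col mul_col_mx !mul0mx addr0 add0r.
by rewrite [dsubmx (_ + _)]linearD /= [dsubmx (_ + _)]linearD /= !col_mxKd.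
Qed.

Lemma linear_law_estimators t : (t < N)%N ->
  exists xh xhh : Omega -> 'cV[R]_(n1 + n2),
  [/\ factors (Y1 t) xh /\ factors (Y t) xhh,
      entrywise (orth P (Y1 t)) (fun w => x t w - xh w),
      entrywise (orth P (Y t)) (fun w => x t w - xhh w) &
      {ae P, forall w, u t w = estimator_feedback (F11 t) (F22 t) (K t) (J t)
         (x t w) (xh w) (xhh w)}].
Proof.
move=> tN; have mY1t := mY1 (ltnW tN); have mYt := mY (ltnW tN).
have ix i : integ P (fun w => x t w i 0) by apply: sqint_integ; exact: (sxu.1 t (ltnW tN) i).
have [xh [fxh oxh]] := vector_reduction (fun i => condexp_exists mY1t (ix i)).
have [xhh [fxhh oxhh]] := vector_reduction (fun i => condexp_exists mYt (ix i)).
have [Z [fZ oZ]] := vector_reduction (fun i => (gain_common tN i).2).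
exists xh, xhh; split=> //.
have lY1 := lin_closed_orth P mY1t; have lY := lin_closed_orth P mYt.
have fxhY : factors (Y t) xh by exact: factors_trans (common_hist1of x u t) fxh.
have fZY : factors (Y t) Z by exact: factors_trans (common_hist1of x u t) fZ.
(* With the current observation set to 0 the law reduces to [L1 t], which is thus measurable by
   admissibility; likewise for [L2 t]. *)
have mL1 : measurable_fun setT (L1 t).
  apply: (eq_measurable_fun (fun h => law1 fs (0, h))).
    by move=> h _; rewrite /= mulmx0 add0r.
  by apply: (measurableT_comp (afs tN).1); exact: measurable_pair1.
have mL2 : measurable_fun setT (L2 t).
  apply: (eq_measurable_fun (fun h => law2 fs (0, h))).
    by move=> h _; rewrite /= mulmx0 add0r.
  by apply: (measurableT_comp (afs tN).2); exact: measurable_pair1.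
pose l1 w := L1 t (Y1 t w); pose l2 w := L2 t (Y t w).
have fl1 : factors (Y1 t) l1 by exact: (factors_comp mL1 (factors_refl _)).
have fl2 : factors (Y t) l2 by exact: (factors_comp mL2 (factors_refl _)).
have u1E w : usubmx (u t w) = F11 t *m usubmx (x t w) + l1 w by exact: usub_control.
have u2E w : dsubmx (u t w) = F22 t *m dsubmx (x t w) + l2 w by exact: dsub_control.
(* Conditioning u_1 - (K x)_1 on H_1(t) identifies the part of u_1 that depends on the history. *)
have e1 : {ae P, forall w, F11 t *m usubmx (xh w) + l1 w - usubmx (K t *m xh w) = 0}.
  apply: (entrywise_eq0 mY1t).
    apply: factorsB; first by apply: factorsD => //; apply: factors_mulmx; exact: factors_usubmx.
    by apply: factors_usubmx; exact: factors_mulmx.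
  have := entrywiseD lY1 (entrywiseB lY1 (entrywise_usubmx (gain_hist1 tN))
     (entrywise_mulmx lY1 (F11 t) (entrywise_usubmx oxh)))
     (entrywise_usubmx (entrywise_mulmx lY1 (K t) oxh)).
  apply: eq_entrywise => w.
  have sB (a b : 'cV[R]_(m1 + m2)) : usubmx (a - b) = usubmx a - usubmx b by exact: linearB.
  have sB' (a b : 'cV[R]_(n1 + n2)) : usubmx (a - b) = usubmx a - usubmx b by exact: linearB.
  rewrite mulmxBr !sB sB' u1E mulmxBr.
  by apply/matrixP => i j; rewrite !(entryD, entryN); ring.
(* Conditioning u_2 - J x_2 on (H_1(t), H_2(t)) identifies the corresponding part of u_2 up to the
   unknown [Z], a function of H_1(t). *)
have e2 : {ae P, forall w,
    F22 t *m dsubmx (xhh w) + l2 w - J t *m dsubmx (xhh w) - Z w = 0}.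
  apply: (entrywise_eq0 mYt).
    apply: factorsB => //; apply: factorsB; last by apply: factors_mulmx; exact: factors_dsubmx.
    by apply: factorsD => //; apply: factors_mulmx; exact: factors_dsubmx.
  have := entrywiseB lY oZ
     (entrywise_mulmx lY (F22 t - J t) (entrywise_dsubmx oxhh)).
  apply: eq_entrywise => w.
  have sB' (a b : 'cV[R]_(n1 + n2)) : dsubmx (a - b) = dsubmx a - dsubmx b by exact: linearB.
  rewrite sB' u2E mulmxBr !mulmxBl.
  by apply/matrixP => i j; rewrite !(entryD, entryN); ring.
(* Conditioning further on H_1(t), where the gain K is available, determines [Z]. *)
have e3 : {ae P, forall w, Z w - dsubmx (K t *m xh w) + J t *m dsubmx (xh w) = 0}.
  apply: (entrywise_eq0 mY1t).
    apply: factorsD; last by apply: factors_mulmx; exact: factors_dsubmx.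
    by apply: factorsB => //; apply: factors_dsubmx; exact: factors_mulmx.
  have oZ1 : entrywise (orth P (Y1 t))
      (fun w => dsubmx (u t w) - J t *m dsubmx (x t w) - Z w).
    by move=> i; exact: orth_factors (common_hist1of x u t) (oZ i).
  have := entrywiseB lY1 (entrywiseD lY1 (entrywiseB lY1 (entrywise_dsubmx (gain_hist1 tN)) oZ1)
     (entrywise_dsubmx (entrywise_mulmx lY1 (K t) oxh)))
     (entrywise_mulmx lY1 (J t) (entrywise_dsubmx oxh)).
  apply: eq_entrywise => w.
  have sB (a b : 'cV[R]_(m1 + m2)) : dsubmx (a - b) = dsubmx a - dsubmx b by exact: linearB.
  have sB' (a b : 'cV[R]_(n1 + n2)) : dsubmx (a - b) = dsubmx a - dsubmx b by exact: linearB.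
  rewrite mulmxBr !sB sB' mulmxBr.
  by apply/matrixP => i j; rewrite !(entryD, entryN); ring.
apply: filterS3 e1 e2 e3 => w e1 e2 e3.
rewrite -[LHS]vsubmxK -[RHS]vsubmxK feedback_usubmx feedback_dsubmx u1E u2E !mulmxBr.
congr col_mx; apply/matrixP => i j.
  by have := congr1 (fun M : 'cV[R]_m1 => M i j) e1; rewrite !(entryD, entryN) [(0 : 'cV[R]_m1) i j]mxE; lra.
have := congr1 (fun M : 'cV[R]_m2 => M i j) e2; have := congr1 (fun M : 'cV[R]_m2 => M i j) e3.
by rewrite !(entryD, entryN) [(0 : 'cV[R]_m2) i j]mxE; lra.
Qed.

End estimators.

(** * Characterization of the optimal laws *)

Section cond_expectation_orth.
Context {d : measure_display} {Omega : measurableType d} {R : realType}.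
Variable P : probability Omega R.
Context {d1} {T1 : measurableType d1} (Y : Omega -> T1).
Hypothesis mY : measurable_fun setT Y.

Let mYE E : measurable E -> measurable (Y @^-1` E).
Proof. by move=> mE; rewrite -[_ @^-1` _]setTI; exact: mY. Qed.

Lemma cond_expectation_orth (X Z : Omega -> R) : cond_expectation P Y X Z ->
  orth P Y (fun w => X w - Z w).
Proof.
move=> [iX iZ _ EXZ]; split.
  by apply: (eq_integ _ (integD iX (integZ (-1) iZ))) => w; rewrite mulN1r.
move=> E mE; rewrite RintegralB; last 3 first.
- exact: mYE.
- by apply: integrableS iX => //; exact: mYE.
- by apply: integrableS iZ => //; exact: mYE.
apply/eqP; rewrite subr_eq0; apply/eqP; congr fine; apply/esym/EXZ.
by exists E; rewrite // setTI.
Qed.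

Lemma orth_cond_expectation (X Z : Omega -> R) : integ P X -> factors Y Z ->
  orth P Y (fun w => X w - Z w) -> cond_expectation P Y X Z.
Proof.
move=> iX [phi mphi EZ] [iXZ oXZ].
have iZ : integ P Z.
  by apply: (eq_integ _ (integD iX (integZ (-1) iXZ))) => w; ring.
split=> // [U mU|G [E mE]].
  exists (phi @^-1` U); first by rewrite -[_ @^-1` _]setTI; exact: mphi.
  by rewrite setTI; apply/seteqP; split=> w /=; rewrite EZ.
rewrite setTI => <-; have mG := mYE mE.
have iXG : P.-integrable (Y @^-1` E) (EFin \o X) by exact: integrableS iX.
have iZG : P.-integrable (Y @^-1` E) (EFin \o Z) by exact: integrableS iZ.
rewrite -[LHS]fineK ?(integrable_fin_num mG iZG)//.
rewrite -[RHS]fineK ?(integrable_fin_num mG iXG)//; congr EFin.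
by apply/esym/eqP; rewrite -subr_eq0 -RintegralB// oXZ.
Qed.

(** The difference of two versions has zero conditional mean and is measurable for the events of
    [Y]. As [Z] is known only through its preimages, measurability of the difference is derived on
    [Omega] equipped with the sigma-algebra generated by [Y]. *)
Lemma cond_expectation_ae_unique (X Z Z' : Omega -> R) : cond_expectation P Y X Z ->
  factors Y Z' -> orth P Y (fun w => X w - Z' w) -> {ae P, forall w, Z w = Z' w}.
Proof.
move=> cZ [phi mphi EZ'] oZ'; have oZ := cond_expectation_orth cZ.
have [_ _ mZ _] := cZ.
have oD : orth P Y (fun w => Z w - Z' w).
  by apply: (eq_orth _ (orthD mY oZ' (orthZ mY (-1) oZ))) => w; ring.
have sD U : measurable U -> g_sigma_algebra_preimage Y ((fun w => Z w - Z' w) @^-1` U).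
  move=> mU.
  have m1 : measurable_fun (setT : set (g_sigma_algebra_preimageType Y)) Z.
    by move=> _ B mB; rewrite setTI; exact: mZ.
  have m2 : measurable_fun (setT : set (g_sigma_algebra_preimageType Y)) Z'.
    move=> _ B mB; rewrite setTI; exists (phi @^-1` B).
      by rewrite -[_ @^-1` _]setTI; exact: mphi.
    by rewrite setTI; apply/seteqP; split=> w /=; rewrite EZ'.
  have mD : measurable_fun (setT : set (g_sigma_algebra_preimageType Y))
      (fun w => Z w - Z' w) by exact: measurable_funB.
  by have := mD measurableT _ mU; rewrite setTI.
apply: filterS (orth_preimage_eq0 mY sD oD) => w /eqP.
by rewrite subr_eq0 => /eqP.
Qed.

End cond_expectation_orth.

Lemma gaussian_vector_moments (d : measure_display) (Omega : measurableType d)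
    (R : realType) (P : probability Omega R) n (X : Omega -> 'cV[R]_n) :
  gaussian_vector P X -> sqintv P X /\ forall i, \int[P]_w X w i 0 = 0.
Proof.
move=> [mX gX].
have H i : sqint P (fun w => X w i 0) /\ \int[P]_w X w i 0 = 0.
  have [s Hs] := gX (delta_mx i 0).
  apply: (@centered_normal_moments _ _ _ _ _ s).
    exact: measurableT_comp (@measurable_mx_entry _ R _ _ i 0) mX.
  move=> U mU; rewrite -Hs//; congr (P _); apply/seteqP; split=> w /=;
    by rewrite trmx_delta -rowE mxE.
by split=> i; have [] := H i.
Qed.

Section characterization.
Context {d : measure_display} {Omega : measurableType d} {R : realType}.
Context {n1 n2 m1 m2 : nat}.
Variables (P : probability Omega R) (N : nat).
Variables (A11 : 'M[R]_(n1, n1)) (A21 : 'M[R]_(n2, n1)) (A22 : 'M[R]_(n2, n2)).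
Variables (B11 : 'M[R]_(n1, m1)) (B21 : 'M[R]_(n2, m1)) (B22 : 'M[R]_(n2, m2)).
Let A := block_mx A11 0 A21 A22.
Let B := block_mx B11 0 B21 B22.
Variables (x0 : Omega -> 'cV[R]_(n1 + n2)) (v : nat -> Omega -> 'cV[R]_(n1 + n2)).
Variables (F11 : nat -> 'M[R]_(m1, n1)) (F22 : nat -> 'M[R]_(m2, n2)).
Variables (K : nat -> 'M[R]_(m1 + m2, n1 + n2)) (J : nat -> 'M[R]_(m2, n2)).
Hypothesis sq_noise : forall t, (t <= N)%N -> sqintv P (noise x0 v t).
Variables (f g : law R n1 n2 m1 m2).
Hypotheses (af : admissible N f) (ag : admissible N g).

Local Notation x f := (state A B f x0 v).
Local Notation u f := (control A B f x0 v).
Local Notation Y1 f := (hist1of (x f) (u f)).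
Local Notation Y f := (common (x f) (u f)).

Let mY h t : admissible N h -> (t <= N)%N -> measurable_fun setT (Y h t).
Proof.
by move=> ah tN; exact: (measurable_common A11 A21 A22 B11 B21 B22 sq_noise ah tN).
Qed.

Let mY1 h t : admissible N h -> (t <= N)%N -> measurable_fun setT (Y1 h t).
Proof.
by move=> ah tN; apply: factors_measurable (mY ah tN) (common_hist1of (x h) (u h) t).
Qed.

Lemma common_ae t : (forall s, (s < t)%N -> {ae P, forall w, u f s w = u g s w}) ->
  {ae P, forall w, (x f t w = x g t w) /\ Y f t w = Y g t w}.
Proof.
move=> ufg.
have xfg : forall s, (s < t.+1)%N -> {ae P, forall w, x f s w = x g s w}.
  by move=> s st; apply: (control_ae_state_ae ufg).
apply: filterS2 (ae_forall_lt ufg) (ae_forall_lt xfg) => w ue xe; split.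
  exact: xe.
congr (pair (pair _ _) (pair _ _)); apply/matrixP => i j; rewrite !mxE ?ue//.
  by rewrite xe// leqW.
by rewrite xe// leqW.
Qed.

Hypothesis g_estimators : forall t, (t < N)%N ->
  exists xh xhh : Omega -> 'cV[R]_(n1 + n2),
  [/\ factors (Y1 g t) xh /\ factors (Y g t) xhh,
      entrywise (orth P (Y1 g t)) (fun w => x g t w - xh w),
      entrywise (orth P (Y g t)) (fun w => x g t w - xhh w) &
      {ae P, forall w, u g t w = estimator_feedback (F11 t) (F22 t) (K t) (J t)
         (x g t w) (xh w) (xhh w)}].

(** The estimator on the second history is obtained by evaluating on it the factoring map [phi] of
    the first. *)
Let transfer t d1 (T1 : measurableType d1) (Z1 Z2 : Omega -> T1)
    (X1 X2 xh : Omega -> 'cV[R]_(n1 + n2)) : (t <= N)%N ->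
  measurable_fun setT Z1 -> measurable_fun setT Z2 ->
  measurable_fun setT X2 ->
  {ae P, forall w, X1 w = X2 w} -> {ae P, forall w, Z1 w = Z2 w} ->
  factors Z1 xh -> entrywise (orth P Z1) (fun w => X1 w - xh w) ->
  exists xh' : Omega -> 'cV[R]_(n1 + n2),
  [/\ factors Z2 xh', entrywise (orth P Z2) (fun w => X2 w - xh' w) &
      {ae P, forall w, xh w = xh' w}].
Proof.
move=> tN mZ1 mZ2 mX2 XE ZE [phi mphi Exh] oxh.
have xE : {ae P, forall w, xh w = phi (Z2 w)}.
  by apply: filterS ZE => w <-; exact: Exh.
exists (phi \o Z2); split=> //; first by exists phi.
move=> i.
have me k (X : Omega -> 'cV[R]_k) j : measurable_fun setT X ->
    measurable_fun setT (fun w => X w j 0).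
  by move=> mX; exact: measurableT_comp (@measurable_mx_entry _ R _ _ j 0) mX.
apply: (orth_ae_eqY mZ1 mZ2 ZE); apply: (orth_ae_eq mZ1 _ _ (oxh i)).
  under eq_fun do rewrite entryD entryN.
  apply: measurable_funB; apply: me => //; exact: measurableT_comp.
by apply: filterS2 XE xE => w XE xE; rewrite !(entryD, entryN) XE xE.
Qed.

(** The control of [g] at t is expressed through the state and estimators along [f], while agreement
    of the controls is assumed only before t; this is the form needed for an induction on t. *)
Lemma estimators_transfer t : (t < N)%N ->
  (forall s, (s < t)%N -> {ae P, forall w, u f s w = u g s w}) ->
  exists xh xhh : Omega -> 'cV[R]_(n1 + n2),
  [/\ factors (Y1 f t) xh /\ factors (Y f t) xhh,
      entrywise (orth P (Y1 f t)) (fun w => x f t w - xh w),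
      entrywise (orth P (Y f t)) (fun w => x f t w - xhh w) &
      {ae P, forall w, u g t w = estimator_feedback (F11 t) (F22 t) (K t) (J t)
         (x f t w) (xh w) (xhh w)}].
Proof.
move=> tN ufg; have tN' := ltnW tN.
have [xh [xhh [[fxh fxhh] oxh oxhh uE]]] := g_estimators tN.
have cE := common_ae ufg.
have xE : {ae P, forall w, x g t w = x f t w} by apply: filterS cE => w [].
have YE : {ae P, forall w, Y g t w = Y f t w} by apply: filterS cE => w [].
have Y1E : {ae P, forall w, Y1 g t w = Y1 f t w}.
  by apply: filterS YE => w /(congr1 fst).
have mx := (measurable_closed_loop A11 A21 A22 B11 B21 B22 sq_noise af).1 t tN'.
have [xh' [fxh' oxh' xhE]] :=
  transfer tN' (mY1 ag tN') (mY1 af tN') mx xE Y1E fxh oxh.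
have [xhh' [fxhh' oxhh' xhhE]] :=
  transfer tN' (mY ag tN') (mY af tN') mx xE YE fxhh oxhh.
exists xh', xhh'; split=> //.
have e12 : {ae P, forall w, xh w = xh' w /\ xhh w = xhh' w}.
  by apply: filterS2 xhE xhhE => w.
by apply: filterS3 xE uE e12 => w xE uE [<- <-]; rewrite uE xE.
Qed.

Lemma control_given_by_estimators :
  (forall t, (t <= N)%N -> sqintv P (x g t)) ->
  (forall t, (t < N)%N -> {ae P, forall w, u f t w = u g t w}) ->
  given_by_estimators P N A B x0 v F11 F22 K J f.
Proof.
move=> sx ufg.
have mx := (measurable_closed_loop A11 A21 A22 B11 B21 B22 sq_noise af).1.
have H t : exists xx : (Omega -> 'cV[R]_(n1 + n2)) * (Omega -> 'cV[R]_(n1 + n2)),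
    (t < N)%N ->
    [/\ cond_expectation_vec P (Y1 f t) (x f t) xx.1,
        cond_expectation_vec P (Y f t) (x f t) xx.2 &
        {ae P, forall w, u f t w = estimator_feedback (F11 t) (F22 t) (K t) (J t)
         (x f t w) (xx.1 w) (xx.2 w)}].
  (* From time N on, arbitrary zero estimators make the family total, so that choice applies. *)
  have [tN|] := ltnP t N; last by move=> _; exists (fun=> 0, fun=> 0).
  have ufgt s : (s < t)%N -> {ae P, forall w, u f s w = u g s w}.
    by move=> st; apply: ufg; exact: ltn_trans tN.
  have [xh [xhh [[fxh fxhh] oxh oxhh uE]]] := estimators_transfer tN ufgt.
  exists (xh, xhh) => _ /=; have tN' := ltnW tN.
  (* Integrability of the state under [f] is inherited from [g], with which it agrees almost
     surely. *)
  have ix i : integ P (fun w => x f t w i 0).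
    apply: (integ_ae_eq _ _ (sqint_integ (sx t tN' i))).
      exact: measurableT_comp (@measurable_mx_entry _ R _ _ i 0) (mx t tN').
    by apply: filterS (common_ae ufgt) => w [-> _].
  split.
  - move=> i; apply: (orth_cond_expectation (mY1 af tN')) => //.
      exact: factors_entry.
    by apply: (eq_orth _ (oxh i)) => w; rewrite entryD entryN.
  - move=> i; apply: (orth_cond_expectation (mY af tN')) => //.
      exact: factors_entry.
    by apply: (eq_orth _ (oxhh i)) => w; rewrite entryD entryN.
  - by apply: filterS2 uE (ufg t tN) => w <- ->.
have [xx Hxx] := choice H.
by exists (fun t => (xx t).1), (fun t => (xx t).2).
Qed.

(** Strong induction forward in time: agreement before t lets the estimators of [g] be transferred
    to the histories of [f], where uniqueness of conditional expectations matches them with those of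
    [f]; both controls at t are then given by the same formula. *)
Lemma given_by_estimators_control :
  given_by_estimators P N A B x0 v F11 F22 K J f ->
  forall t, (t < N)%N -> {ae P, forall w, u f t w = u g t w}.
Proof.
move=> [xh [xhh Hf]] t; elim/ltn_ind: t => t IHt tN.
have ufgt s : (s < t)%N -> {ae P, forall w, u f s w = u g s w}.
  by move=> st; apply: IHt => //; exact: ltn_trans tN.
have [c1 c2 uE] := Hf t tN; have tN' := ltnW tN.
have [xh' [xhh' [[fxh fxhh] oxh oxhh uE']]] := estimators_transfer tN ufgt.
have vec_ae (a b : Omega -> 'cV[R]_(n1 + n2)) :
    (forall i, {ae P, forall w, a w i 0 = b w i 0}) -> {ae P, forall w, a w = b w}.
  move=> H.
  have : {ae P, forall w, forall s, (s < n1 + n2)%N ->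
      forall i : 'I_(n1 + n2), i = s :> nat -> a w i 0 = b w i 0}.
    apply: ae_forall_lt => s sn; apply: filterS (H (Ordinal sn)) => w E i it.
    by have -> : i = Ordinal sn by exact/val_inj.
  by apply: filterS => w E; apply/matrixP => i j; rewrite (ord1 j); exact: (E i).
have e1 : {ae P, forall w, xh t w = xh' w}.
  apply: vec_ae => i; apply: (cond_expectation_ae_unique (mY1 af tN') (c1 i)).
    exact: factors_entry.
  by apply: (eq_orth _ (oxh i)) => w; rewrite entryD entryN.
have e2 : {ae P, forall w, xhh t w = xhh' w}.
  apply: vec_ae => i; apply: (cond_expectation_ae_unique (mY af tN') (c2 i)).
    exact: factors_entry.
  by apply: (eq_orth _ (oxhh i)) => w; rewrite entryD entryN.
have e12 : {ae P, forall w, xh t w = xh' w /\ xhh t w = xhh' w}.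
  by apply: filterS2 e1 e2 => w.
by apply: filterS3 uE uE' e12 => w -> -> [-> ->].
Qed.

End characterization.

(** Both sides are equivalent to almost sure agreement of the control of [f] with that of the linear
    optimal law before time N. *)
Theorem theorem1 (d : measure_display) (Omega : measurableType d)
    (R : realType) (P : probability Omega R)
    (N n1 n2 m1 m2 : nat)
    (A11 : 'M[R]_(n1, n1)) (A21 : 'M[R]_(n2, n1)) (A22 : 'M[R]_(n2, n2))
    (B11 : 'M[R]_(n1, m1)) (B21 : 'M[R]_(n2, m1)) (B22 : 'M[R]_(n2, m2))
    (Q S V : 'M[R]_(n1 + n2)) (W : 'M[R]_(m1 + m2))
    (x0 : Omega -> 'cV[R]_(n1 + n2))
    (v : nat -> Omega -> 'cV[R]_(n1 + n2))
    (F11 : nat -> 'M[R]_(m1, n1)) (F22 : nat -> 'M[R]_(m2, n2))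
    (L1 : forall t, {linear local_hist R n1 m1 t -> 'cV[R]_m1})
    (L2 : forall t,
       {linear (local_hist R n1 m1 t * local_hist R n2 m2 t)%type -> 'cV[R]_m2})
    (Pm : nat -> 'M[R]_(n1 + n2)) (K : nat -> 'M[R]_(m1 + m2, n1 + n2))
    (Pt : nat -> 'M[R]_n2) (J : nat -> 'M[R]_(m2, n2)) :
  let A := block_mx A11 0 A21 A22 in
  let B := block_mx B11 0 B21 B22 in
  posdefmx Q -> posdefmx W -> posdefmx S ->
  gaussian_vector P x0 ->
  (forall t, (t < N)%N ->
     gaussian_vector P (v t) /\ covariance_matrix P (v t) V) ->
  mutually_independent P
    (fun i : option 'I_N => if i is Some t then v t else x0) ->
  optimal P N A B Q W S x0 v (linear_law F11 F22 L1 L2) ->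
  riccati N A B Q W S Pm K ->
  riccati N A22 B22 (drsubmx Q) (drsubmx W) (drsubmx S) Pt J ->
  forall f : law R n1 n2 m1 m2, admissible N f ->
    (optimal P N A B Q W S x0 v f <->
     given_by_estimators P N A B x0 v F11 F22 K J f).
Proof.
move=> A B pQ pW pS gx0 gv mindep opt ric ric2 f af.
have moments t : (t <= N)%N -> sqintv P (noise x0 v t) /\
    forall i, \int[P]_w noise x0 v t w i 0 = 0.
  case: t => [_|t tN]; first exact: gaussian_vector_moments.
  by have [gvt _] := gv t tN; exact: gaussian_vector_moments.
have sq t (tN : (t <= N)%N) := (moments t tN).1.
have mean t (tN : (t <= N)%N) := (moments t tN).2.
have afs : admissible N (linear_law F11 F22 L1 L2) by case: opt.
have est := linear_law_estimators pQ pW pS sq mean mindep ric ric2 opt.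
rewrite (optimal_iff_control pQ pW pS sq opt af); split.
  apply: (control_given_by_estimators sq af afs est).
  exact: (sqint_state_control A11 A21 A22 B11 B21 B22 F11 F22 L1 L2 sq (leqnn N)).1.
exact: (given_by_estimators_control sq af afs est).
Qed.
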